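(* For a linear electromagnetic-gravitational perturbation of the Kerr-Newman spacetime, the following quantities are gauge-invariant, i.e. unchanged under every linear frame transformation (as defined in the context): the symmetric traceless 2-tensors $A$, $\underline A$, $$\mathfrak F=-\tfrac12{}^c\mathcal D\widehat\otimes B_{\mathbf F}-\tfrac32H\widehat\otimes B_{\mathbf F}+P_{\mathbf F}\widehat X,\qquad \underline{\mathfrak F}=-\tfrac12{}^c\mathcal D\widehat\otimes\underline B_{\mathbf F}-\tfrac32\underline H\widehat\otimes\underline B_{\mathbf F}-\overline{P_{\mathbf F}}\,\underline{\widehat X},$$ and the 1-tensors $$\mathfrak B=2P_{\mathbf F}B-3\overline P\,B_{\mathbf F},\qquad\underline{\mathfrak B}=2\overline{P_{\mathbf F}}\,\underline B-3P\,\underline B_{\mathbf F},$$ $$\mathfrak X={}^c\nabla_4B_{\mathbf F}+\tfrac32\overline{\mathrm{tr}X}\,B_{\mathbf F}-2P_{\mathbf F}\Xi,\qquad\underline{\mathfrak X}={}^c\nabla_3\underline B_{\mathbf F}+\tfrac32\overline{\mathrm{tr}\underline X}\,\underline B_{\mathbf F}+2\overline{P_{\mathbf F}}\,\underline\Xi.$$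
   Context: **Formalism.** $(\mathcal M,\mathbf g)$ is a 4-dimensional Lorentzian manifold with Levi-Civita connection $\mathbf D$, a null pair $(e_3,e_4)$ with $\mathbf g(e_3,e_4)=-2$, and an antisymmetric 2-tensor $\mathbf F$. A vector is horizontal if orthogonal to $e_3,e_4$; $(e_a)_{a=1,2}$ is a local orthonormal frame of horizontal vectors, $\in_{ab}$ the horizontal volume form ($\in_{12}=1$, orientation fixed); repeated horizontal indices are summed. $\nabla_a,\nabla_3,\nabla_4$ are the horizontal projections of $\mathbf D_{e_a},\mathbf D_{e_3},\mathbf D_{e_4}$ acting on horizontal tensors. Connection coefficients: $\chi_{ab}=\mathbf g(\mathbf D_ae_4,e_b)$, $\underline\chi_{ab}=\mathbf g(\mathbf D_ae_3,e_b)$, $\eta_a=\frac12\mathbf g(\mathbf D_3e_4,e_a)$, $\underline\eta_a=\frac12\mathbf g(\mathbf D_4e_3,e_a)$, $\xi_a=\frac12\mathbf g(\mathbf D_4e_4,e_a)$, $\underline\xi_a=\frac12\mathbf g(\mathbf D_3e_3,e_a)$, $\zeta_a=\frac12\mathbf g(\mathbf D_ae_4,e_3)$, $\omega=\frac14\mathbf g(\mathbf D_4e_4,e_3)$, $\underline\omega=\frac14\mathbf g(\mathbf D_3e_3,e_4)$; $\mathrm{tr}\chi=\delta^{ab}\chi_{ab}$, ${}^{(a)}\mathrm{tr}\chi=\in^{ab}\chi_{ab}$, $\hat\chi$ is the symmetric traceless part of $\chi$; similarly for $\underline\chi$. Electromagnetic components: $(\beta_{\mathbf F})_a=\mathbf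 F(e_a,e_4)$, $(\underline\beta_{\mathbf F})_a=\mathbf F(e_a,e_3)$, $\rho_{\mathbf F}=\frac12\mathbf F(e_3,e_4)$, $\mathbf F(e_a,e_b)=-\in_{ab}{}^*\rho_{\mathbf F}$. Curvature: $[\mathbf D_\mu,\mathbf D_\nu]f_\gamma=\mathbf R_{\gamma\delta\mu\nu}f^\delta$, $\mathbf W$ is the Weyl tensor, $\alpha_{ab}=\mathbf W(e_4,e_a,e_4,e_b)$, $\underline\alpha_{ab}=\mathbf W(e_3,e_a,e_3,e_b)$, $\beta_a=\frac12\mathbf W(e_a,e_4,e_3,e_4)$, $\underline\beta_a=\frac12\mathbf W(e_a,e_3,e_3,e_4)$, $\rho=\frac14\mathbf W(e_4,e_3,e_4,e_3)$, $\mathbf W(e_a,e_b,e_3,e_4)=2\in_{ab}{}^*\rho$. **Complex notation.** ${}^*f_a=\in_{ab}f_b$, ${}^*u_{ab}=\in_{ac}u_{cb}$. $X=\chi+i{}^*\chi$, so $\mathrm{tr}X=\mathrm{tr}\chi-i\,{}^{(a)}\mathrm{tr}\chi$, $\widehat X=\hat\chi+i{}^*\hat\chi$, likewise $\underline X$; $H=\eta+i{}^*\eta$, $\underline H=\underline\eta+i{}^*\underline\eta$, $\Xi=\xi+i{}^*\xi$, $\underline\Xi=\underline\xi+i{}^*\underline\xi$, $Z=\zeta+i{}^*\zeta$, $A=\alpha+i{}^*\alpha$, $B=\beta+i{}^*\beta$, $P=\rho+i{}^*\rho$ (and $\underline A,\underline B$ similarly), $B_{\mathbf F}=\beta_{\mathbf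 F}+i{}^*\beta_{\mathbf F}$, $\underline B_{\mathbf F}=\underline\beta_{\mathbf F}+i{}^*\underline\beta_{\mathbf F}$, $P_{\mathbf F}=\rho_{\mathbf F}+i{}^*\rho_{\mathbf F}$. $(F\widehat\otimes G)_{ab}=\frac12(F_aG_b+F_bG_a-\delta_{ab}F\cdot G)$ (complex bilinear); $\mathcal D=\nabla+i{}^*\nabla$ with ${}^*\nabla_a=\in_{ab}\nabla_b$; $(\mathcal D\widehat\otimes F)_{ab}=\frac12(\mathcal D_aF_b+\mathcal D_bF_a-\delta_{ab}\mathcal D\cdot F)$. **Conformal derivatives.** A horizontal tensor has conformal type $s$ if it is multiplied by $\lambda^s$ under $e_4\to\lambda e_4$, $e_3\to\lambda^{-1}e_3$. On type $s$: ${}^c\nabla_3=\nabla_3-2s\underline\omega$, ${}^c\nabla_4=\nabla_4+2s\omega$, ${}^c\nabla_a=\nabla_a+s\zeta_a$, ${}^c\mathcal D=\mathcal D+sZ$. $B_{\mathbf F}$ has type $1$, $\underline B_{\mathbf F}$ type $-1$. **Kerr-Newman.** For $\sqrt{a^2+Q^2}<M$, in coordinates $(t,r,\theta,\varphi)$, with $\Delta=r^2-2Mr+a^2+Q^2$, $q=r+ia\cos\theta$, $|q|^2=r^2+a^2\cos^2\theta$, $$\mathbf g_{M,a,Q}=-\tfrac{\Delta}{|q|^2}(dt-a\sin^2\theta d\varphi)^2+\tfrac{|q|^2}{\Delta}dr^2+|q|^2d\theta^2+\tfrac{\sin^2\theta}{|q|^2}(a\,dt-(r^2+a^2)d\varphi)^2,$$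 with principal null frame $e_4=\frac{r^2+a^2}{\Delta}\partial_t+\partial_r+\frac a\Delta\partial_\varphi$, $e_3=\frac{r^2+a^2}{|q|^2}\partial_t-\frac{\Delta}{|q|^2}\partial_r+\frac{a}{|q|^2}\partial_\varphi$, $e_1=\frac1{|q|}\partial_\theta$, $e_2=\frac{a\sin\theta}{|q|}\partial_t+\frac{1}{|q|\sin\theta}\partial_\varphi$. In it $\widehat X,\underline{\widehat X},\Xi,\underline\Xi,A,B,\underline B,\underline A,B_{\mathbf F},\underline B_{\mathbf F}$ vanish, while $P_{\mathbf F}=Q/\overline q^2$, $P=-\frac{2M}{q^3}+\frac{2Q^2}{q^3\overline q}$. **Linear perturbations.** A linear electromagnetic-gravitational perturbation of Kerr-Newman is a solution, with a null frame, of the Einstein-Maxwell equations $\mathbf R_{\mu\nu}=2\mathbf F_{\mu\lambda}\mathbf F_\nu{}^\lambda-\frac12\mathbf g_{\mu\nu}\mathbf F^{\alpha\beta}\mathbf F_{\alpha\beta}$, $\mathbf D_{[\mu}\mathbf F_{\nu\lambda]}=0$, $\mathbf D^\mu\mathbf F_{\mu\nu}=0$, in which expressions quadratic in the quantities vanishing in Kerr-Newman ($\widehat X,\underline{\widehat X},\Xi,\underline\Xi,A,B,\underline B,\underline A,B_{\mathbf F},\underline B_{\mathbf F}$, and their derivatives) are neglected. **Linear frame transformations.** A linear frame transformation is $e_4'=e_4+\mu_ae_a$, $e_3'=e_3+\underline\mu_ae_a$, $e_a'=e_a+\frac12\underline\mu_ae_4+\frac12\mu_ae_3$, with $\mu,\underline\mu$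 real horizontal 1-forms, where expressions quadratic in $\mu,\underline\mu$ and the quantities $\widehat X,\underline{\widehat X},\Xi,\underline\Xi,A,B,\underline B,\underline A,B_{\mathbf F},\underline B_{\mathbf F}$ that vanish in Kerr-Newman (and derivatives) are neglected. A horizontal tensor $\Psi$ built from the frame is gauge-invariant if the corresponding tensor $\Psi'$ built from the transformed frame satisfies $\Psi'=\Psi$ (components compared in the respective frames, modulo quadratic expressions). *)

(* Defs.v *)
From mathcomp Require Import all_boot all_order all_algebra.
From mathcomp Require Import all_classical all_reals all_analysis.
From mathcomp Require Export complex.

Set Implicit Arguments.
Unset Strict Implicit.
Unset Printing Implicit Defensive.

Import Order.TTheory GRing.Theory Num.Theory.
Import numFieldNormedType.Exports.

Local Open Scope classical_set_scope.
Local Open Scope ring_scope.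
Local Open Scope complex_scope.

(** ** Calculus on open sets *)

Section Calculus.
Context {R : realType}.

Definition iter_derive (V : normedModType R) (vs : seq V) (f : V -> R) :
    V -> R :=
  foldr (fun v h => fun x => 'D_v h x) f vs.

(* On an open subset of a finite-dimensional space this is C^infinity. *)
Definition smooth_on (V : normedModType R) (O : set V) (f : V -> R) : Prop :=
  forall (vs : seq V) (x : V), O x ->
    {for x, continuous (iter_derive vs f)} /\
    (forall v : V, derivable (iter_derive vs f) x v).

(* Joint smoothness in the parameter and the point, on ]-eps0, eps0[ x U. *)
Definition smooth_family (eps0 : R) (U : set 'rV[R]_4)
    (f : R -> 'rV[R]_4 -> R) : Prop :=
  smooth_on [set p : R * 'rV[R]_4 | `|p.1| < eps0 /\ U p.2]
    (fun p => f p.1 p.2).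

(* f = O(eps^2) as eps tends to 0. *)
Definition negligible (f : R -> R) : Prop :=
  exists C : R, \forall eps \near (0 : R), `|f eps| <= C * eps ^+ 2.

Definition eq_mod_quadratic (f h : R -> R[i]) : Prop :=
  negligible (fun eps => ComplexField.Normc.normc (f eps - h eps)).

Definition deriveC (v : 'rV[R]_4) (f : 'rV[R]_4 -> R[i]) (x : 'rV[R]_4) :
    R[i] :=
  'D_v (fun y => complex.Re (f y)) x +i* 'D_v (fun y => complex.Im (f y)) x.

End Calculus.

(** ** Lorentzian geometry in a coordinate chart of dimension 4 *)

Section Geometry.
Context {R : realType}.
Local Notation pt := 'rV[R]_4.

Definition vec4 (a b c d : R) : 'rV[R]_4 := \row_(j < 4) [:: a; b; c; d]`_j.

Definition bil (G : 'M[R]_4) (X Y : 'rV[R]_4) : R := (X *m G *m Y^T) 0 0.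

Definition pderive (i : 'I_4) (f : pt -> R) (x : pt) : R :=
  'D_(delta_mx 0 i) f x.

(* Gamma^k_(ij) *)
Definition christoffel (g : pt -> 'M[R]_4) (k i j : 'I_4) (x : pt) : R :=
  2^-1 * \sum_(l < 4) invmx (g x) k l *
    (pderive i (fun y => g y j l) x + pderive j (fun y => g y i l) x
     - pderive l (fun y => g y i j) x).

(* The Levi-Civita derivative D_X Y. *)
Definition cov (g : pt -> 'M[R]_4) (X Y : pt -> 'rV[R]_4) (x : pt) : 'rV[R]_4 :=
  \row_(k < 4) ('D_(X x) (fun y => Y y 0 k) x
    + \sum_(i < 4) \sum_(j < 4) christoffel g k i j x * X x 0 i * Y x 0 j).

(* R^k_(jmn), normalized by [D_m, D_n] f^k = R^k_(jmn) f^j. *)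
Definition riemann_up (g : pt -> 'M[R]_4) (k j m n : 'I_4) (x : pt) : R :=
  pderive m (christoffel g k n j) x - pderive n (christoffel g k m j) x
  + \sum_(l < 4) (christoffel g k m l x * christoffel g l n j x
                  - christoffel g k n l x * christoffel g l m j x).

Definition riemann (g : pt -> 'M[R]_4) (i j m n : 'I_4) (x : pt) : R :=
  \sum_(k < 4) g x i k * riemann_up g k j m n x.

Definition ricci (g : pt -> 'M[R]_4) (j n : 'I_4) (x : pt) : R :=
  \sum_(k < 4) riemann_up g k j k n x.

Definition scalar_curvature (g : pt -> 'M[R]_4) (x : pt) : R :=
  \sum_(j < 4) \sum_(n < 4) invmx (g x) j n * ricci g j n x.

Definition weyl_coord (g : pt -> 'M[R]_4) (i j m n : 'I_4) (x : pt) : R :=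
  riemann g i j m n x
  - 2^-1 * (g x i m * ricci g j n x + g x j n * ricci g i m x
            - g x i n * ricci g j m x - g x j m * ricci g i n x)
  + scalar_curvature g x / 6 * (g x i m * g x j n - g x i n * g x j m).

Definition weyl (g : pt -> 'M[R]_4) (x : pt) (X Y Z T : 'rV[R]_4) : R :=
  \sum_(i < 4) \sum_(j < 4) \sum_(m < 4) \sum_(n < 4)
    weyl_coord g i j m n x * X 0 i * Y 0 j * Z 0 m * T 0 n.

(* F_i^j *)
Definition raise (g F : pt -> 'M[R]_4) (i j : 'I_4) (x : pt) : R :=
  \sum_(k < 4) F x i k * invmx (g x) k j.

(* F^(ij) F_(ij) *)
Definition normF2 (g F : pt -> 'M[R]_4) (x : pt) : R :=
  \sum_(i < 4) \sum_(j < 4) \sum_(k < 4) \sum_(l < 4)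
    invmx (g x) i k * invmx (g x) j l * F x i j * F x k l.

(* D_i F_(jk) *)
Definition covF (g F : pt -> 'M[R]_4) (i j k : 'I_4) (x : pt) : R :=
  pderive i (fun y => F y j k) x
  - \sum_(l < 4) (christoffel g l i j x * F x l k
                  + christoffel g l i k x * F x j l).

Definition einstein_residual (g F : pt -> 'M[R]_4) (m n : 'I_4) (x : pt) : R :=
  ricci g m n x
  - (2 * \sum_(l < 4) F x m l * raise g F n l x
     - 2^-1 * g x m n * normF2 g F x).

(* For antisymmetric F this is 3 D_[i F_jk]. *)
Definition bianchi_residual (g F : pt -> 'M[R]_4) (i j k : 'I_4) (x : pt) : R :=
  covF g F i j k x + covF g F j k i x + covF g F k i j x.

Definition maxwell_residual (g F : pt -> 'M[R]_4) (n : 'I_4) (x : pt) : R :=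
  \sum_(k < 4) \sum_(m < 4) invmx (g x) k m * covF g F k m n x.

(** ** Spacetimes with a frame, and their components *)

(* [fh 0], [fh 1] are the horizontal vectors e_1, e_2. *)
Record frame := Frame {
  f3 : pt -> 'rV[R]_4;
  f4 : pt -> 'rV[R]_4;
  fh : 'I_2 -> pt -> 'rV[R]_4 }.

Record framed_spacetime := Framed {
  metric : pt -> 'M[R]_4;
  faraday : pt -> 'M[R]_4;
  fr :> frame }.

(* The existence of such a frame forces the signature of [G] to be (-+++). *)
Definition null_frame (G : 'M[R]_4) (e : frame) (x : pt) : Prop :=
  [/\ bil G (f3 e x) (f3 e x) = 0 /\ bil G (f4 e x) (f4 e x) = 0,
      bil G (f3 e x) (f4 e x) = - 2,
      forall a, bil G (fh e a x) (f3 e x) = 0 /\ bil G (fh e a x) (f4 e x) = 0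
    & forall a b, bil G (fh e a x) (fh e b x) = (a == b)%:R].

(* The horizontal volume form, in_12 = 1. *)
Definition vol (a b : 'I_2) : R := (b%:R - a%:R).

Section Components.
Variable S : framed_spacetime.
Local Notation e3 := (f3 S).
Local Notation e4 := (f4 S).
Local Notation e_ := (fh S).
Local Notation gx x := (bil (metric S x)).
Local Notation D := (cov (metric S)).
Local Notation W := (weyl (metric S)).
Local Notation Fx x := (bil (faraday S x)).

Definition chi (x : pt) (a b : 'I_2) : R := gx x (D (e_ a) e4 x) (e_ b x).
Definition chib (x : pt) (a b : 'I_2) : R := gx x (D (e_ a) e3 x) (e_ b x).
Definition eta (x : pt) (a : 'I_2) : R := 2^-1 * gx x (D e3 e4 x) (e_ a x).
Definition etab (x : pt) (a : 'I_2) : R := 2^-1 * gx x (D e4 e3 x) (e_ a x).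
Definition xi (x : pt) (a : 'I_2) : R := 2^-1 * gx x (D e4 e4 x) (e_ a x).
Definition xib (x : pt) (a : 'I_2) : R := 2^-1 * gx x (D e3 e3 x) (e_ a x).
Definition zeta (x : pt) (a : 'I_2) : R := 2^-1 * gx x (D (e_ a) e4 x) (e3 x).
Definition omega (x : pt) : R := 4^-1 * gx x (D e4 e4 x) (e3 x).
Definition omegab (x : pt) : R := 4^-1 * gx x (D e3 e3 x) (e4 x).

Definition betaF (x : pt) (a : 'I_2) : R := Fx x (e_ a x) (e4 x).
Definition betabF (x : pt) (a : 'I_2) : R := Fx x (e_ a x) (e3 x).
Definition rhoF (x : pt) : R := 2^-1 * Fx x (e3 x) (e4 x).
(* F(e_a, e_b) = - in_ab *rhoF *)
Definition rhodF (x : pt) : R := - Fx x (e_ 0 x) (e_ 1 x).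

Definition alpha (x : pt) (a b : 'I_2) : R :=
  W x (e4 x) (e_ a x) (e4 x) (e_ b x).
Definition alphab (x : pt) (a b : 'I_2) : R :=
  W x (e3 x) (e_ a x) (e3 x) (e_ b x).
Definition beta (x : pt) (a : 'I_2) : R :=
  2^-1 * W x (e_ a x) (e4 x) (e3 x) (e4 x).
Definition betab (x : pt) (a : 'I_2) : R :=
  2^-1 * W x (e_ a x) (e3 x) (e3 x) (e4 x).
Definition rho (x : pt) : R := 4^-1 * W x (e4 x) (e3 x) (e4 x) (e3 x).
(* W(e_a, e_b, e_3, e_4) = 2 in_ab *rho *)
Definition rhod (x : pt) : R :=
  2^-1 * W x (e_ 0 x) (e_ 1 x) (e3 x) (e4 x).

End Components.

(** ** Complex horizontal tensors *)

Definition dual1 (f : 'I_2 -> R) (a : 'I_2) : R := \sum_b vol a b * f b.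
Definition dual2 (u : 'I_2 -> 'I_2 -> R) (a b : 'I_2) : R :=
  \sum_c vol a c * u c b.
Definition cplx1 (f : 'I_2 -> R) (a : 'I_2) : R[i] := f a +i* dual1 f a.
Definition cplx2 (u : 'I_2 -> 'I_2 -> R) (a b : 'I_2) : R[i] :=
  u a b +i* dual2 u a b.

(* Symmetric traceless part. *)
Definition hat (u : 'I_2 -> 'I_2 -> R) (a b : 'I_2) : R :=
  2^-1 * (u a b + u b a - (a == b)%:R * \sum_c u c c).

Definition trR (u : 'I_2 -> 'I_2 -> R) : R := \sum_a u a a.
Definition atrR (u : 'I_2 -> 'I_2 -> R) : R := \sum_a \sum_b vol a b * u a b.

(* [symtl T] is (1/2)(T_ab + T_ba - delta_ab T_cc), so that
   the hat products F (x) G and D (x) F are [symtl] of F_a G_b and of D_a F_b. *)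
Definition symtl (T : 'I_2 -> 'I_2 -> R[i]) (a b : 'I_2) : R[i] :=
  2^-1 * (T a b + T b a - (a == b)%:R * \sum_c T c c).

Definition hot (F G : 'I_2 -> R[i]) : 'I_2 -> 'I_2 -> R[i] :=
  symtl (fun a b => F a * G b).

Section ComplexQuantities.
Variable S : framed_spacetime.
Local Notation e3 := (f3 S).
Local Notation e4 := (f4 S).
Local Notation e_ := (fh S).

(* Horizontal projection of D_V on complex horizontal 1-forms. *)
Definition nabla (V : pt -> 'rV[R]_4) (f : pt -> 'I_2 -> R[i]) (x : pt)
    (b : 'I_2) : R[i] :=
  deriveC (V x) (fun y => f y b) x
  - \sum_c (bil (metric S x) (cov (metric S) V (e_ b) x) (e_ c x))%:C * f x c.

Definition trX (x : pt) : R[i] := trR (chi S x) -i* atrR (chi S x).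
Definition trXb (x : pt) : R[i] := trR (chib S x) -i* atrR (chib S x).
Definition Xhat (x : pt) := cplx2 (hat (chi S x)).
Definition Xbhat (x : pt) := cplx2 (hat (chib S x)).
Definition Hc (x : pt) := cplx1 (eta S x).
Definition Hbc (x : pt) := cplx1 (etab S x).
Definition Xi (x : pt) := cplx1 (xi S x).
Definition Xib (x : pt) := cplx1 (xib S x).
Definition Zc (x : pt) := cplx1 (zeta S x).
Definition Ac (x : pt) := cplx2 (alpha S x).
Definition Abc (x : pt) := cplx2 (alphab S x).
Definition Bc (x : pt) := cplx1 (beta S x).
Definition Bbc (x : pt) := cplx1 (betab S x).
Definition Pc (x : pt) : R[i] := rho S x +i* rhod S x.
Definition BF (x : pt) := cplx1 (betaF S x).
Definition BbF (x : pt) := cplx1 (betabF S x).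
Definition PF (x : pt) : R[i] := rhoF S x +i* rhodF S x.

(* Conformal derivatives on complex horizontal 1-forms of type s. *)
Definition cnabla3 (s : int) (f : pt -> 'I_2 -> R[i]) (x : pt) (b : 'I_2) :=
  nabla e3 f x b - 2 * s%:~R * (omegab S x)%:C * f x b.
Definition cnabla4 (s : int) (f : pt -> 'I_2 -> R[i]) (x : pt) (b : 'I_2) :=
  nabla e4 f x b + 2 * s%:~R * (omega S x)%:C * f x b.
Definition Dc (f : pt -> 'I_2 -> R[i]) (x : pt) (a b : 'I_2) : R[i] :=
  nabla (e_ a) f x b + (0 +i* 1) * \sum_c (vol a c)%:C * nabla (e_ c) f x b.
Definition cDc (s : int) (f : pt -> 'I_2 -> R[i]) (x : pt) (a b : 'I_2) :=
  Dc f x a b + s%:~R * Zc x a * f x b.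

Definition frakF (x : pt) (a b : 'I_2) : R[i] :=
  - 2^-1 * symtl (cDc 1 BF x) a b - 3 / 2 * hot (Hc x) (BF x) a b
  + PF x * Xhat x a b.
Definition frakFb (x : pt) (a b : 'I_2) : R[i] :=
  - 2^-1 * symtl (cDc (- 1) BbF x) a b - 3 / 2 * hot (Hbc x) (BbF x) a b
  - conjc (PF x) * Xbhat x a b.
Definition frakB (x : pt) (a : 'I_2) : R[i] :=
  2 * PF x * Bc x a - 3 * conjc (Pc x) * BF x a.
Definition frakBb (x : pt) (a : 'I_2) : R[i] :=
  2 * conjc (PF x) * Bbc x a - 3 * Pc x * BbF x a.
Definition frakX (x : pt) (a : 'I_2) : R[i] :=
  cnabla4 1 BF x a + 3 / 2 * conjc (trX x) * BF x a - 2 * PF x * Xi x a.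
Definition frakXb (x : pt) (a : 'I_2) : R[i] :=
  cnabla3 (- 1) BbF x a + 3 / 2 * conjc (trXb x) * BbF x a
  + 2 * conjc (PF x) * Xib x a.

End ComplexQuantities.

(** ** Kerr-Newman *)

Section KerrNewman.
Variables (M a Q : R).

(* Coordinates (t, r, theta, phi). *)
Definition rad (x : pt) : R := x 0 1.
Definition theta (x : pt) : R := x 0 2.

Definition Delta (x : pt) : R :=
  rad x ^+ 2 - 2 * M * rad x + a ^+ 2 + Q ^+ 2.
Definition q (x : pt) : R[i] := rad x +i* (a * cos (theta x)).
Definition q2 (x : pt) : R := rad x ^+ 2 + a ^+ 2 * cos (theta x) ^+ 2.
Definition absq (x : pt) : R := Num.sqrt (q2 x).

(* Where the coordinates and the principal null frame are regular. *)
Definition KN_chart : set pt :=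
  [set x | [/\ 0 < theta x < pi, q2 x != 0 & Delta x != 0]].

Definition sq (w : 'rV[R]_4) : 'M[R]_4 := w^T *m w.

Definition KN_metric (x : pt) : 'M[R]_4 :=
  (- (Delta x / q2 x)) *: sq (vec4 1 0 0 (- a * sin (theta x) ^+ 2))
  + (q2 x / Delta x) *: sq (vec4 0 1 0 0)
  + q2 x *: sq (vec4 0 0 1 0)
  + (sin (theta x) ^+ 2 / q2 x) *: sq (vec4 a 0 0 (- (rad x ^+ 2 + a ^+ 2))).

Definition KN_e4 (x : pt) : 'rV[R]_4 :=
  vec4 ((rad x ^+ 2 + a ^+ 2) / Delta x) 1 0 (a / Delta x).
Definition KN_e3 (x : pt) : 'rV[R]_4 :=
  vec4 ((rad x ^+ 2 + a ^+ 2) / q2 x) (- (Delta x / q2 x)) 0 (a / q2 x).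
Definition KN_e1 (x : pt) : 'rV[R]_4 := vec4 0 0 (absq x)^-1 0.
Definition KN_e2 (x : pt) : 'rV[R]_4 :=
  vec4 (a * sin (theta x) / absq x) 0 0 (absq x * sin (theta x))^-1.

(* The background frame is the principal null frame, up to the remaining
   freedom: rescaling of the null pair, rotation of the horizontal vectors. *)
Definition KN_background (S : framed_spacetime) (x : pt) : Prop :=
  [/\ metric S x = KN_metric x,
      exists2 lam : R, 0 < lam &
        f4 S x = lam *: KN_e4 x /\ f3 S x = lam^-1 *: KN_e3 x,
      exists psi : R,
        fh S 0 x = cos psi *: KN_e1 x + sin psi *: KN_e2 x /\
        fh S 1 x = - sin psi *: KN_e1 x + cos psi *: KN_e2 x
    & [/\ forall b, BF S x b = 0, forall b, BbF S x b = 0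
        & PF S x = Q%:C / (conjc (q x)) ^+ 2]].

(** ** Linear perturbations and linear frame transformations *)

Definition smooth_spacetimes (eps0 : R) (U : set pt)
    (S : R -> framed_spacetime) : Prop :=
  [/\ forall i j, smooth_family eps0 U (fun eps x => metric (S eps) x i j),
      forall i j, smooth_family eps0 U (fun eps x => faraday (S eps) x i j),
      forall i, smooth_family eps0 U (fun eps x => f3 (S eps) x 0 i),
      forall i, smooth_family eps0 U (fun eps x => f4 (S eps) x 0 i)
    & forall b i, smooth_family eps0 U (fun eps x => fh (S eps) b x 0 i)].

(* A perturbation is a one-parameter family through Kerr-Newman; an expression
   quadratic in quantities that vanish at eps = 0 is O(eps^2), and equations
   are imposed up to such terms. *)
Definition linear_perturbation (eps0 : R) (U : set pt)
    (S : R -> framed_spacetime) : Prop :=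
  [/\ smooth_spacetimes eps0 U S,
      forall eps x, `|eps| < eps0 -> U x ->
        [/\ (metric (S eps) x)^T = metric (S eps) x,
            (faraday (S eps) x)^T = - faraday (S eps) x
          & null_frame (metric (S eps) x) (S eps) x],
      forall x, U x -> KN_background (S 0) x
    & forall x, U x ->
        [/\ forall m n, negligible (fun eps =>
              einstein_residual (metric (S eps)) (faraday (S eps)) m n x),
            forall i j k, negligible (fun eps =>
              bianchi_residual (metric (S eps)) (faraday (S eps)) i j k x)
          & forall n, negligible (fun eps =>
              maxwell_residual (metric (S eps)) (faraday (S eps)) n x)]].

End KerrNewman.

Definition transform_frame (mu mub : 'I_2 -> pt -> R) (e : frame) : frame :=
  Frame
    (fun x => f3 e x + \sum_b mub b x *: fh e b x)
    (fun x => f4 e x + \sum_b mu b x *: fh e b x)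
    (fun b x => fh e b x + (2^-1 * mub b x) *: f4 e x
                + (2^-1 * mu b x) *: f3 e x).

Definition transform (mu mub : 'I_2 -> pt -> R) (S : framed_spacetime) :
    framed_spacetime :=
  Framed (metric S) (faraday S) (transform_frame mu mub S).

(* Components, in the frame, of a first-order horizontal 1-form. *)
Definition linear_hform (eps0 : R) (U : set pt) (mu : R -> 'I_2 -> pt -> R) :
    Prop :=
  (forall b, smooth_family eps0 U (fun eps => mu eps b)) /\
  (forall b x, U x -> mu 0 b x = 0).

Definition gauge_invariant1 (eps0 : R) (U : set pt)
    (S : R -> framed_spacetime)
    (Psi : framed_spacetime -> pt -> 'I_2 -> R[i]) : Prop :=
  forall mu mub : R -> 'I_2 -> pt -> R,
    linear_hform eps0 U mu -> linear_hform eps0 U mub ->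
    forall x, U x -> forall b, eq_mod_quadratic
      (fun eps => Psi (transform (mu eps) (mub eps) (S eps)) x b)
      (fun eps => Psi (S eps) x b).

Definition gauge_invariant2 (eps0 : R) (U : set pt)
    (S : R -> framed_spacetime)
    (Psi : framed_spacetime -> pt -> 'I_2 -> 'I_2 -> R[i]) : Prop :=
  forall mu mub : R -> 'I_2 -> pt -> R,
    linear_hform eps0 U mu -> linear_hform eps0 U mub ->
    forall x, U x -> forall b c, eq_mod_quadratic
      (fun eps => Psi (transform (mu eps) (mub eps) (S eps)) x b c)
      (fun eps => Psi (S eps) x b c).

End Geometry.

Arguments frame R : clear implicits.
Arguments framed_spacetime R : clear implicits.

(* Main.v *)
(* Modulo eps^2 the variation of each quantity under a linear frame transformation
   is linear in mu, mub and their first derivatives, with coefficients taken on the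
   Kerr-Newman background. Invariance thus rests on background identities relative
   to e_4: xi, beta_F and the shear vanish, the Weyl tensor is of type D, and the
   Maxwell equations nabla_4 P_F = - conj(tr X) P_F, D P_F = - 2 H P_F hold; the
   underlined quantities follow by exchanging e_3 and e_4. Trace-freeness and the
   symmetries of the Weyl tensor reduce type D to the vanishing of W(4,a,4,b) and
   W(4,a,4,3). There the Ricci terms drop out by the Einstein equation since beta_F
   vanishes, and the Riemann tensor is computed from second derivatives of the
   metric and products of Christoffel symbols. *)
Require Import Defs.
From mathcomp Require Import all_boot all_order all_algebra.
From mathcomp Require Import all_classical all_reals all_analysis.
From mathcomp Require Import ring lra.
Require Import Defs.
Import Order.TTheory GRing.Theory Num.Theory.
Import numFieldNormedType.Exports.
Local Open Scope classical_set_scope.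
Local Open Scope ring_scope.
Set Implicit Arguments.
Unset Strict Implicit.
Unset Printing Implicit Defensive.

(** * Smooth families and first-order variations *)

(** Write M = mu + i *mu. To first order B_F varies by P_F M, B by (3/2) conj(P) M, Xi by (1/2)
    nabla_4 M + (1/4) conj(tr X) M + omega M, and Xhat by half the hat product of D + Z + H with M.
    The constants in the statement are those for which these variations cancel. All remaining
    factors multiply quantities that vanish at eps = 0, so only the existence of their first-order
    variation matters.

    The field equations hold modulo eps^2, hence exactly at eps = 0, and this is where the
    identities are used. On the background the scale of the null pair and the rotation of the
    horizontal pair are only known to exist at each point: the scale is read off as a component of a
    null vector, which makes it differentiable, and the rotation enters pointwise. The Kerr-Newman
    curvature is never expanded in coordinate components: it is contracted with the principal frame
    first, where the derivatives of the metric are short. *)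

Section SmoothOn.
Context {R : realType} {V : normedModType R}.
Variables (O : set V) (openO : open O).
Implicit Types (f g : V -> R) (x v : V).

Lemma iter_derive_rcons vs v f :
  iter_derive (rcons vs v) f = iter_derive vs (fun x => 'D_v f x).
Proof. by rewrite /iter_derive foldr_rcons. Qed.

Lemma near_open x : O x -> \near x, O x.
Proof. by move=> Ox; exact: open_nbhs_nbhs. Qed.

Lemma iter_derive_eq f g : (forall x, O x -> f x = g x) ->
  forall vs x, O x -> iter_derive vs f x = iter_derive vs g x.
Proof.
move=> fg; elim=> [|v vs IH] x Ox /=; first exact: fg.
apply: near_eq_derive; near=> y; apply: IH.
by near: y; exact: near_open.
Unshelve. all: by end_near. Qed.

(** Smoothness up to a finite order: products need an induction on the order, since the Leibniz rule
    returns f itself next to its derivative. *)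
Definition Ck n f := forall vs x, (size vs <= n)%N -> O x ->
  {for x, continuous (iter_derive vs f)} /\
  (forall v, derivable (iter_derive vs f) x v).

Lemma smooth_onP f : smooth_on O f <-> forall n, Ck n f.
Proof.
split=> [sf n vs x _ Ox|Cf vs x Ox]; first exact: sf.
exact: (Cf (size vs)).
Qed.

Lemma Ck_eq n f g : (forall x, O x -> f x = g x) -> Ck n f -> Ck n g.
Proof.
move=> fg Cf vs x svs Ox.
have nfg : \forall y \near x, iter_derive vs f y = iter_derive vs g y.
  by near=> y; apply: iter_derive_eq => //; near: y; exact: near_open.
have [cf df] := Cf vs x svs Ox; split=> [|v].
  rewrite /prop_for /continuous_at -(nbhs_singleton nfg).
  exact: cvg_trans (near_eq_cvg nfg) cf.
exact: near_eq_derivable nfg (df v).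
Unshelve. all: by end_near. Qed.

(** Peels off the innermost derivative, the last entry of the list, so that the Leibniz rule applies
    before the induction hypothesis. *)
Lemma CkS n f :
  Ck n.+1 f <-> Ck 0 f /\ forall v, Ck n (fun x => 'D_v f x).
Proof.
split=> [Cf|[C0 Cf]].
  split=> [vs x /leq_trans/(_ (leq0n n.+1)) svs Ox|v vs x svs Ox]; first exact: Cf.
  by rewrite -iter_derive_rcons; apply: Cf; rewrite ?size_rcons.
case/lastP=> [|vs v] x; first by move=> _; exact: C0.
by rewrite size_rcons ltnS iter_derive_rcons => svs Ox; exact: Cf.
Qed.

Lemma Ck0P f : Ck 0 f <-> forall x, O x ->
  {for x, continuous f} /\ (forall v, derivable f x v).
Proof.
split=> [Cf x Ox|Cf [|//] x _ Ox]; last exact: Cf.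
exact: (Cf [::]).
Qed.

Lemma CkW n f : Ck n.+1 f -> Ck n f.
Proof. by move=> Cf vs x svs; apply: Cf; rewrite ltnW. Qed.

Lemma CkD n f g : Ck n f -> Ck n g -> Ck n (fun x => f x + g x).
Proof.
elim: n f g => [|n IH] f g.
  move=> /Ck0P Cf /Ck0P Cg; apply/Ck0P => x Ox.
  have [cf df] := Cf x Ox; have [cg dg] := Cg x Ox.
  by split=> [|v]; [exact: continuousD|exact: derivableD].
move=> /[dup] Cf /CkS[C0f Cf'] /[dup] Cg /CkS[C0g Cg']; apply/CkS; split.
  move: C0f C0g => /Ck0P C0f /Ck0P C0g; apply/Ck0P => x Ox.
  have [cf df] := C0f x Ox; have [cg dg] := C0g x Ox.
  by split=> [|v]; [exact: continuousD|exact: derivableD].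
move=> v; apply: (Ck_eq _ (IH _ _ (Cf' v) (Cg' v))) => x Ox.
have [_ df] := (Ck0P f).1 C0f x Ox; have [_ dg] := (Ck0P g).1 C0g x Ox.
by rewrite -deriveD.
Qed.

Lemma CkM n f g : Ck n f -> Ck n g -> Ck n (fun x => f x * g x).
Proof.
have M0 f' g' : Ck 0 f' -> Ck 0 g' -> Ck 0 (fun x => f' x * g' x).
  move=> /Ck0P Cf /Ck0P Cg; apply/Ck0P => x Ox.
  have [cf df] := Cf x Ox; have [cg dg] := Cg x Ox.
  by split=> [|v]; [exact: continuousM|exact: derivableM].
elim: n f g => [|n IH] f g; first exact: M0.
move=> /[dup] Cf /CkS[C0f Cf'] /[dup] Cg /CkS[C0g Cg']; apply/CkS.
split=> [|v]; first exact: M0.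
apply: (Ck_eq _ (CkD (IH _ _ (CkW Cf) (Cg' v)) (IH _ _ (CkW Cg) (Cf' v)))) => x Ox.
have [_ df] := (Ck0P f).1 C0f x Ox; have [_ dg] := (Ck0P g).1 C0g x Ox.
by rewrite (deriveM (df v) (dg v)).
Qed.

Lemma smooth_on_eq f g :
  (forall x, O x -> f x = g x) -> smooth_on O f -> smooth_on O g.
Proof.
by move=> fg /smooth_onP Cf; apply/smooth_onP => n; exact: Ck_eq (Cf n).
Qed.

Lemma smooth_onD f g :
  smooth_on O f -> smooth_on O g -> smooth_on O (fun x => f x + g x).
Proof.
by move=> /smooth_onP Cf /smooth_onP Cg; apply/smooth_onP => n; exact: CkD.
Qed.

Lemma smooth_onM f g :
  smooth_on O f -> smooth_on O g -> smooth_on O (fun x => f x * g x).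
Proof.
by move=> /smooth_onP Cf /smooth_onP Cg; apply/smooth_onP => n; exact: CkM.
Qed.

Lemma smooth_on_cst (c : R) : smooth_on O (fun=> c).
Proof.
move=> vs x Ox.
have [c' ->] : exists c', iter_derive vs (fun=> c) = cst c' :> (V -> R).
  elim: vs => [|v vs [c' /= ->]] /=; first by exists c.
  by exists 0; apply/funext => y; rewrite derive_cst.
by split=> [|v]; [exact: cst_continuous|exact: derivable_cst].
Qed.

Lemma smooth_on_derive v f : smooth_on O f -> smooth_on O (fun x => 'D_v f x).
Proof. by move=> sf vs x Ox; rewrite -iter_derive_rcons; exact: sf. Qed.

Lemma smooth_on_derivable f x v : smooth_on O f -> O x -> derivable f x v.
Proof. by move=> sf Ox; have [_] := sf [::] x Ox; apply. Qed.

End SmoothOn.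

(** * Linearity of the directional derivative in its direction *)

Section DeriveLinear.
Context {R : realType} {V : normedModType R}.
Implicit Types (f : V -> R) (x u v : V).

Lemma derive_along f x v c :
  'D_(c *: v) f x = 'D_c (fun h : R => f (h *: v + x)) 0.
Proof.
rewrite /derive; set g1 := fun h => h^-1 *: _; set g2 := fun h => h^-1 *: _.
suff -> : g1 = g2 by [].
by rewrite funeqE /g1 /g2 => h /=; rewrite addr0 scale0r add0r scalerA.
Qed.

Lemma derive_along1 f x v :
  'D_v f x = 'D_1 (fun h : R => f (h *: v + x)) 0.
Proof. by rewrite -derive_along scale1r. Qed.

(** Only the restriction of f to one line matters, and in one variable derivability already is
    differentiability. *)
Lemma deriveZv f x v c : derivable f x v -> 'D_(c *: v) f x = c * 'D_v f x.
Proof.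
move=> /derivable1P/derivable1_diffP df; rewrite derive_along derive_along1 !deriveE//.
by rewrite -[in LHS](mulr1 c) -[c * 1]/(c *: 1) linearZ.
Qed.

Lemma mvt_along f y v (h : R) :
  (forall t : R, `|t| <= `|h| -> derivable f (t *: v + y) v) ->
  exists2 t : R, `|t| <= `|h| & f (h *: v + y) - f y = h * 'D_v f (t *: v + y).
Proof.
move=> df; pose p (t : R) := f (t *: v + y).
have dp (t : R) : `|t| <= `|h| -> is_derive t 1 p ('D_v f (t *: v + y)).
  move=> th; have E : (fun s : R => f (s *: v + (t *: v + y))) = p \o shift t.
    by apply/funext => s /=; rewrite /p scalerDl addrA.
  have /derivable1P := df t th; rewrite E => dpt.
  have D : derivable p t 1.
    have := dpt; rewrite /derivable /=; set g1 := fun h => h^-1 *: _.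
    set g2 := fun h => h^-1 *: _; suff -> : g1 = g2 by [].
    by apply/funext => s; rewrite /g1 /g2 /= addr0 add0r.
  apply: DeriveDef => //.
  rewrite [RHS]derive_along1 E /derive /=.
  set g1 := fun h => h^-1 *: _; set g2 := fun h => h^-1 *: _.
  by suff -> : g1 = g2; last by apply/funext => s; rewrite /g1 /g2 /= addr0 add0r.
have cp (a b : R) : (forall t, t \in `[a, b] -> `|t| <= `|h|) ->
    {within `[a, b], continuous p}.
  move=> H; apply: continuous_in_subspaceT => t /set_mem /= /H th.
  by have [/derivable1_diffP /differentiable_continuous] := dp t th.
have p0 : p 0 = f y by rewrite /p scale0r add0r.
have [h0|h0] := leP 0 h.
- have H (t : R) : t \in `[0, h] -> `|t| <= `|h|.
    by rewrite in_itv /= => /andP[t0 th]; rewrite !ger0_norm.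
  have [||t /H th] := MVT_segment h0 (df := fun t => 'D_v f (t *: v + y)) (f := p).
  + by move=> t; rewrite in_itv /= => /andP[/ltW t0 /ltW th]; apply/dp/H;
      rewrite in_itv /= t0.
  + exact: cp.
  by rewrite p0 subr0 mulrC => E; exists t.
- have H (t : R) : t \in `[h, 0] -> `|t| <= `|h|.
    by rewrite in_itv /= => /andP[th t0]; rewrite !ler0_norm ?lerN2// ltW.
  have [||t /H th] := MVT_segment (ltW h0) (df := fun t => 'D_v f (t *: v + y)) (f := p).
  + by move=> t; rewrite in_itv /= => /andP[/ltW t0 /ltW th]; apply/dp/H;
      rewrite in_itv /= t0.
  + exact: cp.
  rewrite p0 sub0r => E; exists t => //.
  by rewrite -[_ - _]opprB -/(p h) E mulrN opprK mulrC.
Qed.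

(** No total derivative is given, only continuous directional ones. The increment along u + v is
    split at x + h u; the second piece is, by the mean value theorem, ['D_v f] at a nearby point,
    and continuity of ['D_v f] gives the limit. *)
Lemma deriveDv (O : set V) (openO : open O) f x u v :
  smooth_on O f -> O x -> 'D_(u + v) f x = 'D_u f x + 'D_v f x.
Proof.
move=> sf Ox; apply: (cvg_lim (@Rhausdorff R)).
pose k (h : R) := h^-1 *: (f (h *: u + x) - f x).
pose l (h : R) := h^-1 *: (f (h *: v + (h *: u + x)) - f (h *: u + x)).
have -> : (fun h => h^-1 *: ((f \o shift x) (h *: (u + v)) - f x)) = k \+ l.
  apply/funext => h; rewrite /k /l /= -scalerDr; congr (_ *: _).
  by rewrite [RHS]addrC subrKA scalerDr addrA [h *: v + _]addrC.
apply: cvgD; first exact: smooth_on_derivable sf Ox.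
apply/cvgrPdist_lt => e e0.
have /cvgrPdist_lt/(_ e e0) ce : {for x, continuous (fun y => 'D_v f y)}.
  by have [] := sf [:: v] x Ox.
have : \forall y \near x, O y /\ `|'D_v f x - 'D_v f y| < e.
  by near=> y; split; near: y => //; exact: near_open.
case/nbhs_normP => r /= r0 xr.
have uv0 : 0 < `|u| + `|v| + 1 by rewrite ltr_wpDl.
(* All intermediate points stay within distance r of x; the + 1 keeps the divisor positive when u
   and v are zero. *)
have nr (h t : R) : `|h| < r / (`|u| + `|v| + 1) -> `|t| <= `|h| ->
    O (t *: v + (h *: u + x)) /\ `|'D_v f x - 'D_v f (t *: v + (h *: u + x))| < e.
  move=> hr th; apply: xr => /=; rewrite addrA opprD addrCA subrr addr0 normrN.
  rewrite (le_lt_trans (ler_normD _ _))// !normrZ.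
  apply: (@le_lt_trans _ _ (`|h| * (`|u| + `|v| + 1))).
    rewrite !mulrDr mulr1 -addrA [leRHS]addrCA lerD ?ler_wpM2r//.
    by rewrite lerDl.
  by rewrite -ltr_pdivlMr.
near=> h.
have hr : `|h| < r / (`|u| + `|v| + 1).
  near: h; apply: dnbhs0_lt; exact: divr_gt0.
have h0 : h != 0 by near: h; exact: nbhs_dnbhs_neq.
rewrite /l; have [t th ->] := @mvt_along f (h *: u + x) v h (fun t th =>
  (sf [::] _ (nr h t hr th).1).2 v).
by rewrite [_ *: _]mulKf//; exact: (nr h t hr th).2.
Unshelve. all: by end_near. Qed.

End DeriveLinear.

(** * First-order calculus in the perturbation parameter *)

Section FirstOrder.
Context {R : realType}.
Implicit Types f g h v w : R -> R.

Definition small f := exists C : R, \forall e \near (0 : R), `|f e| <= C * `|e|.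
Definition bdd f := exists C : R, \forall e \near (0 : R), `|f e| <= C.

Lemma small_bdd f : small f -> bdd f.
Proof.
case=> C nC; exists `|C|; near=> e.
have /le_trans-> // : `|f e| <= C * `|e| by near: e.
rewrite (le_trans (ler_norm _))// normrM normr_id ler_piMr//.
Unshelve. all: by end_near. Qed.

Lemma bddD f g : bdd f -> bdd g -> bdd (fun e => f e + g e).
Proof.
move=> [C nC] [D nD]; exists (C + D); near=> e.
by rewrite (le_trans (ler_normD _ _))// lerD//; near: e.
Unshelve. all: by end_near. Qed.

Lemma bdd_cst (c : R) : bdd (fun=> c).
Proof. by exists `|c|; near=> e. Unshelve. all: by end_near. Qed.

Lemma smallD f g : small f -> small g -> small (fun e => f e + g e).
Proof.
move=> [C nC] [D nD]; exists (C + D); near=> e.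
by rewrite (le_trans (ler_normD _ _))// mulrDl lerD//; near: e.
Unshelve. all: by end_near. Qed.

Lemma smallM f g : bdd f -> small g -> small (fun e => f e * g e).
Proof.
move=> [C nC] [D nD]; exists (C * D); near=> e.
by rewrite normrM -mulrA ler_pM//; near: e.
Unshelve. all: by end_near. Qed.

Lemma small0 : small (fun=> 0).
Proof. by exists 0; near=> e; rewrite normr0 mul0r. Unshelve. all: by end_near. Qed.

Lemma negligibleD f g :
  negligible f -> negligible g -> negligible (fun e => f e + g e).
Proof.
move=> [C nC] [D nD]; exists (C + D); near=> e.
by rewrite (le_trans (ler_normD _ _))// mulrDl lerD//; near: e.
Unshelve. all: by end_near. Qed.

Lemma negligibleM f g :
  bdd f -> negligible g -> negligible (fun e => f e * g e).
Proof.
move=> [C nC] [D nD]; exists (C * D); near=> e.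
by rewrite normrM -mulrA ler_pM//; near: e.
Unshelve. all: by end_near. Qed.

Lemma small_small f g : small f -> small g -> negligible (fun e => f e * g e).
Proof.
move=> [C nC] [D nD]; exists (C * D); near=> e.
rewrite normrM -real_normK ?num_real// expr2 mulrACA.
by rewrite ler_pM//; near: e.
Unshelve. all: by end_near. Qed.

Lemma negligible0 : negligible (fun=> 0 : R).
Proof. by exists 0; near=> e; rewrite normr0 mul0r. Unshelve. all: by end_near. Qed.

Lemma negligible_small f : negligible f -> small f.
Proof.
case=> C nC; exists `|C|; near=> e.
have /le_trans-> // : `|f e| <= C * e ^+ 2 by near: e.
rewrite (le_trans (ler_norm _))// normrM ler_wpM2l// normrX expr2 ler_piMr//.
Unshelve. all: by end_near. Qed.

Lemma small_eq f g : (\forall e \near 0, f e = g e) -> small f -> small g.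
Proof.
move=> fg [C nC]; exists C; near=> e.
have <- : f e = g e by near: e.
by near: e.
Unshelve. all: by end_near. Qed.

Lemma negligible_eq f g :
  (\forall e \near 0, f e = g e) -> negligible f -> negligible g.
Proof.
move=> fg [C nC]; exists C; near=> e.
have <- : f e = g e by near: e.
by near: e.
Unshelve. all: by end_near. Qed.

(** The neighbourhood of 0 contains 0, where the bound reads C * 0. Equations imposed up to
    quadratic terms are thus exact on the background. *)
Lemma negligible_at0 f : negligible f -> f 0 = 0.
Proof.
case=> C /nbhs_singleton; rewrite expr0n mulr0 => H.
by apply/eqP; rewrite -normr_le0.
Qed.

(* To first order in the perturbation, [f'] exceeds [f] by [v]. *)
Definition Var f f' v :=
  [/\ small (fun e => f e - f 0), small v & negligible (fun e => f' e - f e - v e)].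

Lemma Var_eq f f' v g g' w :
  (\forall e \near 0, f e = g e) -> (\forall e \near 0, f' e = g' e) ->
  (\forall e \near 0, v e = w e) -> Var f f' v -> Var g g' w.
Proof.
move=> fg fg' vw [sf sv n]; split.
- apply: small_eq sf; rewrite (nbhs_singleton fg).
  by near=> e; congr (_ - _); near: e.
- exact: small_eq sv.
- apply: negligible_eq n; near=> e.
  by congr (_ - _ - _); near: e.
Unshelve. all: by end_near. Qed.

Lemma Var_eqv f f' v w : v =1 w -> Var f f' v -> Var f f' w.
Proof. by move=> /funext->. Qed.

Lemma Var_base f : small (fun e => f e - f 0) -> Var f f (fun=> 0).
Proof.
move=> sf; split=> //; first exact: small0.
apply: negligible_eq negligible0.
by near=> e; rewrite subrr subr0.
Unshelve. all: by end_near. Qed.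

Lemma Var_cst (c : R) : Var (fun=> c) (fun=> c) (fun=> 0).
Proof. by apply: Var_base; rewrite subrr; exact: small0. Qed.

Lemma Var_small v : small v -> Var (fun=> 0) v v.
Proof.
move=> sv; split=> //; first by rewrite subrr; exact: small0.
apply: negligible_eq negligible0.
by near=> e; rewrite subr0 subrr.
Unshelve. all: by end_near. Qed.

Lemma VarD f f' v g g' w : Var f f' v -> Var g g' w ->
  Var (fun e => f e + g e) (fun e => f' e + g' e) (fun e => v e + w e).
Proof.
move=> [sf sv n] [sg sw m]; split; last 1 first.
- apply: negligible_eq (negligibleD n m); near=> e; ring.
- by apply: small_eq (smallD sf sg); near=> e; ring.
- exact: smallD.
Unshelve. all: by end_near. Qed.

(** Freezing the coefficients at 0 costs only a quadratic error because f and g move by O(e) while v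
    and w are themselves O(e). *)
Lemma VarM f f' v g g' w : Var f f' v -> Var g g' w ->
  Var (fun e => f e * g e) (fun e => f' e * g' e)
      (fun e => v e * g 0 + f 0 * w e).
Proof.
move=> [sf sv n] [sg sw m].
have bf : bdd f.
  have := bddD (small_bdd sf) (bdd_cst (f 0)).
  by rewrite (_ : (fun _ => _) = f)//; apply/funext => e; rewrite subrK.
have sg' : small (fun e => g' e - g 0).
  apply: small_eq (smallD (smallD (negligible_small m) sw) sg).
  by near=> e; ring.
have bg' : bdd g'.
  have := bddD (small_bdd sg') (bdd_cst (g 0)).
  by rewrite (_ : (fun _ => _) = g')//; apply/funext => e; rewrite subrK.
split; last 1 first.
(* The remainder is (f' - f - v) g' + v (g' - g 0) + f (g' - g - w) + (f - f 0) w. *)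
- have := negligibleD (negligibleD (negligibleM bg' n) (small_small sv sg'))
    (negligibleD (negligibleM bf m) (small_small sf sw)).
  by apply: negligible_eq; near=> e; ring.
- have := smallD (smallM bf sg) (smallM (bdd_cst (g 0)) sf).
  by apply: small_eq; near=> e; ring.
- have := smallD (smallM (bdd_cst (g 0)) sv) (smallM (bdd_cst (f 0)) sw).
  by apply: small_eq; near=> e; ring.
Unshelve. all: by end_near. Qed.

Lemma Var_sum (I : finType) (F F' v : I -> R -> R) :
  (forall i, Var (F i) (F' i) (v i)) ->
  Var (fun e => \sum_i F i e) (fun e => \sum_i F' i e) (fun e => \sum_i v i e).
Proof.
move=> H; elim: (index_enum I) => [|i s IH].
  under [X in Var X]funext do rewrite big_nil.
  under [X in Var _ X]funext do rewrite big_nil.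
  under [X in Var _ _ X]funext do rewrite big_nil.
  exact: Var_cst.
under [X in Var X]funext do rewrite big_cons.
under [X in Var _ X]funext do rewrite big_cons.
under [X in Var _ _ X]funext do rewrite big_cons.
exact: VarD.
Qed.

Lemma VarN f f' v : Var f f' v ->
  Var (fun e => - f e) (fun e => - f' e) (fun e => - v e).
Proof.
move=> H; have := VarM (Var_cst (- 1)) H.
by apply: Var_eq; near=> e; ring.
Unshelve. all: by end_near. Qed.

End FirstOrder.

(** * Functions whose directional derivatives are linear in the direction *)

Section Gradient.
Context {R : realType}.
Local Notation pt := 'rV[R]_4.
Implicit Types (f g : pt -> R) (x : pt).

(** Weaker than differentiability, but enough to expand derivatives along frame vectors in
    coordinates. The closure lemmas below carry this property and the derivative formula together,
    since each step of a composite expression needs both. *)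
Definition has_gradient f x := forall v : pt,
  derivable f x v /\ 'D_v f x = \sum_i v 0 i * pderive i f x.

Lemma gradD f g x : has_gradient f x -> has_gradient g x ->
  has_gradient (fun y => f y + g y) x /\
  forall v, 'D_v (fun y => f y + g y) x = 'D_v f x + 'D_v g x.
Proof.
move=> Gf Gg.
have E v : 'D_v (fun y => f y + g y) x = 'D_v f x + 'D_v g x.
  exact: deriveD (Gf v).1 (Gg v).1.
split=> // v; split; first exact: derivableD (Gf v).1 (Gg v).1.
rewrite E (Gf v).2 (Gg v).2 -big_split /=; apply: eq_bigr => i _.
by rewrite /pderive E mulrDr.
Qed.

Lemma gradM f g x : has_gradient f x -> has_gradient g x ->
  has_gradient (fun y => f y * g y) x /\
  forall v, 'D_v (fun y => f y * g y) x = 'D_v f x * g x + f x * 'D_v g x.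
Proof.
move=> Gf Gg.
have E v : 'D_v (fun y => f y * g y) x = 'D_v f x * g x + f x * 'D_v g x.
  by rewrite (deriveM (Gf v).1 (Gg v).1) addrC mulrC.
split=> // v; split; first exact: derivableM (Gf v).1 (Gg v).1.
rewrite E (Gf v).2 (Gg v).2 mulr_suml mulr_sumr -big_split /=.
by apply: eq_bigr => i _; rewrite /pderive E; ring.
Qed.

Lemma grad_cst (c : R) x :
  has_gradient (fun=> c) x /\ forall v, 'D_v (fun=> c) x = 0.
Proof.
split=> [v|v]; last exact: derive_cst.
split; first exact: derivable_cst.
by rewrite big1 => [|i _]; rewrite /pderive derive_cst ?mulr0.
Qed.

Lemma grad_sum (I : finType) (F : I -> pt -> R) x :
  (forall i, has_gradient (F i) x) ->
  has_gradient (fun y => \sum_i F i y) x /\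
  forall v, 'D_v (fun y => \sum_i F i y) x = \sum_i 'D_v (F i) x.
Proof.
move=> H; elim: (index_enum I) => [|i s [IHg IHd]].
  under [X in has_gradient X]funext do rewrite big_nil.
  have [? E] := grad_cst 0 x; split=> // v.
  under [X in derive X]funext do rewrite big_nil.
  by rewrite big_nil E.
under [X in has_gradient X]funext do rewrite big_cons.
have [? E] := gradD (H i) IHg; split=> // v.
under [X in derive X]funext do rewrite big_cons.
by rewrite big_cons E IHd.
Qed.

Lemma grad_eq f g (U : set pt) (openU : open U) x :
  (forall y, U y -> f y = g y) -> U x -> has_gradient f x ->
  has_gradient g x /\ forall v, 'D_v f x = 'D_v g x.
Proof.
move=> fg Ux Gf.
have nfg : \forall y \near x, f y = g y.
  by near=> y; apply: fg; near: y; exact: (near_open openU).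
have E v : 'D_v f x = 'D_v g x by exact: near_eq_derive.
split=> // v; split; first exact: near_eq_derivable nfg (Gf v).1.
by rewrite -E (Gf v).2; apply: eq_bigr => i _; rewrite /pderive E.
Unshelve. all: by end_near. Qed.

End Gradient.

(** * Families jointly smooth in the parameter and the point *)

Section SmoothFamily.
Context {R : realType}.
Local Notation pt := 'rV[R]_4.
Variables (eps0 : R) (U : set pt).
Hypotheses (eps0_gt0 : 0 < eps0) (openU : open U).
Implicit Types (f g : R -> pt -> R) (x v : pt).

Local Notation SF := (smooth_family eps0 U).
Local Notation O := [set p : R * pt | `|p.1| < eps0 /\ U p.2].

Lemma open_slab : open O.
Proof.
have -> : O = [set p : R * pt | `|p.1| < eps0] `&` [set p | U p.2] by [].
apply: openI.
  apply: (@open_comp _ _ (fun p : R * pt => `|p.1|) [set y | y < eps0]).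
    by move=> p _; apply: continuous_comp; [exact: cvg_fst|exact: norm_continuous].
  exact: open_lt.
by apply: (@open_comp _ _ snd U) => // p _; exact: cvg_snd.
Qed.

Lemma sfD f g : SF f -> SF g -> SF (fun e x => f e x + g e x).
Proof. exact: (smooth_onD open_slab). Qed.

Lemma sfM f g : SF f -> SF g -> SF (fun e x => f e x * g e x).
Proof. exact: (smooth_onM open_slab). Qed.

Lemma sf_cst (c : R) : SF (fun _ _ => c).
Proof. exact: smooth_on_cst. Qed.

Lemma sf_eq f g : (forall e x, `|e| < eps0 -> U x -> f e x = g e x) ->
  SF f -> SF g.
Proof.
by move=> fg; apply: (smooth_on_eq open_slab) => -[e x] /= []; exact: fg.
Qed.

Lemma sfN f : SF f -> SF (fun e x => - f e x).
Proof.
by move=> /(sfM (sf_cst (- 1))); apply: sf_eq => e x _ _; rewrite mulN1r.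
Qed.

Lemma sf_sum (I : finType) (F : I -> R -> pt -> R) :
  (forall i, SF (F i)) -> SF (fun e x => \sum_i F i e x).
Proof.
move=> H; elim: (index_enum I) => [|i s IH].
  by apply: sf_eq (sf_cst 0) => e x _ _; rewrite big_nil.
by apply: sf_eq (sfD (H i) IH) => e x _ _; rewrite big_cons.
Qed.

Lemma derive_slice f e x v :
  'D_((0, v) : R * pt) (fun p : R * pt => f p.1 p.2) (e, x) = 'D_v (f e) x.
Proof.
rewrite /derive; set g1 := fun h => h^-1 *: _; set g2 := fun h => h^-1 *: _.
suff -> : g1 = g2 by [].
by apply/funext => h; rewrite /g1 /g2 /= scaler0 add0r.
Qed.

Lemma derivable_slice f e x v :
  derivable (fun p : R * pt => f p.1 p.2) (e, x) ((0, v) : R * pt) ->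
  derivable (f e) x v.
Proof.
rewrite /derivable; set g1 := fun h => h^-1 *: _; set g2 := fun h => h^-1 *: _.
suff -> : g1 = g2 by [].
by apply/funext => h; rewrite /g1 /g2 /= scaler0 add0r.
Qed.

Lemma sf_derive v f : SF f -> SF (fun e x => 'D_v (f e) x).
Proof.
move=> /(smooth_on_derive ((0, v) : R * pt)); apply: (smooth_on_eq open_slab).
by move=> [e x] _ /=; rewrite derive_slice.
Qed.

(** Linearity in v comes from [deriveDv] and [deriveZv] on the product space, along the directions
    (0, v). *)
Lemma sf_grad f e x : SF f -> `|e| < eps0 -> U x -> has_gradient (f e) x.
Proof.
move=> sf e0 Ux v; have Oex : O (e, x) by [].
split; first exact: derivable_slice (smooth_on_derivable sf Oex).
rewrite -[in LHS]derive_slice.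
pose D (w : pt) := 'D_((0, w) : R * pt) (fun p : R * pt => f p.1 p.2) (e, x).
rewrite -/(D v) [v in LHS]row_sum_delta.
have DD w w' : D (w + w') = D w + D w'.
  rewrite -(deriveDv open_slab _ _ sf Oex); congr ('D_ _ _ _).
  by rewrite /= -[0 in LHS]addr0.
have DZ c w : D (c *: w) = c * D w.
  rewrite -(deriveZv _ (smooth_on_derivable sf Oex)); congr ('D_ _ _ _).
  by rewrite /= -[0 in LHS](scaler0 _ c).
have D0 : D 0 = 0 by rewrite -(scale0r 0) DZ mul0r.
rewrite (big_morph D DD D0); apply: eq_bigr => i _.
by rewrite DZ /D derive_slice.
Qed.

(** The difference quotient in the direction (1, 0) converges to some l, so near 0 it is bounded by
    |l| + 1. *)
Lemma sf_small f x : SF f -> U x -> small (fun e => f e x - f 0 x).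
Proof.
move=> sf Ux; have O0 : O (0, x) by rewrite /= normr0.
have : derivable (fun p : R * pt => f p.1 p.2) (0, x) ((1, 0) : R * pt).
  exact: smooth_on_derivable sf O0.
case/cvg_ex => /= l /cvgrPdist_lt/(_ 1 ltr01) nl.
exists (`|l| + 1); near=> e.
have [->|e0] := eqVneq e 0; first by rewrite subrr normr0 mulr0.
have : `|l - e^-1 *: (f (e *: 1 + 0) (e *: 0 + x) - f 0 x)| < 1.
  by move: e0; near: e; exact: nl.
rewrite scaler0 add0r addr0 -[e *: 1]/(e * 1) mulr1 => le1.
rewrite -ler_pdivrMr ?normr_gt0// mulrC -normfV -normrM.
rewrite -[X in `|X|](subKr l) (le_trans (ler_normB _ _))// lerD2l ltW//.
Unshelve. all: by end_near. Qed.

End SmoothFamily.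

(** * First-order variation of fields together with their first derivatives *)

Section FamilyVariation.
Context {R : realType}.
Local Notation pt := 'rV[R]_4.
Variables (eps0 : R) (U : set pt).
Hypotheses (eps0_gt0 : 0 < eps0) (openU : open U).
Implicit Types (f g v w : R -> pt -> R) (x : pt).

Local Notation SF := (smooth_family eps0 U).

Lemma near_eps0 : \forall e \near (0 : R), `|e| < eps0.
Proof. exact: nbhs0_lt. Qed.

Lemma eps0_0 : `|0 : R| < eps0. Proof. by rewrite normr0. Qed.

(** Connection coefficients differentiate the transformed frame, so the remainder must stay
    quadratic after one derivative, and that derivative must be the variation of the derivative. *)
Definition Var1 f f' v := forall x, U x ->
  [/\ Var (f^~ x) (f'^~ x) (v^~ x),
      forall k, Var (fun e => pderive k (f e) x) (fun e => pderive k (f' e) x)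
                    (fun e => pderive k (v e) x)
    & forall e, `|e| < eps0 -> [/\ has_gradient (f e) x,
                  has_gradient (f' e) x & has_gradient (v e) x]].

Lemma Var1_eq f f' v g g' w :
  (forall e x, `|e| < eps0 -> U x -> f e x = g e x) ->
  (forall e x, `|e| < eps0 -> U x -> f' e x = g' e x) ->
  (forall e x, `|e| < eps0 -> U x -> v e x = w e x) ->
  Var1 f f' v -> Var1 g g' w.
Proof.
move=> fg fg' vw H x Ux; have [V0 V1 G] := H x Ux.
have E (h h' : R -> pt -> R) : (forall e x, `|e| < eps0 -> U x -> h e x = h' e x) ->
    (forall e, `|e| < eps0 -> has_gradient (h e) x) ->
    [/\ \forall e \near 0, h e x = h' e x,
      forall k, \forall e \near 0, pderive k (h e) x = pderive k (h' e) x
      & forall e, `|e| < eps0 -> has_gradient (h' e) x].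
  move=> hh' Gh.
  have D e : `|e| < eps0 -> has_gradient (h' e) x /\
      forall k, 'D_k (h e) x = 'D_k (h' e) x.
    by move=> e0; apply: (grad_eq openU) (Gh e e0) => // y; exact: hh'.
  split=> [|k|e /D[]//]; near=> e; have e0 : `|e| < eps0 by near: e; exact: near_eps0.
    exact: hh'.
  exact: (D e e0).2.
have [f0 f1 fG] := E _ _ fg (fun e e0 => let: And3 a _ _ := G e e0 in a).
have [f'0 f'1 f'G] := E _ _ fg' (fun e e0 => let: And3 _ a _ := G e e0 in a).
have [v0 v1 vG] := E _ _ vw (fun e e0 => let: And3 _ _ a := G e e0 in a).
split=> [|k|e e0]; first exact: Var_eq V0.
  exact: Var_eq (V1 k).
by split; [exact: fG|exact: f'G|exact: vG].
Unshelve. all: by end_near. Qed.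

Lemma Var1D f f' v g g' w : Var1 f f' v -> Var1 g g' w ->
  Var1 (fun e x => f e x + g e x) (fun e x => f' e x + g' e x)
       (fun e x => v e x + w e x).
Proof.
move=> Hf Hg x Ux; have [f0 f1 fG] := Hf x Ux; have [g0 g1 gG] := Hg x Ux.
split=> [|k|e e0]; first exact: VarD.
  apply: Var_eq (VarD (f1 k) (g1 k)); near=> e.
  - have e0 : `|e| < eps0 by near: e; exact: near_eps0.
    have [a b c] := fG e e0; have [a' b' c'] := gG e e0.
    by rewrite /pderive (gradD a a').2.
  - have e0 : `|e| < eps0 by near: e; exact: near_eps0.
    have [a b c] := fG e e0; have [a' b' c'] := gG e e0.
    by rewrite /pderive (gradD b b').2.
  - have e0 : `|e| < eps0 by near: e; exact: near_eps0.
    have [a b c] := fG e e0; have [a' b' c'] := gG e e0.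
    by rewrite /pderive (gradD c c').2.
have [a b c] := fG e e0; have [a' b' c'] := gG e e0.
by split; [exact: (gradD a a').1|exact: (gradD b b').1|exact: (gradD c c').1].
Unshelve. all: by end_near. Qed.

Lemma Var1M f f' v g g' w : Var1 f f' v -> Var1 g g' w ->
  Var1 (fun e x => f e x * g e x) (fun e x => f' e x * g' e x)
       (fun e x => v e x * g 0 x + f 0 x * w e x).
Proof.
move=> Hf Hg x Ux; have [f0 f1 fG] := Hf x Ux; have [g0 g1 gG] := Hg x Ux.
have [fG0 _ _] := fG 0 eps0_0; have [gG0 _ _] := gG 0 eps0_0.
have vG e (e0 : `|e| < eps0) : has_gradient (fun x => v e x * g 0 x + f 0 x * w e x) x
    /\ forall k, 'D_k (fun x => v e x * g 0 x + f 0 x * w e x) x =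
      ('D_k (v e) x * g 0 x + v e x * 'D_k (g 0) x) +
      ('D_k (f 0) x * w e x + f 0 x * 'D_k (w e) x).
  have [a b c] := fG e e0; have [a' b' c'] := gG e e0.
  have [p P] := gradM c gG0; have [q Q] := gradM fG0 c'.
  have [r S] := gradD p q.
  by split=> // k; rewrite S P Q.
split=> [|k|e e0]; first exact: VarM.
  have := VarD (VarM (f1 k) g0) (VarM f0 (g1 k)).
  apply: Var_eq; near=> e.
  - have e0 : `|e| < eps0 by near: e; exact: near_eps0.
    have [a b c] := fG e e0; have [a' b' c'] := gG e e0.
    by rewrite /pderive (gradM a a').2.
  - have e0 : `|e| < eps0 by near: e; exact: near_eps0.
    have [a b c] := fG e e0; have [a' b' c'] := gG e e0.
    by rewrite /pderive (gradM b b').2.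
  - have e0 : `|e| < eps0 by near: e; exact: near_eps0.
    by rewrite /pderive (vG e e0).2; ring.
have [a b c] := fG e e0; have [a' b' c'] := gG e e0.
by split; [exact: (gradM a a').1|exact: (gradM b b').1|exact: (vG e e0).1].
Unshelve. all: by end_near. Qed.

Lemma Var1_base f : SF f -> Var1 f f (fun _ _ => 0).
Proof.
move=> sf x Ux; split=> [|k|e e0].
- exact: Var_base (sf_small eps0_gt0 sf Ux).
- have := Var_base (sf_small eps0_gt0 (sf_derive openU (delta_mx 0 k) sf) Ux).
  apply: Var_eq; near=> e => //.
  by rewrite /pderive (grad_cst 0 x).2.
- by split; [exact: (sf_grad openU sf e0 Ux)|exact: (sf_grad openU sf e0 Ux)|
    exact: (grad_cst 0 x).1].
Unshelve. all: by end_near. Qed.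

(** Since v vanishes at e = 0 on the whole open set U, its derivatives vanish there as well, hence
    are O(e). *)
Lemma Var1_small v : SF v -> (forall x, U x -> v 0 x = 0) ->
  Var1 (fun _ _ => 0) v v.
Proof.
move=> sv v0 x Ux.
have D0 k : 'D_(delta_mx 0 k) (v 0) x = 0.
  have [_ D] := grad_eq openU (fun y Uy => esym (v0 y Uy)) Ux (grad_cst 0 x).1.
  by rewrite -D (grad_cst 0 x).2.
split=> [|k|e e0].
- by apply: Var_small; have := sf_small eps0_gt0 sv Ux; rewrite v0//;
    under [X in small X]funext do rewrite subr0.
- have V : Var (fun=> 0) (fun e => pderive k (v e) x) (fun e => pderive k (v e) x).
    apply: Var_small; have := sf_small eps0_gt0 (sf_derive openU (delta_mx 0 k) sv) Ux.
    by rewrite D0; under [X in small X]funext do rewrite subr0.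
  by apply: Var_eq V; near=> e => //; rewrite /pderive (grad_cst 0 x).2.
- by split; [exact: (grad_cst 0 x).1|exact: (sf_grad openU sv e0 Ux)|
    exact: (sf_grad openU sv e0 Ux)].
Unshelve. all: by end_near. Qed.

Lemma Var1_sum (I : finType) (F F' v : I -> R -> pt -> R) :
  (forall i, Var1 (F i) (F' i) (v i)) ->
  Var1 (fun e x => \sum_i F i e x) (fun e x => \sum_i F' i e x)
       (fun e x => \sum_i v i e x).
Proof.
move=> H; elim: (index_enum I) => [|i s IH].
  by apply: Var1_eq (Var1_base (sf_cst 0)) => e x _ _; rewrite big_nil.
by apply: Var1_eq (Var1D (H i) IH) => e x _ _; rewrite big_cons.
Qed.

End FamilyVariation.

Section VectorVariation.
Context {R : realType}.
Local Notation pt := 'rV[R]_4.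
Variables (eps0 : R) (U : set pt).
Hypotheses (eps0_gt0 : 0 < eps0) (openU : open U).

Lemma bilE (G : 'M[R]_4) (X Y : pt) :
  bil G X Y = \sum_j (\sum_i X 0 i * G i j) * Y 0 j.
Proof. by rewrite /bil mxE; apply: eq_bigr => j _; rewrite !mxE. Qed.

Definition VVar (X X' w : R -> pt) := forall i,
  Var (fun e => X e 0 i) (fun e => X' e 0 i) (fun e => w e 0 i).

Definition VVar1 (X X' w : R -> pt -> pt) := forall i,
  Var1 eps0 U (fun e x => X e x 0 i) (fun e x => X' e x 0 i) (fun e x => w e x 0 i).

Lemma VVar1_at X X' w x : VVar1 X X' w -> U x -> VVar (X^~ x) (X'^~ x) (w^~ x).
Proof. by move=> H Ux i; have [] := H i x Ux. Qed.

Lemma Var_bil (G : R -> 'M[R]_4) X X' w Y Y' z :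
  (forall i j, small (fun e => G e i j - G 0 i j)) ->
  VVar X X' w -> VVar Y Y' z ->
  Var (fun e => bil (G e) (X e) (Y e)) (fun e => bil (G e) (X' e) (Y' e))
    (fun e => bil (G 0) (w e) (Y 0) + bil (G 0) (X 0) (z e)).
Proof.
move=> sG HX HY.
have := Var_sum (fun j => VarM (Var_sum (fun i => VarM (HX i) (Var_base (sG i j)))) (HY j)).
apply: Var_eq; near=> e; rewrite !bilE//.
rewrite -big_split; apply: eq_bigr => j _; congr (_ * _ + _).
by apply: eq_bigr => i _; rewrite mulr0 addr0.
Unshelve. all: by end_near. Qed.

Lemma Var1_bil (G : R -> pt -> 'M[R]_4) X X' w Y Y' z :
  (forall i j, smooth_family eps0 U (fun e x => G e x i j)) ->
  VVar1 X X' w -> VVar1 Y Y' z ->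
  Var1 eps0 U (fun e x => bil (G e x) (X e x) (Y e x))
    (fun e x => bil (G e x) (X' e x) (Y' e x))
    (fun e x => bil (G 0 x) (w e x) (Y 0 x) + bil (G 0 x) (X 0 x) (z e x)).
Proof.
move=> sG HX HY.
have := Var1_sum eps0_gt0 openU (fun j => Var1M eps0_gt0
  (Var1_sum eps0_gt0 openU (fun i => Var1M eps0_gt0 (HX i)
     (Var1_base eps0_gt0 openU (sG i j)))) (HY j)).
apply: (Var1_eq eps0_gt0 openU) => e x _ _; rewrite !bilE//.
rewrite -big_split; apply: eq_bigr => j _; congr (_ * _ + _).
by apply: eq_bigr => i _; rewrite mulr0 addr0.
Qed.

(** A frame transformation leaves the metric alone: the Christoffel symbols are the same on both
    sides, and the variation is the Leibniz rule in X and Y, evaluated with the background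
    connection. *)
Lemma Var_cov (g : R -> pt -> 'M[R]_4) X X' w Y Y' z x :
  (forall k i j, small (fun e => christoffel (g e) k i j x - christoffel (g 0) k i j x)) ->
  U x -> VVar (X^~ x) (X'^~ x) (w^~ x) -> VVar1 Y Y' z ->
  VVar (fun e => cov (g e) (X e) (Y e) x) (fun e => cov (g e) (X' e) (Y' e) x)
    (fun e => cov (g 0) (w e) (Y 0) x + cov (g 0) (X 0) (z e) x).
Proof.
move=> sG Ux HX HY k.
have [_ dY gY] := HY k x Ux.
have G0 := gY 0 (eps0_0 eps0_gt0).
have := VarD (Var_sum (fun i => VarM (HX i) (dY i)))
  (Var_sum (fun i => Var_sum (fun j => VarM (VarM (Var_base (sG k i j)) (HX i))
     (VVar1_at HY Ux j)))).
apply: Var_eq; near=> e.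
- have e0 : `|e| < eps0 by near: e; exact: near_eps0.
  by have [a b c] := gY e e0; rewrite /cov mxE (a _).2.
- have e0 : `|e| < eps0 by near: e; exact: near_eps0.
  by have [a b c] := gY e e0; rewrite /cov mxE (b _).2.
- have e0 : `|e| < eps0 by near: e; exact: near_eps0.
  have [a b c] := gY e e0; have [a' _ _] := G0.
  rewrite /cov !mxE (c _).2 (a' _).2 addrACA -!big_split /=.
  apply: eq_bigr => i _; congr (_ + _); rewrite -big_split; apply: eq_bigr => j _ /=.
  by rewrite mul0r add0r.
Unshelve. all: by end_near. Qed.

(** [weyl] is convertible to this for the array [weyl_coord]; multilinearity and index symmetries
    are then proved once, for any array. *)
Definition tensor4 (W : 'I_4 -> 'I_4 -> 'I_4 -> 'I_4 -> R) (X Y Z T : pt) :=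
  \sum_(i < 4) \sum_(j < 4) \sum_(m < 4) \sum_(n < 4)
    W i j m n * X 0 i * Y 0 j * Z 0 m * T 0 n.

Lemma Var_tensor4 (W : R -> 'I_4 -> 'I_4 -> 'I_4 -> 'I_4 -> R) X X' wX Y Y' wY
    Z Z' wZ T T' wT :
  (forall i j m n, small (fun e => W e i j m n - W 0 i j m n)) ->
  VVar X X' wX -> VVar Y Y' wY -> VVar Z Z' wZ -> VVar T T' wT ->
  Var (fun e => tensor4 (W e) (X e) (Y e) (Z e) (T e))
    (fun e => tensor4 (W e) (X' e) (Y' e) (Z' e) (T' e))
    (fun e => tensor4 (W 0) (wX e) (Y 0) (Z 0) (T 0)
      + tensor4 (W 0) (X 0) (wY e) (Z 0) (T 0)
      + tensor4 (W 0) (X 0) (Y 0) (wZ e) (T 0)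
      + tensor4 (W 0) (X 0) (Y 0) (Z 0) (wT e)).
Proof.
move=> sW HX HY HZ HT.
have := Var_sum (fun i => Var_sum (fun j => Var_sum (fun m => Var_sum (fun n =>
  VarM (VarM (VarM (VarM (Var_base (sW i j m n)) (HX i)) (HY j)) (HZ m)) (HT n))))).
apply: Var_eq; near=> e => //.
rewrite /tensor4 -!big_split; apply: eq_bigr => i _.
rewrite -!big_split; apply: eq_bigr => j _.
rewrite -!big_split; apply: eq_bigr => m _.
rewrite -!big_split; apply: eq_bigr => n _ /=.
by ring.
Unshelve. all: by end_near. Qed.

End VectorVariation.

(** * Null frames and the Levi-Civita connection *)

Section Bilinear.
Context {R : realType}.
Local Notation pt := 'rV[R]_4.
Implicit Types (G : 'M[R]_4) (X Y Z : pt).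

Lemma bilDl G X X' Y : bil G (X + X') Y = bil G X Y + bil G X' Y.
Proof. by rewrite /bil !mulmxDl mxE. Qed.
Lemma bilDr G X Y Y' : bil G X (Y + Y') = bil G X Y + bil G X Y'.
Proof. by rewrite /bil linearD mulmxDr mxE. Qed.
Lemma bilZl G (c : R) X Y : bil G (c *: X) Y = c * bil G X Y.
Proof. by rewrite /bil -!scalemxAl mxE. Qed.
Lemma bilZr G (c : R) X Y : bil G X (c *: Y) = c * bil G X Y.
Proof. by rewrite /bil linearZ -scalemxAr mxE. Qed.
Lemma bil_tr G X Y : bil G^T X Y = bil G Y X.
Proof.
rewrite /bil; suff -> : X *m G^T *m Y^T = (Y *m G *m X^T)^T by rewrite mxE.
by rewrite !trmx_mul trmxK mulmxA.
Qed.
Lemma bil_sym G X Y : G^T = G -> bil G X Y = bil G Y X.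
Proof. by move=> GT; rewrite -[in LHS]GT bil_tr. Qed.
Lemma bil_anti G X Y : G^T = - G -> bil G X Y = - bil G Y X.
Proof.
by move=> GT; rewrite -(bil_tr G X Y) GT /bil mulmxN mulNmx [in RHS]mxE opprK.
Qed.
(** The completeness relation of a null frame: by [null_frame_inv] this is the inverse metric. *)
Definition dual_metric (e : frame R) x : 'M[R]_4 :=
  - 2^-1 *: ((f3 e x)^T *m f4 e x + (f4 e x)^T *m f3 e x)
  + \sum_b (fh e b x)^T *m fh e b x.

Lemma mul_dual_metric G e x X : X *m G *m dual_metric e x =
  - 2^-1 *: (bil G X (f3 e x) *: f4 e x + bil G X (f4 e x) *: f3 e x)
  + \sum_b bil G X (fh e b x) *: fh e b x.
Proof.
have E Y Z : X *m G *m (Y^T *m Z) = bil G X Y *: Z.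
  by rewrite mulmxA [X *m G *m Y^T]mx11_scalar mul_scalar_mx.
rewrite /dual_metric mulmxDr -scalemxAr mulmxDr !E mulmx_sumr.
by congr (_ + _); apply: eq_bigr => b _; rewrite E.
Qed.

Definition frame_mx (e : frame R) x : 'M[R]_4 :=
  \matrix_(i < 4) [:: f3 e x; f4 e x; fh e 0 x; fh e 1 x]`_i.

(** The frame relations give E G N = E for the matrix E of frame vectors. The Gram matrix of the
    frame is constant and invertible, so E is invertible and cancels. *)
Lemma null_frame_inv G e x : G^T = G -> null_frame G e x ->
  G \in unitmx /\ invmx G = dual_metric e x.
Proof.
move=> GT [[e33 e44] e34 eh ehh].
have e43 : bil G (f4 e x) (f3 e x) = -2 by rewrite bil_sym.
pose E := frame_mx e x; pose N := dual_metric e x.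
have e3h b : bil G (f3 e x) (fh e b x) = 0 by rewrite bil_sym//; case: (eh b).
have e4h b : bil G (f4 e x) (fh e b x) = 0 by rewrite bil_sym//; case: (eh b).
have N3 : f3 e x *m G *m N = f3 e x.
  rewrite mul_dual_metric e33 e34 big1 => [|b _]; last by rewrite e3h scale0r.
  by rewrite scale0r add0r addr0 scalerA mulrNN mulVf ?scale1r// pnatr_eq0.
have N4 : f4 e x *m G *m N = f4 e x.
  rewrite mul_dual_metric e44 e43 big1 => [|b _]; last by rewrite e4h scale0r.
  by rewrite scale0r !addr0 scalerA mulrNN mulVf ?scale1r// pnatr_eq0.
have Nh a : fh e a x *m G *m N = fh e a x.
  rewrite mul_dual_metric (eh a).1 (eh a).2 !scale0r addr0 scaler0 add0r.
  rewrite (bigD1 a)//= big1 => [|b ba].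
    by rewrite ehh eqxx scale1r addr0.
  by rewrite ehh eq_sym (negbTE ba) scale0r.
have EGN : E *m G *m N = E.
  apply/row_matrixP => i; rewrite !row_mul rowK.
  by case: i => [[|[|[|[|//]]]] ?] /=.
(* The Gram matrix of (e_3, e_4, e_1, e_2), and below it its inverse. *)
pose eta : 'M[R]_4 := \matrix_(i < 4) [:: (-2) *: delta_mx 0 1; (-2) *: delta_mx 0 0;
  delta_mx 0 2%:R; delta_mx 0 3%:R]`_i.
pose eta' : 'M[R]_4 := \matrix_(i < 4) [:: (-2^-1) *: delta_mx 0 1; (-2^-1) *: delta_mx 0 0;
  delta_mx 0 2%:R; delta_mx 0 3%:R]`_i.
have Eeta : E *m G *m E^T = eta.
  apply/matrixP => i j.
  have -> : (E *m G *m E^T) i j = bil G (row i E) (row j E).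
    by rewrite /bil -row_mul !mxE; apply: eq_bigr => k _; rewrite !mxE.
  rewrite !rowK !mxE.
  case: i => [[|[|[|[|//]]]] ?]; case: j => [[|[|[|[|//]]]] ?] /=;
  rewrite !mxE /= ?(e33, e44, e34, e43, e3h, e4h, ehh, (eh _).1, (eh _).2) ?mulr0 ?mulr1 //.
have ee : eta *m eta' = 1%:M.
  apply/row_matrixP => i; rewrite row_mul rowK row1.
  case: i => [[|[|[|[|//]]]] ?] /=;
    rewrite -?scalemxAl -rowE rowK /= ?scalerA ?mulrNN ?mulfV ?pnatr_eq0 ?scale1r //.
  all: try by congr (delta_mx _ _); apply/val_inj.
have Eu : E \in unitmx.
  suff /mulmx1_unit[//] : E *m (G *m E^T *m eta') = 1%:M.
  by rewrite !mulmxA Eeta.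
have GN : G *m N = 1%:M.
  by rewrite -(mulKmx Eu (G *m N)) (mulmxA E) EGN mulVmx.
have [Gu _] := mulmx1_unit GN; split=> //.
by rewrite -[RHS](mulKmx Gu) GN mulmx1.
Qed.
End Bilinear.

(** * The connection through Christoffel symbols of the first kind *)

Section LowerChristoffel.
Context {R : realType}.
Local Notation pt := 'rV[R]_4.
Variables (g : pt -> 'M[R]_4) (x : pt).
Hypotheses (gT : (g x)^T = g x) (gu : g x \in unitmx).
Implicit Types (V Y Z : pt).

Definition dmetric V : 'M[R]_4 := \matrix_(i, j) 'D_V (fun y => g y i j) x.

Definition lower_gamma (l i j : 'I_4) : R := 2^-1 *
  (pderive i (fun y => g y j l) x + pderive j (fun y => g y i l) x
     - pderive l (fun y => g y i j) x).

Lemma lower_christoffel l i j :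
  \sum_k g x l k * christoffel g k i j x = lower_gamma l i j.
Proof.
pose b := \col_l lower_gamma l i j.
have E k : christoffel g k i j x = (invmx (g x) *m b) k 0.
  rewrite /christoffel mxE mulr_sumr; apply: eq_bigr => m _.
  by rewrite mxE /lower_gamma mulrCA mulrA.
have -> : lower_gamma l i j = (g x *m (invmx (g x) *m b)) l 0 by rewrite mulKVmx// mxE.
by rewrite mxE; apply: eq_bigr => k _; rewrite E.
Qed.

(* [2 Gamma_(Z, VY)], with the components of [V], [Y], [Z] frozen. *)
Definition frozen_conn V Y Z : R :=
  bil (dmetric V) Y Z + bil (dmetric Y) V Z - bil (dmetric Z) V Y.

Hypothesis gG : forall i j, has_gradient (fun y => g y i j) x.

Lemma dmetricE V i j : dmetric V i j = \sum_k V 0 k * pderive k (fun y => g y i j) x.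
Proof. by rewrite mxE (gG i j V).2. Qed.

Lemma sum_lower_gamma V Y Z :
  \sum_l \sum_i \sum_j lower_gamma l i j * V 0 i * Y 0 j * Z 0 l =
  2^-1 * frozen_conn V Y Z.
Proof.
have E1 : bil (dmetric V) Y Z = \sum_l \sum_i \sum_j
    pderive i (fun y => g y j l) x * V 0 i * Y 0 j * Z 0 l.
  rewrite bilE; apply: eq_bigr => l _; rewrite mulr_suml exchange_big /=.
  apply: eq_bigr => j _; rewrite dmetricE mulr_sumr mulr_suml.
  by apply: eq_bigr => i _; ring.
have E2 : bil (dmetric Y) V Z = \sum_l \sum_i \sum_j
    pderive j (fun y => g y i l) x * V 0 i * Y 0 j * Z 0 l.
  rewrite bilE; apply: eq_bigr => l _; rewrite mulr_suml.
  apply: eq_bigr => i _; rewrite dmetricE mulr_sumr mulr_suml.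
  by apply: eq_bigr => j _; ring.
have E3 : bil (dmetric Z) V Y = \sum_l \sum_i \sum_j
    pderive l (fun y => g y i j) x * V 0 i * Y 0 j * Z 0 l.
  rewrite exchange_big /=; under [RHS]eq_bigr do rewrite exchange_big /=.
  rewrite exchange_big /= bilE; apply: eq_bigr => j _; rewrite mulr_suml.
  apply: eq_bigr => i _; rewrite dmetricE mulr_sumr mulr_suml.
  by apply: eq_bigr => l _; ring.
rewrite /frozen_conn E1 E2 E3 -big_split -sumrB mulr_sumr; apply: eq_bigr => l _ /=.
rewrite -big_split -sumrB mulr_sumr; apply: eq_bigr => i _ /=.
rewrite -big_split -sumrB mulr_sumr; apply: eq_bigr => j _ /=.
by rewrite /lower_gamma; ring.
Qed.

(** Paired with a vector, the covariant derivative involves only derivatives of the metric; its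
    inverse disappears. All connection coefficients of Kerr-Newman are computed this way. *)
Lemma bil_cov (V Y : pt -> pt) Z :
  bil (g x) (cov g V Y x) Z =
  bil (g x) (\row_k 'D_(V x) (fun y => Y y 0 k) x) Z
  + 2^-1 * frozen_conn (V x) (Y x) Z.
Proof.
have -> : cov g V Y x = \row_k 'D_(V x) (fun y => Y y 0 k) x
    + \row_k (\sum_i \sum_j christoffel g k i j x * V x 0 i * Y x 0 j).
  by apply/rowP => k; rewrite !mxE.
rewrite bilDl; congr (_ + _); rewrite -sum_lower_gamma bilE.
apply: eq_bigr => l _; under eq_bigr do rewrite mxE mulr_suml.
rewrite exchange_big mulr_suml; apply: eq_bigr => i _ /=.
under eq_bigr do rewrite mulr_suml.
rewrite exchange_big mulr_suml; apply: eq_bigr => j _ /=.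
rewrite -lower_christoffel !mulr_suml; apply: eq_bigr => k _.
by rewrite -{1}gT mxE; ring.
Qed.

End LowerChristoffel.

Section MetricCompatibility.
Context {R : realType}.
Local Notation pt := 'rV[R]_4.
Variables (U : set pt) (openU : open U) (g : pt -> 'M[R]_4).
Hypothesis gT : forall y, U y -> (g y)^T = g y.
Variables (x : pt) (Ux : U x).
Hypothesis gu : g x \in unitmx.
Hypothesis gG : forall i j, has_gradient (fun y => g y i j) x.

Lemma dmetric_sym V : (dmetric g x V)^T = dmetric g x V.
Proof.
apply/matrixP => i j; rewrite !mxE.
have H y : U y -> g y j i = g y i j by move=> Uy; rewrite -[in LHS]gT// mxE.
by have [_ ->] := grad_eq openU H Ux (gG j i).
Qed.

Lemma derive_bil (Y Z : pt -> pt) (V : pt) :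
  (forall k, has_gradient (fun y => Y y 0 k) x) ->
  (forall k, has_gradient (fun y => Z y 0 k) x) ->
  has_gradient (fun y => bil (g y) (Y y) (Z y)) x /\
  'D_V (fun y => bil (g y) (Y y) (Z y)) x =
  bil (g x) (\row_k 'D_V (fun y => Y y 0 k) x) (Z x) + bil (dmetric g x V) (Y x) (Z x)
  + bil (g x) (Y x) (\row_k 'D_V (fun y => Z y 0 k) x).
Proof.
move=> GY GZ.
have G1 j i := gradM (GY i) (gG i j).
have G2 j := grad_sum (fun i => (G1 j i).1).
have G3 j := gradM (G2 j).1 (GZ j).
have [G D] := grad_sum (fun j => (G3 j).1).
under eq_fun do rewrite bilE; split=> //.
rewrite D !bilE -!big_split; apply: eq_bigr => j _ /=.
rewrite (G3 j).2 (G2 j).2 mxE -mulrDl -big_split; congr (_ * _ + _) => /=.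
by apply: eq_bigr => i _; rewrite (G1 j i).2 !mxE.
Qed.

(** In [frozen_conn] the last two terms are exchanged with opposite signs under Y <-> Z, so the
    symmetrization leaves twice the derivative of the metric along V. *)
Lemma metric_compat (V Y Z : pt -> pt) :
  (forall k, has_gradient (fun y => Y y 0 k) x) ->
  (forall k, has_gradient (fun y => Z y 0 k) x) ->
  'D_(V x) (fun y => bil (g y) (Y y) (Z y)) x =
  bil (g x) (cov g V Y x) (Z x) + bil (g x) (Y x) (cov g V Z x).
Proof.
move=> GY GZ; rewrite (derive_bil _ GY GZ).2 [bil (g x) (Y x) (cov _ _ _ _)]bil_sym ?gT//.
rewrite !bil_cov ?gT// /frozen_conn.
rewrite [bil (dmetric g x (V x)) (Z x) _]bil_sym ?dmetric_sym//.
rewrite [bil (g x) (Y x) _]bil_sym ?gT//.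
by field.
Qed.

End MetricCompatibility.

(** * Geometric quantities of the perturbed and of the transformed spacetime *)

Section PerturbedSpacetime.
Context {R : realType}.
Local Notation pt := 'rV[R]_4.
Variables (eps0 : R) (U : set pt).
Hypotheses (eps0_gt0 : 0 < eps0) (openU : open U).
Variable S : R -> framed_spacetime R.
Hypothesis smS : smooth_spacetimes eps0 U S.
Hypothesis nfS : forall e x, `|e| < eps0 -> U x ->
  [/\ (metric (S e) x)^T = metric (S e) x,
      (faraday (S e) x)^T = - faraday (S e) x
    & null_frame (metric (S e) x) (S e) x].

Local Notation SF := (smooth_family eps0 U).

Lemma sf_metric i j : SF (fun e x => metric (S e) x i j).
Proof. by case: smS. Qed.
Lemma sf_faraday i j : SF (fun e x => faraday (S e) x i j).
Proof. by case: smS. Qed.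
Lemma sf_f3 i : SF (fun e x => f3 (S e) x 0 i).
Proof. by case: smS. Qed.
Lemma sf_f4 i : SF (fun e x => f4 (S e) x 0 i).
Proof. by case: smS. Qed.
Lemma sf_fh b i : SF (fun e x => fh (S e) b x 0 i).
Proof. by case: smS. Qed.

(** By [null_frame_inv] the inverse metric is polynomial in the frame components, so its smoothness
    requires no division by a determinant. *)
Lemma sf_invmx i j : SF (fun e x => invmx (metric (S e) x) i j).
Proof.
have := sfD openU (sfM openU (sf_cst (- 2^-1))
    (sfD openU (sfM openU (sf_f3 i) (sf_f4 j)) (sfM openU (sf_f4 i) (sf_f3 j))))
  (sf_sum openU (fun b => sfM openU (sf_fh b i) (sf_fh b j))).
apply: (sf_eq openU) => e x e0 Ux.
have [gT _ nf] := nfS e0 Ux; have [_ ->] := null_frame_inv gT nf.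
rewrite /dual_metric !mxE !big_ord1 !mxE summxE; congr (_ + _).
by apply: eq_bigr => b _; rewrite !mxE big_ord1 !mxE.
Qed.

Lemma sf_christoffel k i j : SF (fun e x => christoffel (metric (S e)) k i j x).
Proof.
have P m a b : SF (fun e x => pderive m (fun y => metric (S e) y a b) x).
  exact: (sf_derive openU (delta_mx 0 m) (sf_metric a b)).
apply: (sfM openU (sf_cst 2^-1)); apply: (sf_sum openU) => l.
apply: (sfM openU (sf_invmx k l)); apply: (sfD openU) (sfN openU _) => //.
exact: (sfD openU).
Qed.

Lemma sf_riemann_up k j m n : SF (fun e x => riemann_up (metric (S e)) k j m n x).
Proof.
have P i a b c : SF (fun e x => pderive i (christoffel (metric (S e)) a b c) x).
  exact: (sf_derive openU (delta_mx 0 i) (sf_christoffel a b c)).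
apply: (sfD openU); first exact: (sfD openU) (sfN openU _).
by apply: (sf_sum openU) => l; apply: (sfD openU) (sfN openU _);
  apply: (sfM openU); exact: sf_christoffel.
Qed.

Lemma sf_ricci j n : SF (fun e x => ricci (metric (S e)) j n x).
Proof. by apply: (sf_sum openU) => k; exact: sf_riemann_up. Qed.

Lemma sf_weyl i j m n : SF (fun e x => weyl_coord (metric (S e)) i j m n x).
Proof.
have gR a b c d : SF (fun e x => metric (S e) x a b * ricci (metric (S e)) c d x).
  exact: (sfM openU (sf_metric a b) (sf_ricci c d)).
have gg a b c d : SF (fun e x => metric (S e) x a b * metric (S e) x c d).
  exact: (sfM openU (sf_metric a b) (sf_metric c d)).
have sc : SF (fun e x => scalar_curvature (metric (S e)) x).
  apply: (sf_sum openU) => a; apply: (sf_sum openU) => b.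
  exact: (sfM openU (sf_invmx a b) (sf_ricci a b)).
apply: (sfD openU); first apply: (sfD openU) (sfN openU _).
- by apply: (sf_sum openU) => k; apply: (sfM openU (sf_metric i k)); exact: sf_riemann_up.
- apply: (sfM openU (sf_cst 2^-1)).
  by apply: (sfD openU _ (sfN openU _)) => //; apply: (sfD openU _ (sfN openU _)) => //;
    exact: (sfD openU).
- apply: (sfM openU); first exact: (sfM openU sc (sf_cst _)).
  exact: (sfD openU _ (sfN openU _)).
Qed.

Variables mu mub : R -> 'I_2 -> pt -> R.
Hypotheses (linmu : linear_hform eps0 U mu) (linmub : linear_hform eps0 U mub).

Definition S' e := transform (mu e) (mub e) (S e).

(* The increments of the frame, with the background frame in place of the perturbed one. *)
Definition d4 e y : pt := \sum_b mu e b y *: fh (S 0) b y.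
Definition d3 e y : pt := \sum_b mub e b y *: fh (S 0) b y.
Definition dh b e y : pt :=
  (2^-1 * mub e b y) *: f4 (S 0) y + (2^-1 * mu e b y) *: f3 (S 0) y.

Lemma Var1_mulform (m : R -> 'I_2 -> pt -> R) b (h : R -> pt -> R) :
  linear_hform eps0 U m -> SF h ->
  Var1 eps0 U (fun _ _ => 0) (fun e y => m e b y * h e y)
    (fun e y => m e b y * h 0 y).
Proof.
move=> [sm m0] sh.
have := Var1M eps0_gt0 (Var1_small eps0_gt0 openU (sm b) (m0 b)) (Var1_base eps0_gt0 openU sh).
by apply: (Var1_eq eps0_gt0 openU) => e x _ _; rewrite ?mul0r ?addr0.
Qed.

Lemma VVar1_f4 : VVar1 eps0 U (fun e => f4 (S e)) (fun e => f4 (S' e)) d4.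
Proof.
move=> i; have := Var1D eps0_gt0 (Var1_base eps0_gt0 openU (sf_f4 i))
  (Var1_sum eps0_gt0 openU (fun b => Var1_mulform b linmu (sf_fh b i))).
apply: (Var1_eq eps0_gt0 openU) => e x _ _ /=.
- by rewrite big1// addr0.
- by rewrite !mxE summxE; under [in RHS]eq_bigr do rewrite mxE.
- by rewrite add0r summxE; apply: eq_bigr => b _; rewrite mxE.
Qed.

Lemma VVar1_f3 : VVar1 eps0 U (fun e => f3 (S e)) (fun e => f3 (S' e)) d3.
Proof.
move=> i; have := Var1D eps0_gt0 (Var1_base eps0_gt0 openU (sf_f3 i))
  (Var1_sum eps0_gt0 openU (fun b => Var1_mulform b linmub (sf_fh b i))).
apply: (Var1_eq eps0_gt0 openU) => e x _ _ /=.
- by rewrite big1// addr0.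
- by rewrite !mxE summxE; under [in RHS]eq_bigr do rewrite mxE.
- by rewrite add0r summxE; apply: eq_bigr => b _; rewrite mxE.
Qed.

Lemma VVar1_fh b : VVar1 eps0 U (fun e => fh (S e) b) (fun e => fh (S' e) b) (dh b).
Proof.
move=> i.
have half m h (Hm : linear_hform eps0 U m) (Hh : SF h) :=
  Var1M eps0_gt0 (Var1_base eps0_gt0 openU (sf_cst 2^-1)) (Var1_mulform b Hm Hh).
have := Var1D eps0_gt0 (Var1D eps0_gt0 (Var1_base eps0_gt0 openU (sf_fh b i))
  (half _ _ linmub (sf_f4 i))) (half _ _ linmu (sf_f3 i)).
apply: (Var1_eq eps0_gt0 openU) => e x _ _ /=; rewrite ?mxE; ring.
Qed.

Lemma Var_weyl X X' wX Y Y' wY Z Z' wZ T T' wT x : U x ->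
  VVar1 eps0 U X X' wX -> VVar1 eps0 U Y Y' wY -> VVar1 eps0 U Z Z' wZ ->
  VVar1 eps0 U T T' wT ->
  let W := weyl (metric (S 0)) x in
  Var (fun e => weyl (metric (S e)) x (X e x) (Y e x) (Z e x) (T e x))
    (fun e => weyl (metric (S e)) x (X' e x) (Y' e x) (Z' e x) (T' e x))
    (fun e => W (wX e x) (Y 0 x) (Z 0 x) (T 0 x) + W (X 0 x) (wY e x) (Z 0 x) (T 0 x)
      + W (X 0 x) (Y 0 x) (wZ e x) (T 0 x) + W (X 0 x) (Y 0 x) (Z 0 x) (wT e x)).
Proof.
move=> Ux HX HY HZ HT; have sW i j m n := sf_small eps0_gt0 (sf_weyl i j m n) Ux.
exact: (Var_tensor4 sW (VVar1_at HX Ux) (VVar1_at HY Ux) (VVar1_at HZ Ux) (VVar1_at HT Ux)).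
Qed.

Lemma Var_conn X X' wX Y Y' wY Z Z' wZ x : U x ->
  VVar1 eps0 U X X' wX -> VVar1 eps0 U Y Y' wY -> VVar1 eps0 U Z Z' wZ ->
  let g := metric (S 0) in
  Var (fun e => bil (metric (S e) x) (cov (metric (S e)) (X e) (Y e) x) (Z e x))
    (fun e => bil (metric (S e) x) (cov (metric (S e)) (X' e) (Y' e) x) (Z' e x))
    (fun e => bil (g x) (cov g (wX e) (Y 0) x + cov g (X 0) (wY e) x) (Z 0 x)
      + bil (g x) (cov g (X 0) (Y 0) x) (wZ e x)).
Proof.
move=> Ux HX HY HZ /=.
have sg i j := sf_small eps0_gt0 (sf_metric i j) Ux.
have sG k i j := sf_small eps0_gt0 (sf_christoffel k i j) Ux.
exact: (Var_bil sg (Var_cov eps0_gt0 sG Ux (VVar1_at HX Ux) HY) (VVar1_at HZ Ux)).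
Qed.

Lemma Var1_faraday X X' wX Y Y' wY :
  VVar1 eps0 U X X' wX -> VVar1 eps0 U Y Y' wY ->
  let F y := faraday (S 0) y in
  Var1 eps0 U (fun e y => bil (faraday (S e) y) (X e y) (Y e y))
    (fun e y => bil (faraday (S e) y) (X' e y) (Y' e y))
    (fun e y => bil (F y) (wX e y) (Y 0 y) + bil (F y) (X 0 y) (wY e y)).
Proof. by move=> HX HY; apply: (Var1_bil eps0_gt0 openU) => //; exact: sf_faraday. Qed.

End PerturbedSpacetime.

Local Open Scope complex_scope.

(** * Variations of complex quantities *)

Section ComplexVariation.
Context {R : realType}.
Local Notation C := R[i].
Implicit Types f v g w : R -> C.

Lemma ReMc (z t : C) : complex.Re (z * t) =
  complex.Re z * complex.Re t - complex.Im z * complex.Im t.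
Proof. by case: z t => [a b] [c d]. Qed.
Lemma ImMc (z t : C) : complex.Im (z * t) =
  complex.Re z * complex.Im t + complex.Im z * complex.Re t.
Proof. by case: z t => [a b] [c d]. Qed.
Lemma ReDc (z t : C) : complex.Re (z + t) = complex.Re z + complex.Re t.
Proof. by case: z t => [a b] [c d]. Qed.
Lemma ImDc (z t : C) : complex.Im (z + t) = complex.Im z + complex.Im t.
Proof. by case: z t => [a b] [c d]. Qed.
Lemma ReNc (z : C) : complex.Re (- z) = - complex.Re z.
Proof. by case: z. Qed.
Lemma ImNc (z : C) : complex.Im (- z) = - complex.Im z.
Proof. by case: z. Qed.
Lemma ReJc (z : C) : complex.Re (conjc z) = complex.Re z.
Proof. by case: z. Qed.
Lemma ImJc (z : C) : complex.Im (conjc z) = - complex.Im z.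
Proof. by case: z. Qed.
Lemma complexP (z t : C) :
  complex.Re z = complex.Re t -> complex.Im z = complex.Im t -> z = t.
Proof. by case: z t => [a b] [c d] /= -> ->. Qed.

Lemma normc_le (z : C) :
  ComplexField.Normc.normc z <= `|complex.Re z| + `|complex.Im z|.
Proof.
case: z => a b /=; rewrite -[leRHS]ger0_norm ?addr_ge0// -sqrtr_sqr ler_wsqrtr//.
rewrite sqrrD !real_normK ?num_real// [leRHS]addrAC lerDl.
by rewrite mulrn_wge0 ?mulr_ge0.
Qed.

Definition CVar f f' v :=
  Var (fun e => complex.Re (f e)) (fun e => complex.Re (f' e)) (fun e => complex.Re (v e))
  /\ Var (fun e => complex.Im (f e)) (fun e => complex.Im (f' e)) (fun e => complex.Im (v e)).

Lemma CVar_eq f f' v g g' w :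
  (forall e, f e = g e) -> (forall e, f' e = g' e) ->
  (\forall e \near 0, v e = w e) -> CVar f f' v -> CVar g g' w.
Proof.
by move=> fg fg' vw [r i]; split; [apply: Var_eq r|apply: Var_eq i]; near=> e;
  congr complex.Re || congr complex.Im; rewrite ?fg ?fg'//; near: e.
Unshelve. all: by end_near. Qed.

Lemma CVar_mk (a a' va b b' vb : R -> R) : Var a a' va -> Var b b' vb ->
  CVar (fun e => a e +i* b e) (fun e => a' e +i* b' e) (fun e => va e +i* vb e).
Proof. by []. Qed.

Lemma CVar_cst (c : C) : CVar (fun=> c) (fun=> c) (fun=> 0).
Proof. by split; exact: Var_cst. Qed.

Lemma CVar_real (a a' va : R -> R) : Var a a' va ->
  CVar (fun e => (a e)%:C) (fun e => (a' e)%:C) (fun e => (va e)%:C).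
Proof. by move=> H; apply: CVar_mk H (Var_cst 0). Qed.

Lemma CVarD f f' v g g' w : CVar f f' v -> CVar g g' w ->
  CVar (fun e => f e + g e) (fun e => f' e + g' e) (fun e => v e + w e).
Proof.
by move=> [rf jf] [rg jg]; split; [have := VarD rf rg|have := VarD jf jg];
  apply: Var_eq; near=> e; rewrite ?ReDc ?ImDc.
Unshelve. all: by end_near. Qed.

Lemma CVarM f f' v g g' w : CVar f f' v -> CVar g g' w ->
  CVar (fun e => f e * g e) (fun e => f' e * g' e) (fun e => v e * g 0 + f 0 * w e).
Proof.
move=> [rf jf] [rg jg]; split.
  have := VarD (VarM rf rg) (VarN (VarM jf jg)).
  by apply: Var_eq; near=> e; rewrite ?(ReDc, ReMc)//; ring.
have := VarD (VarM rf jg) (VarM jf rg).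
by apply: Var_eq; near=> e; rewrite ?(ImDc, ImMc)//; ring.
Unshelve. all: by end_near. Qed.

Lemma CVarN f f' v : CVar f f' v ->
  CVar (fun e => - f e) (fun e => - f' e) (fun e => - v e).
Proof.
by move=> [r i]; split; [have := VarN r|have := VarN i];
  apply: Var_eq; near=> e; rewrite ?ReNc ?ImNc.
Unshelve. all: by end_near. Qed.

Lemma CVarJ f f' v : CVar f f' v ->
  CVar (fun e => conjc (f e)) (fun e => conjc (f' e)) (fun e => conjc (v e)).
Proof.
by move=> [r i]; split; [move: r|have := VarN i];
  apply: Var_eq; near=> e; rewrite ?ReJc ?ImJc.
Unshelve. all: by end_near. Qed.

Lemma CVar_sum (I : finType) (F F' v : I -> R -> C) :
  (forall i, CVar (F i) (F' i) (v i)) ->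
  CVar (fun e => \sum_i F i e) (fun e => \sum_i F' i e) (fun e => \sum_i v i e).
Proof.
move=> H; elim: (index_enum I) => [|i s IH].
  by apply: CVar_eq (CVar_cst 0) => [e|e|]; [..|near=> e]; rewrite big_nil.
by apply: CVar_eq (CVarD (H i) IH) => [e|e|]; [..|near=> e]; rewrite big_cons.
Unshelve. all: by end_near. Qed.

(** Reduces invariance to the vanishing of the computed first-order variation. *)
Lemma CVar_eq_mod_quadratic f f' v :
  CVar f f' v -> (\forall e \near 0, v e = 0) -> eq_mod_quadratic f' f.
Proof.
move=> [[_ _ [C nC]] [_ _ [D nD]]] v0; exists (C + D); near=> e.
have ve : v e = 0 by near: e.
have : `|complex.Re (f' e) - complex.Re (f e) - complex.Re (v e)| <= C * e ^+ 2 by near: e.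
have : `|complex.Im (f' e) - complex.Im (f e) - complex.Im (v e)| <= D * e ^+ 2 by near: e.
rewrite ve /= !subr0 => Ii Ir.
rewrite ger0_norm ?normc_ge0//.
  by rewrite (le_trans (normc_le _))// ReDc ImDc ReNc ImNc mulrDl lerD.
by case: (_ - _) => ? ? /=; exact: sqrtr_ge0.
Unshelve. all: by end_near. Qed.

Lemma sum2 (V : nmodType) (F : 'I_2 -> V) : \sum_i F i = F 0 + F 1.
Proof.
rewrite big_ord_recl big_ord1; congr (_ + F _); exact: val_inj.
Qed.

Lemma I2P (a : 'I_2) : a = 0 \/ a = 1.
Proof. by case: a => [[|[|//]] ?]; [left|right]; exact: val_inj. Qed.

Lemma CVar_cplx1 (f f' v : R -> 'I_2 -> R) a :
  (forall b, Var (f^~ b) (f'^~ b) (v^~ b)) ->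
  CVar (fun e => cplx1 (f e) a) (fun e => cplx1 (f' e) a) (fun e => cplx1 (v e) a).
Proof.
move=> H; apply: CVar_mk => //.
have := Var_sum (fun b => VarM (Var_cst (vol a b)) (H b)).
by apply: Var_eq; near=> e => //; apply: eq_bigr => b _; rewrite mul0r add0r.
Unshelve. all: by end_near. Qed.

Lemma CVar_cplx2 (f f' v : R -> 'I_2 -> 'I_2 -> R) a b :
  (forall a b, Var (fun e => f e a b) (fun e => f' e a b) (fun e => v e a b)) ->
  CVar (fun e => cplx2 (f e) a b) (fun e => cplx2 (f' e) a b) (fun e => cplx2 (v e) a b).
Proof.
move=> H; apply: CVar_mk => //.
have := Var_sum (fun c => VarM (Var_cst (vol a c)) (H c b)).
by apply: Var_eq; near=> e => //; apply: eq_bigr => c _; rewrite mul0r add0r.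
Unshelve. all: by end_near. Qed.

Lemma Var_hat (f f' v : R -> 'I_2 -> 'I_2 -> R) a b :
  (forall a b, Var (fun e => f e a b) (fun e => f' e a b) (fun e => v e a b)) ->
  Var (fun e => hat (f e) a b) (fun e => hat (f' e) a b) (fun e => hat (v e) a b).
Proof.
move=> H.
have := VarM (Var_cst 2^-1) (VarD (VarD (H a b) (H b a))
   (VarN (VarM (Var_cst (a == b)%:R) (Var_sum (fun c => H c c))))).
by apply: Var_eq; near=> e => //; rewrite mul0r add0r mul0r add0r.
Unshelve. all: by end_near. Qed.

Lemma CVar_symtl (f f' v : R -> 'I_2 -> 'I_2 -> C) a b :
  (forall a b, CVar (fun e => f e a b) (fun e => f' e a b) (fun e => v e a b)) ->
  CVar (fun e => symtl (f e) a b) (fun e => symtl (f' e) a b) (fun e => symtl (v e) a b).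
Proof.
move=> H.
have := CVarM (CVar_cst 2^-1) (CVarD (CVarD (H a b) (H b a))
   (CVarN (CVarM (CVar_cst (a == b)%:R) (CVar_sum (fun c => H c c))))).
by apply: CVar_eq => //; near=> e => //; rewrite mul0r add0r mul0r add0r.
Unshelve. all: by end_near. Qed.

End ComplexVariation.

Section ComplexDerivative.
Context {R : realType}.
Local Notation pt := 'rV[R]_4.
Variables (eps0 : R) (U : set pt).
Hypotheses (eps0_gt0 : 0 < eps0) (openU : open U).

Definition CVar1 (f f' v : R -> pt -> R[i]) :=
  Var1 eps0 U (fun e x => complex.Re (f e x)) (fun e x => complex.Re (f' e x))
    (fun e x => complex.Re (v e x)) /\
  Var1 eps0 U (fun e x => complex.Im (f e x)) (fun e x => complex.Im (f' e x))
    (fun e x => complex.Im (v e x)).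

Lemma CVar1_at f f' v x : U x -> CVar1 f f' v -> CVar (f^~ x) (f'^~ x) (v^~ x).
Proof. by move=> Ux [r i]; split; [have [] := r x Ux|have [] := i x Ux]. Qed.

(** Direction and function vary together; expanding the derivative in coordinates makes this a sum
    of products. *)
Lemma Var_derive f f' v (X X' w : R -> pt) x : U x ->
  VVar X X' w -> Var1 eps0 U f f' v ->
  Var (fun e => 'D_(X e) (f e) x) (fun e => 'D_(X' e) (f' e) x)
    (fun e => 'D_(w e) (f 0) x + 'D_(X 0) (v e) x).
Proof.
move=> Ux HX Hf; have [_ d G] := Hf x Ux.
have := Var_sum (fun i => VarM (HX i) (d i)).
have G0 := G 0 (eps0_0 eps0_gt0).
apply: Var_eq; near=> e; have e0 : `|e| < eps0 by near: e; exact: near_eps0.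
- by have [a b c] := G e e0; rewrite (a _).2.
- by have [a b c] := G e e0; rewrite (b _).2.
- by have [a b c] := G e e0; have [a0 _ _] := G0; rewrite (a0 _).2 (c _).2 big_split.
Unshelve. all: by end_near. Qed.

Lemma CVar_deriveC f f' v (X X' w : R -> pt) x : U x ->
  VVar X X' w -> CVar1 f f' v ->
  CVar (fun e => deriveC (X e) (f e) x) (fun e => deriveC (X' e) (f' e) x)
    (fun e => deriveC (w e) (f 0) x + deriveC (X 0) (v e) x).
Proof.
move=> Ux HX [r i].
apply: CVar_eq (CVar_mk (Var_derive Ux HX r) (Var_derive Ux HX i)) => //.
by near=> e.
Unshelve. all: by end_near. Qed.

Lemma CVar1_cplx1 (f f' v : R -> pt -> 'I_2 -> R) a :
  (forall b, Var1 eps0 U (fun e x => f e x b) (fun e x => f' e x b) (fun e x => v e x b)) ->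
  CVar1 (fun e x => cplx1 (f e x) a) (fun e x => cplx1 (f' e x) a)
    (fun e x => cplx1 (v e x) a).
Proof.
move=> H; split; first exact: H.
have := Var1_sum eps0_gt0 openU (fun b => Var1M eps0_gt0
  (Var1_base eps0_gt0 openU (sf_cst (vol a b))) (H b)).
apply: (Var1_eq eps0_gt0 openU) => // e x _ _ /=.
by apply: eq_bigr => b _; rewrite mul0r add0r.
Qed.

End ComplexDerivative.

Section CovariantDerivativeRules.
Context {R : realType}.
Local Notation pt := 'rV[R]_4.
Variables (g : pt -> 'M[R]_4) (x : pt).
Implicit Types (A B X Y : pt -> pt).

Definition smooth_field Y := forall k, has_gradient (fun y => Y y 0 k) x.

Lemma cov_addl A B Y : smooth_field Y ->
  cov g (fun y => A y + B y) Y x = cov g A Y x + cov g B Y x.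
Proof.
move=> GY; apply/rowP => k; rewrite !mxE !(GY k _).2 addrACA -!big_split /=.
apply: eq_bigr => i _; rewrite mxE mulrDl; congr (_ + _).
rewrite -big_split; apply: eq_bigr => j _ /=; ring.
Qed.

Lemma cov_scalel (c : pt -> R) A Y : smooth_field Y ->
  cov g (fun y => c y *: A y) Y x = c x *: cov g A Y x.
Proof.
move=> GY; apply/rowP => k; rewrite !mxE !(GY k _).2 mulrDr !mulr_sumr.
congr (_ + _); apply: eq_bigr => i _; rewrite ?mxE ?mulrA// mulr_sumr.
by apply: eq_bigr => j _; ring.
Qed.

Lemma cov_addr X A B : smooth_field A -> smooth_field B ->
  cov g X (fun y => A y + B y) x = cov g X A x + cov g X B x.
Proof.
move=> GA GB; apply/rowP => k; rewrite !mxE.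
under [X in derive X]eq_fun do rewrite mxE.
rewrite (gradD (GA k) (GB k)).2 addrACA; congr (_ + _).
rewrite -big_split; apply: eq_bigr => i _ /=.
by rewrite -big_split; apply: eq_bigr => j _ /=; rewrite mxE mulrDr.
Qed.

Lemma cov_scaler X (c : pt -> R) A : has_gradient c x -> smooth_field A ->
  cov g X (fun y => c y *: A y) x = 'D_(X x) c x *: A x + c x *: cov g X A x.
Proof.
move=> Gc GA; apply/rowP => k; rewrite !mxE.
under [X in derive X]eq_fun do rewrite mxE.
rewrite (gradM Gc (GA k)).2 mulrDr addrA; congr (_ + _).
rewrite mulr_sumr; apply: eq_bigr => i _; rewrite mulr_sumr.
by apply: eq_bigr => j _; rewrite mxE; ring.
Qed.

Lemma smooth_fieldZ (c : pt -> R) A : has_gradient c x -> smooth_field A ->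
  smooth_field (fun y => c y *: A y).
Proof.
by move=> Gc GA k; under eq_fun do rewrite mxE; exact: (gradM Gc (GA k)).1.
Qed.

End CovariantDerivativeRules.

(** * Invariance relative to one null direction *)

Section AlignedBackground.
Context {R : realType}.
Local Notation pt := 'rV[R]_4.

(* The properties of Kerr-Newman, relative to the principal direction [e_4],
   on which invariance rests. *)
Record aligned (S : framed_spacetime R) (x : pt) : Prop := Aligned {
  aligned_betaF : forall a, betaF S x a = 0;
  aligned_xi : forall a, xi S x a = 0;
  aligned_chi : chi S x 0 0 = chi S x 1 1 /\ chi S x 0 1 = - chi S x 1 0;
  aligned_PF4 : deriveC (f4 S x) (PF S) x = - conjc (trX S x) * PF S x;
  aligned_PFh : deriveC (fh S 0 x) (PF S) x + (0 +i* 1) * deriveC (fh S 1 x) (PF S) x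
    = - 2 * Hc S x 0 * PF S x;
  aligned_W44 : forall Z T, weyl (metric S) x (f4 S x) (f4 S x) Z T = 0
     /\ weyl (metric S) x Z T (f4 S x) (f4 S x) = 0;
  aligned_alpha : forall a b,
    weyl (metric S) x (fh S a x) (f4 S x) (fh S b x) (f4 S x) = 0;
  aligned_beta : forall a, beta S x a = 0;
  aligned_W434h : forall b,
    weyl (metric S) x (f4 S x) (f3 S x) (f4 S x) (fh S b x) = 0;
  aligned_W4h43 : forall b,
    weyl (metric S) x (f4 S x) (fh S b x) (f4 S x) (f3 S x) = 0;
  aligned_Whh4h : forall a b c,
    weyl (metric S) x (fh S c x) (fh S a x) (f4 S x) (fh S b x) = 0;
  aligned_W4hhh : forall a b c,
    weyl (metric S) x (f4 S x) (fh S a x) (fh S c x) (fh S b x) = 0;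
  aligned_W3434 :
    weyl (metric S) x (f3 S x) (f4 S x) (f3 S x) (f4 S x) = 4 * rho S x;
  aligned_Whh34 : forall a b,
    weyl (metric S) x (fh S a x) (fh S b x) (f3 S x) (f4 S x)
    = 2 * vol a b * rhod S x;
  aligned_Wh43h : forall a b,
    weyl (metric S) x (fh S a x) (f4 S x) (f3 S x) (fh S b x)
    = (a == b)%:R * rho S x + vol a b * rhod S x }.

End AlignedBackground.

Section Weyl.
Context {R : realType}.
Local Notation pt := 'rV[R]_4.
Variables (W : 'I_4 -> 'I_4 -> 'I_4 -> 'I_4 -> R).
Implicit Types X Y Z T : pt.

Lemma tensor4_lin1 (c : R) X X' Y Z T :
  tensor4 W (c *: X + X') Y Z T = c * tensor4 W X Y Z T + tensor4 W X' Y Z T.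
Proof.
rewrite /tensor4 mulr_sumr -big_split; apply: eq_bigr => i _ /=.
rewrite mulr_sumr -big_split; apply: eq_bigr => j _ /=.
rewrite mulr_sumr -big_split; apply: eq_bigr => m _ /=.
rewrite mulr_sumr -big_split; apply: eq_bigr => n _ /=.
by rewrite !mxE; ring.
Qed.
Lemma tensor4_lin2 (c : R) X Y Y' Z T :
  tensor4 W X (c *: Y + Y') Z T = c * tensor4 W X Y Z T + tensor4 W X Y' Z T.
Proof.
rewrite /tensor4 mulr_sumr -big_split; apply: eq_bigr => i _ /=.
rewrite mulr_sumr -big_split; apply: eq_bigr => j _ /=.
rewrite mulr_sumr -big_split; apply: eq_bigr => m _ /=.
rewrite mulr_sumr -big_split; apply: eq_bigr => n _ /=.
by rewrite !mxE; ring.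
Qed.
Lemma tensor4_lin3 (c : R) X Y Z Z' T :
  tensor4 W X Y (c *: Z + Z') T = c * tensor4 W X Y Z T + tensor4 W X Y Z' T.
Proof.
rewrite /tensor4 mulr_sumr -big_split; apply: eq_bigr => i _ /=.
rewrite mulr_sumr -big_split; apply: eq_bigr => j _ /=.
rewrite mulr_sumr -big_split; apply: eq_bigr => m _ /=.
rewrite mulr_sumr -big_split; apply: eq_bigr => n _ /=.
by rewrite !mxE; ring.
Qed.
Lemma tensor4_lin4 (c : R) X Y Z T T' :
  tensor4 W X Y Z (c *: T + T') = c * tensor4 W X Y Z T + tensor4 W X Y Z T'.
Proof.
rewrite /tensor4 mulr_sumr -big_split; apply: eq_bigr => i _ /=.
rewrite mulr_sumr -big_split; apply: eq_bigr => j _ /=.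
rewrite mulr_sumr -big_split; apply: eq_bigr => m _ /=.
rewrite mulr_sumr -big_split; apply: eq_bigr => n _ /=.
by rewrite !mxE; ring.
Qed.

Definition tensor4_lin := (tensor4_lin1, tensor4_lin2, tensor4_lin3, tensor4_lin4).

Lemma tensor4_zero :
  (forall Y Z T, tensor4 W 0 Y Z T = 0) * (forall X Z T, tensor4 W X 0 Z T = 0)
  * (forall X Y T, tensor4 W X Y 0 T = 0) * (forall X Y Z, tensor4 W X Y Z 0 = 0).
Proof.
by do !split; move=> A B C; rewrite -(scale0r (0 : pt)) -[_ *: _]addr0 ?tensor4_lin;
  rewrite /tensor4 !big1 ?mulr0 ?addr0// => i _; rewrite big1// => j _;
  rewrite big1// => m _; rewrite big1// => n _; rewrite mxE ?(mulr0, mul0r).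
Qed.

End Weyl.

(** * Variations of the frame components over an aligned background *)

Section AlignedVariations.
Context {R : realType}.
Local Notation pt := 'rV[R]_4.
Variables (eps0 : R) (U : set pt).
Hypotheses (eps0_gt0 : 0 < eps0) (openU : open U).
Variable S : R -> framed_spacetime R.
Hypothesis smS : smooth_spacetimes eps0 U S.
Hypothesis nfS : forall e x, `|e| < eps0 -> U x ->
  [/\ (metric (S e) x)^T = metric (S e) x,
      (faraday (S e) x)^T = - faraday (S e) x
    & null_frame (metric (S e) x) (S e) x].
Hypothesis alS : forall x, U x -> aligned (S 0) x.
Variables mu mub : R -> 'I_2 -> pt -> R.
Hypotheses (linmu : linear_hform eps0 U mu) (linmub : linear_hform eps0 U mub).

Local Notation SF := (smooth_family eps0 U).
Local Notation S'_ := (S' S mu mub).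
Local Notation e0_0 := (eps0_0 eps0_gt0).

Let vf4 := VVar1_f4 eps0_gt0 openU smS mub linmu.
Let vf3 := VVar1_f3 eps0_gt0 openU smS mu linmub.
Let vfh := VVar1_fh eps0_gt0 openU smS linmu linmub.

Let d4E e y : d4 S mu e y = mu e 0 y *: fh (S 0) 0 y + mu e 1 y *: fh (S 0) 1 y.
Proof. by rewrite /d4 sum2. Qed.

Let d3E e y : d3 S mub e y = mub e 0 y *: fh (S 0) 0 y + mub e 1 y *: fh (S 0) 1 y.
Proof. by rewrite /d3 sum2. Qed.

Let weyl_tensor4 x : weyl (metric (S 0)) x =
  tensor4 (fun i j m n => weyl_coord (metric (S 0)) i j m n x).
Proof. by []. Qed.

(* The padding puts a scaled vector in the shape expected by [tensor4_lin]. *)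
Lemma scale_lin (c : R) (v : pt) : c *: v = c *: v + 0.
Proof. by rewrite addr0. Qed.

(** Changing one slot of W(4,a,4,b) lowers the boost weight by at most one. The resulting components
    of weight one vanish in type D, and the others have e_4 twice in an antisymmetric pair. *)
Lemma Var_alpha x a b : U x ->
  Var (fun e => alpha (S e) x a b) (fun e => alpha (S'_ e) x a b) (fun=> 0).
Proof.
move=> Ux; have := Var_weyl eps0_gt0 openU smS nfS Ux vf4 (vfh a) vf4 (vfh b).
apply: Var_eqv => e /=; have al := alS Ux.
rewrite !d4E /dh !weyl_tensor4.
rewrite [_ *: fh (S 0) 1 x]scale_lin [_ *: f3 (S 0) x]scale_lin.
rewrite [(2^-1 * mu e b x) *: _]scale_lin.
rewrite !tensor4_lin !tensor4_zero -!weyl_tensor4.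
rewrite !(aligned_W44 al _ _).1 !(aligned_W44 al _ _).2.
rewrite !(aligned_W434h al) !(aligned_W4h43 al) !(aligned_Whh4h al) !(aligned_W4hhh al).
by ring.
Qed.

Lemma vol00 : vol 0 0 = 0 :> R. Proof. by rewrite /vol subrr. Qed.
Lemma vol11 : vol 1 1 = 0 :> R. Proof. by rewrite /vol subrr. Qed.
Lemma vol01 : vol 0 1 = 1 :> R. Proof. by rewrite /vol subr0. Qed.
Lemma vol10 : vol 1 0 = -1 :> R. Proof. by rewrite /vol sub0r. Qed.
Definition volE := (vol00, vol01, vol10, vol11).

(** The real part of (3/2) conj(P) (mu + i *mu). Of the factor 3, two units come from W(3,4,3,4) and
    W(a,b,3,4), one from W(a,4,3,b); the normalization of beta halves it. *)
Definition vbeta e x a : R := 3 / 2 *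
  (rho (S 0) x * mu e a x + rhod (S 0) x * \sum_b vol a b * mu e b x).

Lemma Var_beta x a : U x ->
  Var (fun e => beta (S e) x a) (fun e => beta (S'_ e) x a) (fun e => vbeta e x a).
Proof.
move=> Ux.
have := VarM (Var_cst 2^-1) (Var_weyl eps0_gt0 openU smS nfS Ux (vfh a) vf4 vf3 vf4).
apply: Var_eqv => e /=; have al := alS Ux.
rewrite !d4E !d3E /dh !weyl_tensor4.
rewrite [mu e 1 x *: _]scale_lin [mub e 1 x *: _]scale_lin [_ *: f3 (S 0) x]scale_lin.
rewrite !tensor4_lin !tensor4_zero -!weyl_tensor4.
rewrite !(aligned_W44 al _ _).1 !(aligned_alpha al) (aligned_W3434 al).
rewrite !(aligned_Whh34 al) !(aligned_Wh43h al) /vbeta sum2.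
by case: (I2P a) => ->; rewrite !volE ?eqxx /=; field.
Qed.

Lemma Var1_betaF_raw a : Var1 eps0 U (fun e y => betaF (S e) y a)
  (fun e y => betaF (S'_ e) y a)
  (fun e y => mu e a y * rhoF (S 0) y - (\sum_b vol a b * mu e b y) * rhodF (S 0) y).
Proof.
apply: (Var1_eq eps0_gt0 openU) (Var1_faraday eps0_gt0 openU smS (vfh a) vf4) => // e y e0 Uy /=.
have [_ FT _] := nfS e0_0 Uy.
have F0 v : bil (faraday (S 0) y) v v = 0.
  by have := bil_anti v v FT; lra.
rewrite /dh d4E !(bilDl, bilDr, bilZl, bilZr) F0 /rhoF /rhodF sum2.
case: (I2P a) => ->; rewrite !volE F0; first by field.
by rewrite [bil _ (fh _ 1 y) _]bil_anti//; field.
Qed.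

(** The real part of P_F (mu + i *mu). It is kept as a field on U, because the invariants
    differentiate B_F. *)
Definition vBF e y a : R :=
  mu e a y * rhoF (S 0) y - (\sum_b vol a b * mu e b y) * rhodF (S 0) y.

Lemma CVar1_BF a : CVar1 eps0 U (fun e y => BF (S e) y a) (fun e y => BF (S'_ e) y a)
  (fun e y => cplx1 (vBF e y) a).
Proof. by apply: CVar1_cplx1 => // b; exact: Var1_betaF_raw. Qed.

Lemma CVar_BF x a : U x -> CVar (fun e => BF (S e) x a) (fun e => BF (S'_ e) x a)
  (fun e => cplx1 (vBF e x) a).
Proof. by move=> Ux; exact: CVar1_at Ux (CVar1_BF a). Qed.

(** The value of v is left open: P_F multiplies only quantities that vanish on the background, so it
    contributes through its value at 0. *)
Lemma CVar_PF x : U x ->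
  exists v, CVar (fun e => PF (S e) x) (fun e => PF (S'_ e) x) v.
Proof.
move=> Ux.
have [V34 _ _] := Var1_faraday eps0_gt0 openU smS vf3 vf4 Ux.
have [V12 _ _] := Var1_faraday eps0_gt0 openU smS (vfh 0) (vfh 1) Ux.
by eexists; exact: CVar_mk (VarM (Var_cst 2^-1) V34) (VarN V12).
Qed.

Lemma BF0 x a : U x -> BF (S 0) x a = 0.
Proof.
move=> Ux; rewrite /BF /cplx1 /dual1 sum2 !(aligned_betaF (alS Ux)).
by rewrite !mulr0 addr0.
Qed.

Lemma Bc0 x a : U x -> Bc (S 0) x a = 0.
Proof.
move=> Ux; rewrite /Bc /cplx1 /dual1 sum2 !(aligned_beta (alS Ux)).
by rewrite !mulr0 addr0.
Qed.

Definition ReImE :=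
  (@ReDc R, @ImDc R, @ReMc R, @ImMc R, @ReNc R, @ImNc R, @ReJc R, @ImJc R).

Lemma Re_nat n : complex.Re (n%:R : R[i]) = n%:R.
Proof. by elim: n => // n IH; rewrite -!natr1 ReDc IH. Qed.
Lemma Im_nat n : complex.Im (n%:R : R[i]) = 0.
Proof. by elim: n => // n IH; rewrite -!natr1 ImDc IH addr0. Qed.

(* [p] is the conjugate of [Pc] for [frakB]; for [frakBb] it is [Pc] itself. *)
Lemma frakB_invariant (p p' vp : R -> R[i]) x a : U x -> CVar p p' vp ->
  p 0 = conjc (Pc (S 0) x) ->
  eq_mod_quadratic
    (fun e => 2 * PF (S'_ e) x * Bc (S'_ e) x a - 3 * p' e * BF (S'_ e) x a)
    (fun e => 2 * PF (S e) x * Bc (S e) x a - 3 * p e * BF (S e) x a).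
Proof.
move=> Ux Hp p0; have [vPF HPF] := CVar_PF Ux.
have HB : CVar (fun e => Bc (S e) x a) (fun e => Bc (S'_ e) x a)
    (fun e => cplx1 (vbeta e x) a).
  by apply: CVar_cplx1 => b; exact: Var_beta.
apply: (CVar_eq_mod_quadratic (CVarD (CVarM (CVarM (CVar_cst 2) HPF) HB)
  (CVarN (CVarM (CVarM (CVar_cst 3) Hp) (CVar_BF a Ux))))).
(* The terms left are 2 P_F (3/2) conj(P) M and - 3 conj(P) P_F M with M = mu + i *mu; they
   cancel. *)
near=> e; rewrite p0 BF0// Bc0// !(mulr0, mul0r, add0r, addr0).
apply: complexP; rewrite !ReImE ?Re_nat ?Im_nat /= /dual1 !sum2 /vBF /vbeta !sum2;
  by case: (I2P a) => ->; rewrite !volE; field.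
Unshelve. all: by end_near. Qed.

Lemma Ac_invariant x a b : U x ->
  eq_mod_quadratic (fun e => Ac (S'_ e) x a b) (fun e => Ac (S e) x a b).
Proof.
move=> Ux; have H : CVar (fun e => Ac (S e) x a b) (fun e => Ac (S'_ e) x a b)
    (fun e => cplx2 (fun _ _ => 0) a b).
  by apply: CVar_cplx2 => c d; exact: Var_alpha.
apply: (CVar_eq_mod_quadratic H); near=> e.
by rewrite /cplx2 /dual2 sum2 !mulr0 addr0.
Unshelve. all: by end_near. Qed.

Let g := metric (S 0).
Let gT x : U x -> (g x)^T = g x. Proof. by move=> Ux; have [] := nfS e0_0 Ux. Qed.
Let nf x : U x -> null_frame (g x) (S 0) x.
Proof. by move=> Ux; have [] := nfS e0_0 Ux. Qed.
Let gu x : U x -> g x \in unitmx.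
Proof. by move=> Ux; have [] := null_frame_inv (gT Ux) (nf Ux). Qed.
Let gG x i j : U x -> has_gradient (fun y => g y i j) x.
Proof. by move=> Ux; exact: (sf_grad openU (sf_metric smS i j) e0_0 Ux). Qed.
Let G4 x : U x -> smooth_field x (f4 (S 0)).
Proof. by move=> Ux k; exact: (sf_grad openU (sf_f4 smS k) e0_0 Ux). Qed.
Let G3 x : U x -> smooth_field x (f3 (S 0)).
Proof. by move=> Ux k; exact: (sf_grad openU (sf_f3 smS k) e0_0 Ux). Qed.
Let Gh b x : U x -> smooth_field x (fh (S 0) b).
Proof. by move=> Ux k; exact: (sf_grad openU (sf_fh smS b k) e0_0 Ux). Qed.
Let Gmu e b x : `|e| < eps0 -> U x -> has_gradient (mu e b) x.
Proof. by move=> e0 Ux; exact: (sf_grad openU (linmu.1 b) e0 Ux). Qed.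

Let conn (X Y Z : pt -> pt) x := bil (g x) (cov g X Y x) (Z x).

(** Metric compatibility applied to a constant inner product. This yields the antisymmetry of the
    horizontal connection coefficients. *)
Lemma conn_const (V Y Z : pt -> pt) (c : R) x : U x ->
  smooth_field x Y -> smooth_field x Z -> (forall y, U y -> bil (g y) (Y y) (Z y) = c) ->
  conn V Y Z x = - conn V Z Y x.
Proof.
move=> Ux GY GZ E.
have := metric_compat openU gT Ux (gu Ux) (fun i j => gG i j Ux) V GY GZ.
have [Gb _] := derive_bil (fun i j => gG i j Ux) 0 GY GZ.
have [_ ->] := grad_eq openU E Ux Gb.
rewrite (grad_cst c x).2 => H; apply/eqP; rewrite -addr_eq0; apply/eqP.
by rewrite /conn [bil (g x) (cov g V Z x) _]bil_sym ?gT.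
Qed.

Lemma conn_hh V b c x : U x -> conn V (fh (S 0) b) (fh (S 0) c) x =
  - conn V (fh (S 0) c) (fh (S 0) b) x.
Proof.
move=> Ux; apply: (@conn_const _ _ _ (b == c)%:R) => //; [exact: Gh|exact: Gh|].
by move=> y Uy; have [_ _ _ ->] := nf Uy.
Qed.

Lemma conn_hh0 V b x : U x -> conn V (fh (S 0) b) (fh (S 0) b) x = 0.
Proof. by move=> Ux; have := conn_hh V b b Ux; lra. Qed.

Lemma conn_44 V x : U x -> conn V (f4 (S 0)) (f4 (S 0)) x = 0.
Proof.
move=> Ux; have : conn V (f4 (S 0)) (f4 (S 0)) x = - conn V (f4 (S 0)) (f4 (S 0)) x.
  apply: (@conn_const _ _ _ 0) => //; [exact: G4|exact: G4|].
  by move=> y Uy; have [[]] := nf Uy.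
by lra.
Qed.

Lemma conn_d4 e X Z x : `|e| < eps0 -> U x ->
  bil (g x) (cov g X (d4 S mu e) x) Z =
  'D_(X x) (mu e 0) x * bil (g x) (fh (S 0) 0 x) Z + mu e 0 x * bil (g x) (cov g X (fh (S 0) 0) x) Z
  + ('D_(X x) (mu e 1) x * bil (g x) (fh (S 0) 1 x) Z
     + mu e 1 x * bil (g x) (cov g X (fh (S 0) 1) x) Z).
Proof.
move=> e0 Ux; have -> : d4 S mu e = fun y => mu e 0 y *: fh (S 0) 0 y + mu e 1 y *: fh (S 0) 1 y.
  by apply/funext => y; exact: d4E.
rewrite cov_addr; [|by apply: smooth_fieldZ; [exact: Gmu|exact: Gh]..].
by rewrite !cov_scaler; [rewrite !bilDl !bilZl|exact: Gmu|exact: Gh|exact: Gmu|exact: Gh].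
Qed.

Lemma conn_hhE a b x : U x -> bil (g x) (fh (S 0) a x) (fh (S 0) b x) = (a == b)%:R.
Proof. by move=> Ux; have [_ _ _ ->] := nf Ux. Qed.

(** This is (1/2) (nabla_4 mu_a + mu_b chi_ba) + omega mu_a, with nabla_4 mu written in frame
    components. *)
Definition vxi e x a : R := 2^-1 * (mu e 0 x * chi (S 0) x 0 a + mu e 1 x * chi (S 0) x 1 a
  + 'D_(f4 (S 0) x) (mu e a) x
  + mu e 0 x * conn (f4 (S 0)) (fh (S 0) 0) (fh (S 0) a) x
  + mu e 1 x * conn (f4 (S 0)) (fh (S 0) 1) (fh (S 0) a) x) + mu e a x * omega (S 0) x.

Lemma Var_xi x a : U x ->
  Var (fun e => xi (S e) x a) (fun e => xi (S'_ e) x a) (fun e => vxi e x a).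
Proof.
move=> Ux.
have := VarM (Var_cst 2^-1) (Var_conn eps0_gt0 openU smS nfS Ux vf4 vf4 (vfh a)).
apply: Var_eq; near=> e => //.
have e0 : `|e| < eps0 by near: e; exact: near_eps0.
rewrite mul0r add0r bilDl (conn_d4 _ _ e0 Ux) (conn_hhE 0 a Ux) (conn_hhE 1 a Ux)
  /dh !(bilDr, bilZr).
have -> : d4 S mu e = fun y => mu e 0 y *: fh (S 0) 0 y + mu e 1 y *: fh (S 0) 1 y.
  by apply/funext => y; exact: d4E.
rewrite cov_addl ?cov_scalel; try exact: G4.
rewrite !(bilDl, bilZl).
have := conn_44 (f4 (S 0)) Ux; rewrite /conn => ->.
rewrite /vxi /omega /conn /chi.
by case: (I2P a) => ->; rewrite ?eqxx /=; field.
Unshelve. all: by end_near. Qed.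

(** This is nabla_a mu_b + mu_a eta_b + zeta_a mu_b. The contribution of mub is a multiple of xi,
    which vanishes on the background. *)
Definition vchi e x a b : R := mu e a x * eta (S 0) x b + mu e b x * zeta (S 0) x a
  + 'D_(fh (S 0) a x) (mu e b) x
  + mu e 0 x * conn (fh (S 0) a) (fh (S 0) 0) (fh (S 0) b) x
  + mu e 1 x * conn (fh (S 0) a) (fh (S 0) 1) (fh (S 0) b) x.

Lemma Var_chi x a b : U x ->
  Var (fun e => chi (S e) x a b) (fun e => chi (S'_ e) x a b) (fun e => vchi e x a b).
Proof.
move=> Ux.
have := Var_conn eps0_gt0 openU smS nfS Ux (vfh a) vf4 (vfh b).
apply: Var_eq; near=> e => //.
have e0 : `|e| < eps0 by near: e; exact: near_eps0.
rewrite bilDl (conn_d4 _ _ e0 Ux) (conn_hhE 0 b Ux) (conn_hhE 1 b Ux) {2}/dh !(bilDr, bilZr).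
rewrite cov_addl ?(cov_scalel _ (fun y => 2^-1 * mub e a y))
  ?(cov_scalel _ (fun y => 2^-1 * mu e a y)); try exact: G4.
rewrite !(bilDl, bilZl).
have := conn_44 (fh (S 0) a) Ux; rewrite /conn => ->.
have := aligned_xi (alS Ux) b; rewrite /xi => xi0.
have -> : bil (g x) (cov g (f4 (S 0)) (f4 (S 0)) x) (fh (S 0) b x) = 0 by move: xi0; lra.
rewrite /vchi /eta /zeta /conn.
by case: (I2P b) => ->; rewrite ?eqxx /=; field.
Unshelve. all: by end_near. Qed.

Lemma sf_rhoF : SF (fun e => rhoF (S e)).
Proof.
apply: (sfM openU (sf_cst 2^-1)).
have H : SF (fun e x => \sum_j (\sum_i f3 (S e) x 0 i * faraday (S e) x i j) * f4 (S e) x 0 j).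
  apply: (sf_sum openU) => j; apply: (sfM openU _ (sf_f4 smS j)).
  by apply: (sf_sum openU) => i; exact: (sfM openU (sf_f3 smS i) (sf_faraday smS i j)).
by apply: (sf_eq openU) H => e x _ _; rewrite bilE.
Qed.

Lemma sf_rhodF : SF (fun e => rhodF (S e)).
Proof.
apply: (sfN openU).
have H : SF (fun e x => \sum_j (\sum_i fh (S e) 0 x 0 i * faraday (S e) x i j) * fh (S e) 1 x 0 j).
  apply: (sf_sum openU) => j; apply: (sfM openU _ (sf_fh smS 1 j)).
  by apply: (sf_sum openU) => i; exact: (sfM openU (sf_fh smS 0 i) (sf_faraday smS i j)).
by apply: (sf_eq openU) H => e x _ _; rewrite bilE.
Qed.

Lemma derive_vBF e x a (V : pt) : `|e| < eps0 -> U x ->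
  has_gradient (fun y => vBF e y a) x /\
  'D_V (fun y => vBF e y a) x =
  'D_V (mu e a) x * rhoF (S 0) x + mu e a x * 'D_V (rhoF (S 0)) x
  - ((\sum_b vol a b * 'D_V (mu e b) x) * rhodF (S 0) x
    + (\sum_b vol a b * mu e b x) * 'D_V (rhodF (S 0)) x).
Proof.
move=> e0 Ux.
have Gr := sf_grad openU sf_rhoF e0_0 Ux.
have Gd := sf_grad openU sf_rhodF e0_0 Ux.
have P1 := gradM (Gmu a e0 Ux) Gr.
have Q b := gradM (grad_cst (vol a b) x).1 (Gmu b e0 Ux).
have Q1 := grad_sum (fun b => (Q b).1).
have Q2 := gradM Q1.1 Gd.
have Q3 := gradM (grad_cst (-1) x).1 Q2.1.
have [G D] := gradD P1.1 Q3.1.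
have -> : (fun y => vBF e y a) = (fun y => mu e a y * rhoF (S 0) y +
    -1 * ((\sum_b vol a b * mu e b y) * rhodF (S 0) y)).
  by apply/funext => y; rewrite mulN1r.
split=> //; rewrite D P1.2 Q3.2 Q2.2 Q1.2 (grad_cst _ _).2 mul0r add0r mulN1r.
congr (_ - (_ * _ + _)); apply: eq_bigr => b _.
by rewrite (Q b).2 (grad_cst _ _).2 mul0r add0r.
Qed.

Lemma deriveC_vBF e x a (V : pt) : `|e| < eps0 -> U x ->
  deriveC V (fun y => cplx1 (vBF e y) a) x =
  cplx1 (fun b => 'D_V (fun y => vBF e y b) x) a.
Proof.
move=> e0 Ux; rewrite /deriveC /cplx1 /=; congr (_ +i* _).
have Q b := gradM (grad_cst (vol a b) x).1 (derive_vBF b 0 e0 Ux).1.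
rewrite /dual1 (grad_sum (fun b => (Q b).1)).2; apply: eq_bigr => b _.
by rewrite (Q b).2 (grad_cst _ _).2 mul0r add0r.
Qed.

Lemma deriveC_BF0 a V x : U x -> deriveC V (fun y => BF (S 0) y a) x = 0.
Proof.
move=> Ux; apply: complexP => /=.
  have H y : U y -> 0 = complex.Re (BF (S 0) y a) by move=> Uy; rewrite BF0.
  by have [_ <-] := grad_eq openU H Ux (grad_cst 0 x).1; exact: (grad_cst 0 x).2.
have H y : U y -> 0 = complex.Im (BF (S 0) y a) by move=> Uy; rewrite BF0.
by have [_ <-] := grad_eq openU H Ux (grad_cst 0 x).1; exact: (grad_cst 0 x).2.
Qed.

(** B_F vanishes identically on the background, so the variations of X and of the connection drop
    out and the background derivative of [vBF] remains. *)
Lemma CVar_nabla X X' wX a x : U x -> VVar1 eps0 U X X' wX ->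
  CVar (fun e => nabla (S e) (X e) (BF (S e)) x a)
    (fun e => nabla (S'_ e) (X' e) (BF (S'_ e)) x a)
    (fun e => deriveC (X 0 x) (fun y => cplx1 (vBF e y) a) x
      - \sum_c (conn (X 0) (fh (S 0) a) (fh (S 0) c) x)%:C * cplx1 (vBF e x) c).
Proof.
move=> Ux HX.
have := CVarD (CVar_deriveC eps0_gt0 Ux (VVar1_at HX Ux) (CVar1_BF a))
  (CVarN (CVar_sum (fun c => CVarM (CVar_real
    (Var_conn eps0_gt0 openU smS nfS Ux HX (vfh a) (vfh c))) (CVar_BF c Ux)))).
apply: CVar_eq => //; near=> e; rewrite deriveC_BF0// add0r; congr (_ - _).
by apply: eq_bigr => c _; rewrite BF0// mulr0 add0r.
Unshelve. all: by end_near. Qed.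

End AlignedVariations.

(** * Cancellations in the invariants built from derivatives of B_F *)

Lemma symtl_mk (R : realType) (p q : 'I_2 -> 'I_2 -> R) a b :
  symtl (fun c d => p c d +i* q c d) a b = hat p a b +i* hat q a b.
Proof.
rewrite /symtl /hat.
have -> : 2^-1 = (2^-1)%:C :> R[i] by rewrite fmorphV rmorph_nat.
have -> : (a == b)%:R = (a == b)%:R%:C :> R[i] by rewrite rmorph_nat.
by rewrite !sum2; apply: complexP => /=; ring.
Qed.

Lemma hatE (R : realType) (p : 'I_2 -> 'I_2 -> R) :
  (hat p 0 0 = 2^-1 * (p 0 0 - p 1 1)) * (hat p 0 1 = 2^-1 * (p 0 1 + p 1 0))
  * (hat p 1 0 = 2^-1 * (p 0 1 + p 1 0)) * (hat p 1 1 = 2^-1 * (p 1 1 - p 0 0)).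
Proof. by rewrite /hat !sum2 /=; do !split; ring. Qed.

(** The pointwise identity behind [frakF], with the geometry replaced by scalars: r + i s is P_F, dr
    and ds its horizontal derivatives, and k c d l = g(D_c e_d, e_l). The terms in D M and Z M
    cancel between B_F and Xhat; those in P_F H M carry 1 (from D P_F = - 2 H P_F), - 3/2 and
    1/2. *)
Lemma frakF_algebra (R : realType) (m : 'I_2 -> R) (dm : 'I_2 -> 'I_2 -> R) (r s : R)
    (dr ds et ze : 'I_2 -> R) (k : 'I_2 -> 'I_2 -> 'I_2 -> R) (a b : 'I_2) :
  (forall c, k c 1 0 = - k c 0 1) -> (forall c, k c 0 0 = 0) -> (forall c, k c 1 1 = 0) ->
  dr 0 = ds 1 - 2 * (et 0 * r - et 1 * s) ->
  ds 0 = - dr 1 - 2 * (et 0 * s + et 1 * r) ->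
  let v d := m d * r - (\sum_b vol d b * m b) * s in
  let dv c d := dm c d * r + m d * dr c
    - ((\sum_b vol d b * dm c b) * s + (\sum_b vol d b * m b) * ds c) in
  let w c d := (dv c d - (k c d 0 * v 0 + k c d 1 * v 1))
    +i* ((vol d 0 * dv c 0 + vol d 1 * dv c 1) - (k c d 0 * v 1 - k c d 1 * v 0)) in
  let wz c d := w c d + (0 +i* 1) * ((vol c 0)%:C * w 0 d + (vol c 1)%:C * w 1 d)
    + cplx1 ze c * cplx1 v d in
  let x c d := m c * et d + m d * ze c + dm c d + m 0 * k c 0 d + m 1 * k c 1 d in
  (- 2^-1)%:C * symtl wz a b
  - (3 / 2)%:C * symtl (fun c d => cplx1 et c * cplx1 v d) a b
  + (r +i* s) * cplx2 (fun c d => hat x c d) a b = 0.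
Proof.
move=> k10 k00 k11 dr0 ds0 v dv w wz x.
pose wr c d := dv c d - (k c d 0 * v 0 + k c d 1 * v 1).
pose wi c d := (vol d 0 * dv c 0 + vol d 1 * dv c 1) - (k c d 0 * v 1 - k c d 1 * v 0).
pose mr (f : 'I_2 -> R) c d := f c * v d
  - (vol c 0 * f 0 + vol c 1 * f 1) * (vol d 0 * v 0 + vol d 1 * v 1).
pose mi (f : 'I_2 -> R) c d := f c * (vol d 0 * v 0 + vol d 1 * v 1)
  + (vol c 0 * f 0 + vol c 1 * f 1) * v d.
have mE (f : 'I_2 -> R) c d : cplx1 f c * cplx1 v d = mr f c d +i* mi f c d.
  by rewrite /cplx1 /dual1 !sum2.
pose zr c d := wr c d - (vol c 0 * wi 0 d + vol c 1 * wi 1 d) + mr ze c d.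
pose zi c d := wi c d + (vol c 0 * wr 0 d + vol c 1 * wr 1 d) + mi ze c d.
have zE : wz = fun c d => zr c d +i* zi c d.
  apply/funext => c; apply/funext => d; rewrite /wz mE /w -/(wr c d) -/(wi c d).
  rewrite -/(wr 0 d) -/(wi 0 d) -/(wr 1 d) -/(wi 1 d).
  by apply: complexP => /=; rewrite /zr /zi; ring.
have hE : (fun c d => cplx1 et c * cplx1 v d) = fun c d => mr et c d +i* mi et c d.
  by apply/funext => c; apply/funext => d; exact: mE.
rewrite zE hE !symtl_mk /cplx2.
have -> : dual2 (fun c d => hat x c d) a b = vol a 0 * hat x 0 b + vol a 1 * hat x 1 b.
  by rewrite /dual2 sum2.
have k100 := k10 0; have k101 := k10 1.
apply: complexP => /=; case: (I2P a) => ->; case: (I2P b) => ->; rewrite !hatE !volE.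
all: rewrite /zr /zi /mr /mi /wr /wi /x !volE !(k10, k00, k11).
all: rewrite /dv /v !sum2 !volE dr0 ds0.
all: by field.
Qed.

Section FieldStrengths.
Context {R : realType}.
Local Notation pt := 'rV[R]_4.
Variables (eps0 : R) (U : set pt).
Hypotheses (eps0_gt0 : 0 < eps0) (openU : open U).
Variable S : R -> framed_spacetime R.
Hypothesis smS : smooth_spacetimes eps0 U S.
Hypothesis nfS : forall e x, `|e| < eps0 -> U x ->
  [/\ (metric (S e) x)^T = metric (S e) x,
      (faraday (S e) x)^T = - faraday (S e) x
    & null_frame (metric (S e) x) (S e) x].
Hypothesis alS : forall x, U x -> aligned (S 0) x.
Variables mu mub : R -> 'I_2 -> pt -> R.
Hypotheses (linmu : linear_hform eps0 U mu) (linmub : linear_hform eps0 U mub).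

Local Notation S'_ := (S' S mu mub).
Local Notation conn X Y Z x :=
  (bil (metric (S 0) x) (cov (metric (S 0)) X Y x) (Z x)).

Let vf4 := VVar1_f4 eps0_gt0 openU smS mub linmu.
Let vf3 := VVar1_f3 eps0_gt0 openU smS mu linmub.
Let vfh := VVar1_fh eps0_gt0 openU smS linmu linmub.
Let vBFx x a Ux := @CVar_BF R eps0 U eps0_gt0 openU S smS nfS mu mub linmu linmub x a Ux.

Lemma realC_nat n : (n%:R : R[i]) = (n%:R)%:C.
Proof. by rewrite rmorph_nat. Qed.
Lemma realC_inv n : (n%:R^-1 : R[i]) = (n%:R^-1)%:C.
Proof. by rewrite fmorphV rmorph_nat. Qed.

(** The terms in nabla_4 M and omega M cancel between B_F and Xi. Those in conj(tr X) P_F M carry -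
    1 from the Maxwell equation, 3/2, and - 1/2 from Xi, since absence of shear makes mu_b chi_ba
    the real part of (1/2) conj(tr X) M. *)
Lemma frakX_invariant x a : U x ->
  eq_mod_quadratic (fun e => frakX (S'_ e) x a) (fun e => frakX (S e) x a).
Proof.
move=> Ux; have al := alS Ux.
have [vPF HPF] := CVar_PF eps0_gt0 openU smS linmu linmub Ux.
have HN := CVar_nabla eps0_gt0 openU smS nfS alS linmu linmub a Ux vf4.
have Hom := VarM (Var_cst 4^-1) (Var_conn eps0_gt0 openU smS nfS Ux vf4 vf4 vf3).
have Hchi b c := Var_chi eps0_gt0 openU smS nfS alS linmu linmub b c Ux.
have HtrX := CVar_mk (Var_sum (fun b => Hchi b b))
  (VarN (Var_sum (fun b => Var_sum (fun c => VarM (Var_cst (vol b c)) (Hchi b c))))).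
have HXi := CVar_cplx1 a (fun b => Var_xi eps0_gt0 openU smS nfS linmu linmub b Ux).
have H := CVarD (CVarD (CVarD HN (CVarM (CVarM (CVar_cst (2 * 1%:~R)) (CVar_real Hom)) (vBFx a Ux)))
  (CVarM (CVarM (CVar_cst (3 / 2)) (CVarJ HtrX)) (vBFx a Ux)))
  (CVarN (CVarM (CVarM (CVar_cst 2) HPF) HXi)).
apply: (CVar_eq_mod_quadratic H) => {H HtrX Hom HN HXi HPF}; near=> e.
have e0 : `|e| < eps0 by near: e; exact: near_eps0.
rewrite (BF0 alS a Ux) (deriveC_vBF eps0_gt0 openU smS linmu a _ e0 Ux).
have -> : cplx1 (fun b => xi (S 0) x b) a = 0.
  by rewrite /cplx1 /dual1 sum2 !(aligned_xi al) !mulr0 addr0.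
have -> : 2 * 1%:~R = 2%:C :> R[i] by rewrite mulr1 realC_nat.
have -> : 3 / 2 = (3 / 2)%:C :> R[i] by rewrite realC_nat realC_inv -rmorphM.
rewrite realC_nat !(mul0r, mulr0, add0r, addr0).
have [chi0 chi1] := aligned_chi al.
have P4 := aligned_PF4 al.
have P4r : 'D_(f4 (S 0) x) (rhoF (S 0)) x =
    complex.Re (- conjc (trX (S 0) x) * PF (S 0) x) by rewrite -P4.
have P4i : 'D_(f4 (S 0) x) (rhodF (S 0)) x =
    complex.Im (- conjc (trX (S 0) x) * PF (S 0) x) by rewrite -P4.
have Hhh := conn_hh eps0_gt0 openU smS nfS (f4 (S 0)) 1 0 Ux.
have H00 := conn_hh0 eps0_gt0 openU smS nfS (f4 (S 0)) 0 Ux.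
have H11 := conn_hh0 eps0_gt0 openU smS nfS (f4 (S 0)) 1 Ux.
have Dv b := (derive_vBF eps0_gt0 openU smS linmu b (f4 (S 0) x) e0 Ux).2.
have PE : PF (S 0) x = rhoF (S 0) x +i* rhodF (S 0) x by [].
move: P4r P4i; rewrite /trX /trR /atrR PE !sum2 !volE !ReImE /= => P4r P4i.
rewrite /cplx1 /dual1 ?sum2.
case: (I2P a) => ->; rewrite !volE !Dv !sum2 !volE P4r P4i ?H00 ?H11 ?Hhh.
  by apply: complexP; rewrite !ReImE /= /vBF /vxi !sum2 !volE /omega
    ?H00 ?H11 ?Hhh ?chi0 ?chi1; field.
by apply: complexP; rewrite !ReImE /= /vBF /vxi !sum2 !volE /omega
    ?H00 ?H11 ?Hhh ?chi0 ?chi1; field.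
Unshelve. all: by end_near. Qed.

(* [z] replaces [Zc], because the connection term of [frakFb] is [- Zc] on the
   original frame. *)
Definition frakF_with (T : framed_spacetime R) (z : 'I_2 -> R[i]) x a b : R[i] :=
  - 2^-1 * symtl (fun a b => Dc T (BF T) x a b + z a * BF T x b) a b
  - 3 / 2 * hot (Hc T x) (BF T x) a b + PF T x * Xhat T x a b.

(** The variations of z, H and P_F multiply B_F or Xhat, which vanish at 0; what remains is
    [frakF_algebra]. *)
Lemma frakF_invariant (z z' vz : R -> 'I_2 -> R[i]) x a b : U x ->
  (forall c, CVar (fun e => z e c) (fun e => z' e c) (fun e => vz e c)) ->
  (forall c, z 0 c = Zc (S 0) x c) ->
  eq_mod_quadratic (fun e => frakF_with (S'_ e) (z' e) x a b)
    (fun e => frakF_with (S e) (z e) x a b).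
Proof.
move=> Ux Hz z0; have al := alS Ux.
have [vPF HPF] := CVar_PF eps0_gt0 openU smS linmu linmub Ux.
have HN c d := CVar_nabla eps0_gt0 openU smS nfS alS linmu linmub d Ux (vfh c).
pose w e c d : R[i] := deriveC (fh (S 0) c x) (fun y => cplx1 (vBF S mu e y) d) x
  - \sum_k (conn (fh (S 0) c) (fh (S 0) d) (fh (S 0) k) x)%:C * cplx1 (vBF S mu e x) k.
pose wz e c d := w e c d + (0 +i* 1) * ((vol c 0)%:C * w e 0 d + (vol c 1)%:C * w e 1 d)
  + Zc (S 0) x c * cplx1 (vBF S mu e x) d.
have HDz c d : CVar (fun e => Dc (S e) (BF (S e)) x c d + z e c * BF (S e) x d)
    (fun e => Dc (S'_ e) (BF (S'_ e)) x c d + z' e c * BF (S'_ e) x d) (fun e => wz e c d).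
  have := CVarD (CVarD (HN c d) (CVarM (CVar_cst (0 +i* 1))
    (CVar_sum (fun k => CVarM (CVar_cst (vol c k)%:C) (HN k d))))) (CVarM (Hz c) (vBFx d Ux)).
  apply: CVar_eq => //; near=> e.
  rewrite (BF0 alS d Ux) mulr0 z0 mul0r !add0r; congr (_ + _ * _ + _).
  by rewrite sum2; congr (_ + _); rewrite mul0r add0r.
have HHB0 c d : CVar (fun e => Hc (S e) x c * BF (S e) x d)
    (fun e => Hc (S'_ e) x c * BF (S'_ e) x d)
    (fun e => Hc (S 0) x c * cplx1 (vBF S mu e x) d).
  have HH := CVar_cplx1 c (fun k => VarM (Var_cst 2^-1)
    (Var_conn eps0_gt0 openU smS nfS Ux vf3 vf4 (vfh k))).
  have := CVarM HH (vBFx d Ux); apply: CVar_eq => //; near=> e.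
  by rewrite (BF0 alS d Ux) mulr0 add0r.
have Hchi c d := Var_chi eps0_gt0 openU smS nfS alS linmu linmub c d Ux.
have HX := CVar_cplx2 a b (fun c d => Var_hat c d Hchi).
have H := CVarD (CVarD (CVarM (CVar_cst (- 2^-1)) (CVar_symtl a b HDz))
  (CVarN (CVarM (CVar_cst (3 / 2)) (CVar_symtl a b HHB0)))) (CVarM HPF HX).
apply: (CVar_eq_mod_quadratic H) => {H HX HHB0 HDz HN HPF}; near=> e.
have e0 : `|e| < eps0 by near: e; exact: near_eps0.
have DE c d := deriveC_vBF eps0_gt0 openU smS linmu d (fh (S 0) c x) e0 Ux.
have B0 c := BF0 alS c Ux.
have [chi0 chi1] := aligned_chi al.
have Ph := aligned_PFh al.
have PE : PF (S 0) x = rhoF (S 0) x +i* rhodF (S 0) x by [].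
(* Real and imaginary parts of D P_F = - 2 H P_F, solved for the derivatives along e_1. *)
have Phr : 'D_(fh (S 0) 0 x) (rhoF (S 0)) x = 'D_(fh (S 0) 1 x) (rhodF (S 0)) x
    - 2 * (eta (S 0) x 0 * rhoF (S 0) x - eta (S 0) x 1 * rhodF (S 0) x).
  have := congr1 (@complex.Re R) Ph; rewrite realC_nat PE !ReImE /= /dual1 sum2 volE.
  by rewrite /deriveC /=; move=> H; rewrite volE in H; lra.
have Phi : 'D_(fh (S 0) 0 x) (rhodF (S 0)) x = - 'D_(fh (S 0) 1 x) (rhoF (S 0)) x
    - 2 * (eta (S 0) x 0 * rhodF (S 0) x + eta (S 0) x 1 * rhoF (S 0) x).
  have := congr1 (@complex.Im R) Ph; rewrite realC_nat PE !ReImE /= /dual1 sum2 volE.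
  by rewrite /deriveC /=; move=> H; rewrite volE in H; lra.
have Hhh c := conn_hh eps0_gt0 openU smS nfS (fh (S 0) c) 1 0 Ux.
have H00 c := conn_hh0 eps0_gt0 openU smS nfS (fh (S 0) c) 0 Ux.
have H11 c := conn_hh0 eps0_gt0 openU smS nfS (fh (S 0) c) 1 Ux.
have Dv c d := (derive_vBF eps0_gt0 openU smS linmu d (fh (S 0) c x) e0 Ux).2.
(* On the background chi is a multiple of the identity plus an antisymmetric part, hence free of
   shear. *)
have X0 : cplx2 (fun c d => hat (fun c d => chi (S 0) x c d) c d) a b = 0.
  rewrite /cplx2 /dual2 /hat !sum2 ?chi0.
  by apply: complexP; case: (I2P a) => ->; case: (I2P b) => ->;
    rewrite ?chi0 ?chi1 !volE ?eqxx /=; field.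
rewrite X0 mulr0 add0r !mul0r !add0r.
have -> : - 2^-1 = (- 2^-1)%:C :> R[i] by rewrite realC_inv -rmorphN.
have -> : 3 / 2 = (3 / 2)%:C :> R[i] by rewrite realC_nat realC_inv -rmorphM.
move: Phr Phi; rewrite /eta => Phr Phi.
have wE c d : w e c d =
    ('D_(fh (S 0) c x) (fun y => vBF S mu e y d) x
      - (conn (fh (S 0) c) (fh (S 0) d) (fh (S 0) 0) x * vBF S mu e x 0
        + conn (fh (S 0) c) (fh (S 0) d) (fh (S 0) 1) x * vBF S mu e x 1))
    +i* ((vol d 0 * 'D_(fh (S 0) c x) (fun y => vBF S mu e y 0) x
          + vol d 1 * 'D_(fh (S 0) c x) (fun y => vBF S mu e y 1) x)
      - (conn (fh (S 0) c) (fh (S 0) d) (fh (S 0) 0) x * vBF S mu e x 1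
        - conn (fh (S 0) c) (fh (S 0) d) (fh (S 0) 1) x * vBF S mu e x 0)).
  rewrite /w DE sum2 /cplx1 /dual1 !sum2 !volE.
  by apply: complexP; rewrite !ReImE /=; ring.
have := @frakF_algebra R (fun d => mu e d x) (fun c d => 'D_(fh (S 0) c x) (mu e d) x)
  (rhoF (S 0) x) (rhodF (S 0) x) (fun c => 'D_(fh (S 0) c x) (rhoF (S 0)) x)
  (fun c => 'D_(fh (S 0) c x) (rhodF (S 0)) x) (eta (S 0) x) (zeta (S 0) x)
  (fun c d k => conn (fh (S 0) c) (fh (S 0) d) (fh (S 0) k) x) a b Hhh H00 H11 Phr Phi.
rewrite PE; apply: etrans; congr (_ * _ - _ + _); congr (symtl _ a b).
apply/funext => c; apply/funext => d.
by rewrite /wz !wE !Dv.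
Unshelve. all: by end_near. Qed.

End FieldStrengths.

(** * Exchange of the two null directions *)

Section Swap.
Context {R : realType}.
Local Notation pt := 'rV[R]_4.

(** The horizontal pair and its orientation are kept, so each underlined quantity becomes its
    counterpart up to signs and conjugations. *)
Definition swap (S : framed_spacetime R) : framed_spacetime R :=
  Framed (metric S) (faraday S) (Frame (f4 S) (f3 S) (fh S)).

(** Read off the coordinate formula for any g, so it also applies to the perturbed metrics; the
    other symmetries are established on the background. *)
Lemma weyl_coord_anti34 (g : pt -> 'M[R]_4) i j m n x :
  weyl_coord g i j m n x = - weyl_coord g i j n m x.
Proof.
rewrite /weyl_coord.
have -> : riemann g i j m n x = - riemann g i j n m x.
  rewrite /riemann -sumrN; apply: eq_bigr => k _; rewrite -mulrN; congr (_ * _).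
  rewrite /riemann_up opprD opprB; congr (_ + _); rewrite -sumrN.
  by apply: eq_bigr => l _; rewrite opprB.
move: (riemann g i j n m x) (ricci g) (g x) (scalar_curvature g x) => r c h s.
by ring.
Qed.

Lemma weyl_anti34 (g : pt -> 'M[R]_4) x X Y Z T :
  weyl g x X Y Z T = - weyl g x X Y T Z.
Proof.
rewrite /weyl -sumrN; apply: eq_bigr => i _; rewrite -sumrN; apply: eq_bigr => j _.
rewrite exchange_big -sumrN; apply: eq_bigr => m _; rewrite -sumrN.
by apply: eq_bigr => n _; rewrite weyl_coord_anti34; ring.
Qed.

Lemma swap_transform mu mub (S : framed_spacetime R) :
  transform mub mu (swap S) = swap (transform mu mub S).
Proof.
rewrite /transform /swap /transform_frame /=; congr (Framed _ _ (Frame _ _ _)).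
by apply/funext => b; apply/funext => y; rewrite addrAC.
Qed.

(** The exchange reverses the sign of rhoF and leaves rhodF alone. *)
Lemma PF_swap (S : framed_spacetime R) x : (faraday S x)^T = - faraday S x ->
  PF (swap S) x = - conjc (PF S x).
Proof.
by move=> FT; apply: complexP; rewrite /= ?opprK// /rhoF /= bil_anti// mulrN.
Qed.

Lemma Bc_swap (S : framed_spacetime R) x a : Bc (swap S) x a = - Bbc S x a.
Proof.
have E b : beta (swap S) x b = - betab S x b.
  by rewrite /beta /betab /= weyl_anti34 mulrN.
apply: complexP; rewrite /= ?E// /dual1 -sumrN.
by apply: eq_bigr => b _; rewrite E mulrN.
Qed.

(** Stated with - Z of the original frame, which is what type - 1 puts into [frakFb]; agreement with
    Z of the swapped frame is then required only at e = 0. *)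
Lemma frakFb_swap (S : framed_spacetime R) x a b : (faraday S x)^T = - faraday S x ->
  frakF_with (swap S) (fun k => (-1)%:~R * Zc S x k) x a b = frakFb S x a b.
Proof.
move=> FT; rewrite /frakF_with /frakFb PF_swap//; congr (_ + _).
by rewrite mulNr.
Qed.

Lemma frakBb_swap (S : framed_spacetime R) x a : (faraday S x)^T = - faraday S x ->
  2 * PF (swap S) x * Bc (swap S) x a - 3 * Pc S x * BF (swap S) x a = frakBb S x a.
Proof.
move=> FT; rewrite /frakBb PF_swap// Bc_swap; congr (_ - _).
by rewrite !mulrN mulNr opprK.
Qed.

Lemma frakXb_swap (S : framed_spacetime R) x a : (faraday S x)^T = - faraday S x ->
  frakX (swap S) x a = frakXb S x a.
Proof.
move=> FT; rewrite /frakX /frakXb PF_swap// !mulrN mulNr opprK; congr (_ + _ + _).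
by rewrite /cnabla4 /cnabla3 mulrN1z !mulrN !mulNr opprK.
Qed.

Variables (eps0 : R) (U : set pt).
Hypotheses (eps0_gt0 : 0 < eps0) (openU : open U).
Variable S : R -> framed_spacetime R.
Hypothesis smS : smooth_spacetimes eps0 U S.
Hypothesis nfS : forall e x, `|e| < eps0 -> U x ->
  [/\ (metric (S e) x)^T = metric (S e) x,
      (faraday (S e) x)^T = - faraday (S e) x
    & null_frame (metric (S e) x) (S e) x].
Hypothesis alS : forall x, U x -> aligned (S 0) x.
Hypothesis alsS : forall x, U x -> aligned (swap (S 0)) x.

Local Notation T := (fun e => swap (S e)).

Lemma smooth_swap : smooth_spacetimes eps0 U T.
Proof. by case: smS => g F v3 v4 vh; exact: (And5 g F v4 v3 vh). Qed.

Lemma null_swap e x : `|e| < eps0 -> U x ->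
  [/\ (metric (T e) x)^T = metric (T e) x,
      (faraday (T e) x)^T = - faraday (T e) x
    & null_frame (metric (T e) x) (T e) x].
Proof.
move=> e0 Ux; have [gT FT [[e33 e44] e34 eh ehh]] := nfS e0 Ux; split=> //.
split=> //=; first by rewrite bil_sym.
by move=> b; have [] := eh b.
Qed.

Lemma eq_mod_quadratic_near (f h f' h' : R -> R[i]) :
  (forall e, `|e| < eps0 -> f e = f' e) -> (forall e, `|e| < eps0 -> h e = h' e) ->
  eq_mod_quadratic f h -> eq_mod_quadratic f' h'.
Proof.
move=> ff hh; apply: negligible_eq; near=> e.
have e0 : `|e| < eps0 by near: e; exact: near_eps0.
by rewrite ff ?hh.
Unshelve. all: by end_near. Qed.

Lemma CVar_Zc mu mub x a : linear_hform eps0 U mu -> linear_hform eps0 U mub -> U x ->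
  exists v, CVar (fun e => Zc (S e) x a) (fun e => Zc (S' S mu mub e) x a) v.
Proof.
move=> lmu lmub Ux; eexists.
exact: (CVar_cplx1 a (fun k => VarM (Var_cst 2^-1)
  (Var_conn eps0_gt0 openU smS nfS Ux (VVar1_fh eps0_gt0 openU smS lmu lmub k)
    (VVar1_f4 eps0_gt0 openU smS mub lmu) (VVar1_f3 eps0_gt0 openU smS mu lmub)))).
Qed.

Lemma CVar_Pc mu mub x : linear_hform eps0 U mu -> linear_hform eps0 U mub -> U x ->
  exists v, CVar (fun e => Pc (S e) x) (fun e => Pc (S' S mu mub e) x) v.
Proof.
move=> lmu lmub Ux; eexists.
have v4 := VVar1_f4 eps0_gt0 openU smS mub lmu.
have v3 := VVar1_f3 eps0_gt0 openU smS mu lmub.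
have vh := VVar1_fh eps0_gt0 openU smS lmu lmub.
exact: (CVar_mk
  (VarM (Var_cst 4^-1) (Var_weyl eps0_gt0 openU smS nfS Ux v4 v3 v4 v3))
  (VarM (Var_cst 2^-1) (Var_weyl eps0_gt0 openU smS nfS Ux (vh 0) (vh 1) v3 v4))).
Qed.

(** Differentiating the constant g(e_3, e_4) = - 2 moves D_a from e_3 to e_4 with a change of
    sign. *)
Lemma Zc_swap x a : U x -> Zc (swap (S 0)) x a = - Zc (S 0) x a.
Proof.
move=> Ux.
have E b : zeta (swap (S 0)) x b = - zeta (S 0) x b.
  rewrite /zeta /= -mulrN; congr (_ * _).
  apply: (conn_const eps0_gt0 openU smS nfS (fh (S 0) b) (c := -2)) => //.
  - by move=> k; exact: (sf_grad openU (sf_f3 smS k) (eps0_0 eps0_gt0) Ux).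
  - by move=> k; exact: (sf_grad openU (sf_f4 smS k) (eps0_0 eps0_gt0) Ux).
  - by move=> y Uy; have [_ _ []] := nfS (eps0_0 eps0_gt0) Uy.
apply: complexP; rewrite /= ?E// /dual1 -sumrN.
by apply: eq_bigr => b _; rewrite E mulrN.
Qed.

Lemma Pc_swap x : U x -> Pc (S 0) x = conjc (Pc (swap (S 0)) x).
Proof.
move=> Ux; apply: complexP => /=.
  apply: (mulfI (_ : 4 != 0 :> R)); first by rewrite pnatr_eq0.
  by rewrite -(aligned_W3434 (alS Ux)) /rho /= mulrA mulfV ?mul1r ?pnatr_eq0.
by rewrite /rhod /= [in RHS]weyl_anti34 mulrN opprK.
Qed.

Lemma main_of_aligned :
  [/\ gauge_invariant2 eps0 U S Ac /\ gauge_invariant2 eps0 U S Abc,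
      gauge_invariant2 eps0 U S frakF /\ gauge_invariant2 eps0 U S frakFb,
      gauge_invariant1 eps0 U S frakB /\ gauge_invariant1 eps0 U S frakBb
    & gauge_invariant1 eps0 U S frakX /\ gauge_invariant1 eps0 U S frakXb].
Proof.
have SE mu mub e : S' T mub mu e = swap (S' S mu mub e) by exact: swap_transform.
split; split=> mu mub lmu lmub x Ux.
- by move=> b c; exact: (Ac_invariant eps0_gt0 openU smS nfS alS lmu lmub).
- move=> b c; have := Ac_invariant eps0_gt0 openU smooth_swap null_swap alsS lmub lmu b c Ux.
  by apply: eq_mod_quadratic_near => e e0; rewrite ?SE.
- move=> b c; have [vz Hz] := choice (fun k => CVar_Zc k lmu lmub Ux).
  have := frakF_invariant eps0_gt0 openU smS nfS alS lmu lmub b c Ux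
    (vz := fun e k => vz k e) Hz (fun=> erefl).
  apply: eq_mod_quadratic_near => e e0; rewrite /frakF_with /frakF; congr (_ * symtl _ _ _ - _ + _);
  by apply/funext => i; apply/funext => j; rewrite /cDc mul1r.
- move=> b c; have [vz Hz] := choice (fun k => CVar_Zc k lmu lmub Ux).
  have := frakF_invariant eps0_gt0 openU smooth_swap null_swap alsS lmub lmu b c Ux
    (z := fun e k => (-1)%:~R * Zc (S e) x k)
    (z' := fun e k => (-1)%:~R * Zc (S' S mu mub e) x k)
    (fun k => CVarM (CVar_cst (-1)%:~R) (Hz k)).
  have z0 k : (-1)%:~R * Zc (S 0) x k = Zc (swap (S 0)) x k.
    by rewrite Zc_swap// mulrN1z mulN1r.
  move=> /(_ z0); apply: eq_mod_quadratic_near => e e0; rewrite ?SE frakFb_swap//;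
    by have [] := nfS e0 Ux.
- move=> b; have [v Hv] := CVar_Pc lmu lmub Ux.
  have := frakB_invariant eps0_gt0 openU smS nfS alS lmu lmub b Ux (CVarJ Hv) (erefl _).
  by apply: eq_mod_quadratic_near.
- move=> b; have [v Hv] := CVar_Pc lmu lmub Ux.
  have := frakB_invariant eps0_gt0 openU smooth_swap null_swap alsS lmub lmu b Ux Hv (Pc_swap Ux).
  apply: eq_mod_quadratic_near => e e0; rewrite ?SE frakBb_swap//;
    by have [] := nfS e0 Ux.
- by move=> b; exact: (frakX_invariant eps0_gt0 openU smS nfS alS lmu lmub).
- move=> b; have := frakX_invariant eps0_gt0 openU smooth_swap null_swap alsS lmub lmu b Ux.
  apply: eq_mod_quadratic_near => e e0; rewrite ?SE frakXb_swap//;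
    by have [] := nfS e0 Ux.
Qed.

End Swap.

Local Close Scope complex_scope.

(** * Symmetries of the curvature *)

Section Tensor4.
Context {R : realType}.
Local Notation pt := 'rV[R]_4.
Implicit Types (W : 'I_4 -> 'I_4 -> 'I_4 -> 'I_4 -> R) (X Y Z T : pt).

Lemma tensor4_swap12 W X Y Z T :
  tensor4 (fun i j m n => W j i m n) X Y Z T = tensor4 W Y X Z T.
Proof.
rewrite /tensor4 exchange_big; apply: eq_bigr => i _; apply: eq_bigr => j _.
by apply: eq_bigr => m _; apply: eq_bigr => n _; ring.
Qed.

Lemma tensor4_swap34 W X Y Z T :
  tensor4 (fun i j m n => W i j n m) X Y Z T = tensor4 W X Y T Z.
Proof.
rewrite /tensor4; apply: eq_bigr => i _; apply: eq_bigr => j _.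
rewrite exchange_big; apply: eq_bigr => m _; apply: eq_bigr => n _; ring.
Qed.

Lemma tensor4_swap23 W X Y Z T :
  tensor4 (fun i j m n => W i m j n) X Y Z T = tensor4 W X Z Y T.
Proof.
rewrite /tensor4; apply: eq_bigr => i _.
rewrite exchange_big; apply: eq_bigr => j _; apply: eq_bigr => m _.
by apply: eq_bigr => n _; ring.
Qed.

Lemma tensor4_eq W W' X Y Z T : (forall i j m n, W i j m n = W' i j m n) ->
  tensor4 W X Y Z T = tensor4 W' X Y Z T.
Proof.
move=> E; rewrite /tensor4; do 4! (apply: eq_bigr => ? _).
by rewrite E.
Qed.

Lemma tensor4D W W' X Y Z T : tensor4 (fun i j m n => W i j m n + W' i j m n) X Y Z T
  = tensor4 W X Y Z T + tensor4 W' X Y Z T.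
Proof.
rewrite /tensor4 -big_split; apply: eq_bigr => i _ /=.
rewrite -big_split; apply: eq_bigr => j _ /=.
rewrite -big_split; apply: eq_bigr => m _ /=.
rewrite -big_split; apply: eq_bigr => n _ /=.
by ring.
Qed.

Lemma tensor4Z (c : R) W X Y Z T : tensor4 (fun i j m n => c * W i j m n) X Y Z T
  = c * tensor4 W X Y Z T.
Proof.
rewrite /tensor4 mulr_sumr; apply: eq_bigr => i _ /=.
rewrite mulr_sumr; apply: eq_bigr => j _ /=.
rewrite mulr_sumr; apply: eq_bigr => m _ /=.
rewrite mulr_sumr; apply: eq_bigr => n _ /=.
by ring.
Qed.

Lemma tensor4N W X Y Z T : tensor4 (fun i j m n => - W i j m n) X Y Z T
  = - tensor4 W X Y Z T.
Proof.
by rewrite -mulN1r -tensor4Z; apply: tensor4_eq => i j m n; rewrite mulN1r.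
Qed.

Lemma tensor4_prod12 (A B : 'M[R]_4) X Y Z T :
  tensor4 (fun i j m n => A i j * B m n) X Y Z T = bil A X Y * bil B Z T.
Proof.
have bE C V U : bil C V U = \sum_i \sum_j C i j * V 0 i * U 0 j.
  rewrite bilE exchange_big; apply: eq_bigr => j _; rewrite mulr_suml.
  by apply: eq_bigr => i _; ring.
rewrite /tensor4 !bE mulr_suml; apply: eq_bigr => i _.
rewrite mulr_suml; apply: eq_bigr => j _; rewrite mulr_sumr; apply: eq_bigr => m _.
by rewrite mulr_sumr; apply: eq_bigr => n _; ring.
Qed.

Lemma tensor4_prod13 (A B : 'M[R]_4) X Y Z T :
  tensor4 (fun i j m n => A i m * B j n) X Y Z T = bil A X Z * bil B Y T.
Proof.
by rewrite -tensor4_prod12 (tensor4_swap23 (fun i j m n => A i j * B m n)).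
Qed.

Lemma tensor4_prod14 (A B : 'M[R]_4) X Y Z T :
  tensor4 (fun i j m n => A i n * B j m) X Y Z T = bil A X T * bil B Y Z.
Proof.
by rewrite -tensor4_prod13 (tensor4_swap34 (fun i j m n => A i m * B j n)).
Qed.

Lemma tensor4_contract13 W X Y Z T :
  \sum_i \sum_m (X^T *m Z) i m * (\sum_j \sum_n W i j m n * Y 0 j * T 0 n)
  = tensor4 W X Y Z T.
Proof.
rewrite /tensor4; apply: eq_bigr => i _; rewrite exchange_big.
apply: eq_bigr => m _; rewrite mulr_sumr; apply: eq_bigr => j _.
by rewrite mulr_sumr; apply: eq_bigr => n _; rewrite !mxE big_ord1 !mxE; ring.
Qed.

Record curvature_like W : Prop := CurvatureLike {
  curv_anti12 : forall i j m n, W i j m n = - W j i m n;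
  curv_anti34 : forall i j m n, W i j m n = - W i j n m;
  curv_cyclic : forall i j m n, W i j m n + W i m n j + W i n j m = 0 }.

(** The classical argument: a signed combination of the four cyclic identities obtained by moving
    each index to the front. *)
Lemma curv_pair W : curvature_like W -> forall i j m n, W i j m n = W m n i j.
Proof.
move=> [a12 a34 cyc] i j m n.
have c1 := cyc i j m n; have c2 := cyc j m n i.
have c3 := cyc m n i j; have c4 := cyc n i j m.
have h1 := a12 i j m n; have h2 := a12 i m n j; have h3 := a12 i n j m.
have h4 := a12 j m n i; have h5 := a12 j n i m; have h6 := a12 m n i j.
have k1 := a34 j i m n; have k2 := a34 m i n j; have k3 := a34 n i j m.
have k4 := a34 m j n i; have k5 := a34 n j i m; have k6 := a34 n m i j.
by lra.
Qed.

Lemma tensor4_anti12 W X Y Z T : curvature_like W ->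
  tensor4 W X Y Z T = - tensor4 W Y X Z T.
Proof.
by case=> a12 _ _; rewrite -tensor4N -tensor4_swap12; exact: tensor4_eq.
Qed.

Lemma tensor4_anti34 W X Y Z T : curvature_like W ->
  tensor4 W X Y Z T = - tensor4 W X Y T Z.
Proof.
by case=> _ a34 _; rewrite -tensor4N -tensor4_swap34; exact: tensor4_eq.
Qed.

Lemma tensor4_cyclic W X Y Z T : curvature_like W ->
  tensor4 W X Y Z T + tensor4 W X Z T Y + tensor4 W X T Y Z = 0.
Proof.
case=> _ _ cyc.
have -> : tensor4 W X Z T Y = tensor4 (fun i j m n => W i m n j) X Y Z T.
  by rewrite (tensor4_swap23 (fun i j m n => W i j n m)) tensor4_swap34.
have -> : tensor4 W X T Y Z = tensor4 (fun i j m n => W i n j m) X Y Z T.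
  by rewrite (tensor4_swap34 (fun i j m n => W i m j n)) tensor4_swap23.
rewrite -!tensor4D; under tensor4_eq do rewrite cyc.
by rewrite /tensor4; do 4! (rewrite big1// => ? _); rewrite !mul0r.
Qed.

Lemma tensor4_pair W X Y Z T : curvature_like W ->
  tensor4 W X Y Z T = tensor4 W Z T X Y.
Proof.
move=> cW; have P := curv_pair cW.
have -> : tensor4 W Z T X Y = tensor4 (fun i j m n => W m n i j) X Y Z T.
  rewrite (tensor4_swap23 (fun i j m n => W j n i m)).
  rewrite (tensor4_swap12 (fun i j m n => W i n j m)).
  rewrite (tensor4_swap34 (fun i j m n => W i m j n)).
  by rewrite (tensor4_swap23 (fun i j m n => W i j m n)).
exact: tensor4_eq.
Qed.

End Tensor4.

(** * Riemann and Weyl symmetries from the coordinate formulas *)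

Section RiemannSymmetries.
Context {R : realType}.
Local Notation pt := 'rV[R]_4.
Variables (U : set pt) (openU : open U) (g : pt -> 'M[R]_4).
Hypothesis gT : forall y, U y -> (g y)^T = g y.
Hypothesis gu : forall y, U y -> g y \in unitmx.
Hypothesis gG : forall y i j, U y -> has_gradient (fun z => g z i j) y.
Hypothesis dgG : forall y k i j, U y ->
  has_gradient (fun z => pderive k (fun z => g z i j) z) y.
Hypothesis chG : forall y k i j, U y -> has_gradient (christoffel g k i j) y.
Variables (x : pt) (Ux : U x).
Hypothesis schwarz : forall m n i j,
  pderive m (fun z => pderive n (fun z => g z i j) z) x =
  pderive n (fun z => pderive m (fun z => g z i j) z) x.

Let d m i j := pderive m (fun z => g z i j) x.
Let dd m n i j := pderive m (fun z => pderive n (fun z => g z i j) z) x.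

Lemma metric_symE y i j : U y -> g y i j = g y j i.
Proof. by move=> Uy; rewrite -[in LHS]gT// mxE. Qed.

Lemma pderive_sym m i j y : U y ->
  pderive m (fun z => g z i j) y = pderive m (fun z => g z j i) y.
Proof.
move=> Uy; have E z : U z -> g z i j = g z j i by exact: metric_symE.
by have [_] := grad_eq openU E Uy (gG i j Uy); apply.
Qed.

Let schwarz' m n i j : dd m n i j = dd n m i j. Proof. exact: schwarz. Qed.

Let dS m i j : d m i j = d m j i. Proof. exact: pderive_sym. Qed.

Let ddS m n i j : dd m n i j = dd m n j i.
Proof.
have E z : U z -> pderive n (fun z => g z i j) z = pderive n (fun z => g z j i) z.
  exact: pderive_sym.
by have [_] := grad_eq openU E Ux (dgG n i j Ux); apply.
Qed.

Lemma christoffel_sym y k i j : U y -> christoffel g k i j y = christoffel g k j i y.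
Proof.
move=> Uy; rewrite /christoffel; congr (_ * _); apply: eq_bigr => l _.
congr (_ * _); rewrite [in X in _ - X](pderive_sym l i j Uy).
by congr (_ - _); rewrite addrC.
Qed.

(* Differentiate [g_ik Gamma^k_nj = Gamma_(i,nj)]. *)
Lemma pderive_christoffel_low m i n j :
  \sum_k g x i k * pderive m (christoffel g k n j) x =
  2^-1 * (dd m n j i + dd m j n i - dd m i n j)
  - \sum_k d m i k * christoffel g k n j x.
Proof.
have P k := gradM (gG i k Ux) (chG k n j Ux).
have [SG SD] := grad_sum (fun k => (P k).1).
have E z : U z -> \sum_k g z i k * christoffel g k n j z = lower_gamma g z i n j.
  by move=> Uz; rewrite lower_christoffel// gu.
have [_ D] := grad_eq openU E Ux SG.
have G1 := gradD (dgG n j i Ux) (dgG j n i Ux).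
have G2 := gradM (grad_cst (-1) x).1 (dgG i n j Ux).
have G3 := gradD G1.1 G2.1.
have G4 := gradM (grad_cst 2^-1 x).1 G3.1.
have L : 'D_(delta_mx 0 m) (fun z => lower_gamma g z i n j) x =
    2^-1 * (dd m n j i + dd m j n i - dd m i n j).
  have -> : (fun z => lower_gamma g z i n j) = (fun z => 2^-1 *
      (pderive n (fun y => g y j i) z + pderive j (fun y => g y n i) z
       + -1 * pderive i (fun y => g y n j) z)).
    by apply/funext => z; rewrite /lower_gamma mulN1r.
  by rewrite G4.2 (grad_cst _ _).2 G3.2 G1.2 G2.2 (grad_cst _ _).2 !mul0r !add0r mulN1r.
rewrite -L -D SD; apply/eqP; rewrite eq_sym subr_eq -big_split /=; apply/eqP.
apply: eq_bigr => k _; rewrite (P k).2 addrC; congr (_ + _).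
Qed.

Lemma d_lower m i k : d m i k = lower_gamma g x i m k + lower_gamma g x k m i.
Proof.
by rewrite /lower_gamma; have := dS m k i; rewrite /d => ->; field.
Qed.

(** The contraction g^kl Gamma_(k,ab) Gamma_(l,pq) of two symbols of the first kind, as [gamma2E]
    shows. *)
Definition gamma2 a b p q : R := \sum_k lower_gamma g x k a b * christoffel g k p q x.

(** Differentiating the lowered symbols produces d_m g_ik Gamma^k_nj; by [d_lower] half of it
    cancels a quadratic term of the curvature. The result shows the symmetries and contains no
    derivative of the inverse metric. *)
Lemma riemann_lower i j m n : riemann g i j m n x =
  2^-1 * (dd m j n i + dd n i m j - dd m i n j - dd n j m i)
  - gamma2 m i n j + gamma2 n i m j.
Proof.
pose A m n := \sum_k g x i k * pderive m (christoffel g k n j) x.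
pose B m n := \sum_l lower_gamma g x i m l * christoffel g l n j x.
have -> : riemann g i j m n x = A m n - A n m + (B m n - B n m).
  rewrite /riemann /riemann_up.
  under eq_bigr do rewrite mulrDr mulrBr.
  rewrite big_split sumrB; congr (_ + _).
  under eq_bigr do rewrite mulr_sumr.
  rewrite exchange_big -sumrB; apply: eq_bigr => l _ /=.
  under eq_bigr do rewrite mulrBr [X in X - _]mulrA [X in _ - X]mulrA.
  by rewrite sumrB -!mulr_suml !lower_christoffel ?gT ?gu.
have EA m' n' : A m' n' =
    2^-1 * (dd m' n' j i + dd m' j n' i - dd m' i n' j) - (B m' n' + gamma2 m' i n' j).
  rewrite {}/A pderive_christoffel_low; congr (_ - _).
  by rewrite -big_split; apply: eq_bigr => k _; rewrite d_lower mulrDl.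
rewrite (EA m n) (EA n m) -(schwarz' m n).
move: (B m n) (B n m) => s1 s2.
move: (gamma2 m i n j) (gamma2 n i m j) (dd m n j i) (dd m j n i) (dd m i n j)
  (dd n j m i) (dd n i m j) => *; ring.
Qed.

Local Notation gi := (invmx (g x)).

Lemma invmx_sym k l : gi k l = gi l k.
Proof. by rewrite -[in LHS](gT Ux) -trmx_inv mxE. Qed.

Lemma christoffel_raise k a b : christoffel g k a b x = \sum_l gi k l * lower_gamma g x l a b.
Proof.
by rewrite /christoffel mulr_sumr; apply: eq_bigr => l _; rewrite /lower_gamma mulrCA.
Qed.

Lemma gamma2E a b p q :
  gamma2 a b p q = \sum_k \sum_l gi k l * lower_gamma g x k a b * lower_gamma g x l p q.
Proof.
apply: eq_bigr => k _; rewrite christoffel_raise mulr_sumr.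
by apply: eq_bigr => l _; ring.
Qed.

Lemma gamma2_sym a b p q : gamma2 a b p q = gamma2 p q a b.
Proof.
rewrite !gamma2E exchange_big; apply: eq_bigr => k _; apply: eq_bigr => l _.
by rewrite invmx_sym; ring.
Qed.

Lemma gamma2_symr a b p q : gamma2 a b p q = gamma2 a b q p.
Proof. by apply: eq_bigr => k _; rewrite (christoffel_sym k p q Ux). Qed.

Lemma riemann_curvature_like : curvature_like (fun i j m n => riemann g i j m n x).
Proof.
split=> i j m n.
- rewrite !riemann_lower (gamma2_sym m j n i) (gamma2_sym n j m i).
  move: (gamma2 m i n j) (gamma2 n i m j) (dd m j n i) (dd n i m j) (dd m i n j)
    (dd n j m i) => *; ring.
- rewrite !riemann_lower.
  move: (gamma2 m i n j) (gamma2 n i m j) (dd m j n i) (dd n i m j) (dd m i n j)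
    (dd n j m i) => *; ring.
- rewrite !riemann_lower (gamma2_symr n i j m) (gamma2_symr j i m n) (gamma2_symr m i j n).
  (* The second derivatives are brought to common representatives, after which the cyclic sum
     cancels formally. *)
  rewrite (schwarz' j m n i) (ddS m j n i) (schwarz' n i m j) (ddS i n m j).
  rewrite (schwarz' n m j i) (schwarz' i n j m) (schwarz' j n m i) (ddS n j m i).
  rewrite (ddS n i j m) (schwarz' n i m j) (ddS m i j n) (schwarz' m j i n) (ddS j m i n).
  rewrite (schwarz' j i n m) (ddS i j n m) (schwarz' m i n j) (ddS m n j i) (schwarz' i j m n).
  move: (gamma2 m i n j) (gamma2 n i m j) (gamma2 j i n m) (dd j m n i) (dd i n m j)
    (dd i m n j) (dd n j i m) (dd m n i j) (dd j i m n) => *; ring.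
Qed.

Lemma metric_inv_mul k l : \sum_i gi i k * g x i l = (k == l)%:R.
Proof.
have := congr1 (fun M : 'M[R]_4 => M k l) (mulVmx (gu Ux)); rewrite !mxE => <-.
by apply: eq_bigr => i _; rewrite invmx_sym.
Qed.

Lemma ricci_trace j n : ricci g j n x = \sum_i \sum_m gi i m * riemann g i j m n x.
Proof.
rewrite exchange_big; apply: eq_bigr => k _; rewrite /riemann.
under eq_bigr do rewrite mulr_sumr.
rewrite exchange_big /=.
have E l : \sum_i gi i k * (g x i l * riemann_up g l j k n x) =
    (k == l)%:R * riemann_up g l j k n x.
  by rewrite -metric_inv_mul mulr_suml; apply: eq_bigr => i _; rewrite mulrA.
under eq_bigr do rewrite E.
rewrite (bigD1 k)//= big1 => [|l lk]; first by rewrite eqxx mul1r addr0.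
by rewrite eq_sym (negbTE lk) mul0r.
Qed.

Lemma ricci_sym j n : ricci g j n x = ricci g n j x.
Proof.
rewrite !ricci_trace exchange_big; apply: eq_bigr => i _; apply: eq_bigr => m _.
by rewrite invmx_sym (curv_pair riemann_curvature_like).
Qed.

Lemma weyl_curvature_like : curvature_like (fun i j m n => weyl_coord g i j m n x).
Proof.
have [a12 a34 cyc] := riemann_curvature_like.
split=> i j m n; rewrite /weyl_coord.
- rewrite a12; move: (riemann g j i m n x) (ricci g) (g x) (scalar_curvature g x) => *.
  ring.
- rewrite a34; move: (riemann g i j n m x) (ricci g) (g x) (scalar_curvature g x) => *.
  ring.
- rewrite (ricci_sym n j) (ricci_sym m n) (ricci_sym m j) (ricci_sym n m).
  rewrite (metric_symE n j Ux) (metric_symE m n Ux) (metric_symE m j Ux).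
  move: (cyc i j m n) (ricci g) (g x) (scalar_curvature g x).
  move: (riemann g i j m n x) (riemann g i m n j x) (riemann g i n j m x) => r1 r2 r3.
  by move=> H c h s; rewrite -[RHS]H; ring.
Qed.

(** In dimension 4 the traces balance: Ric - (1/2) (4 Ric + sc g - 2 Ric) + (sc / 6) (4 - 1) g =
    0. *)
Lemma weyl_trace j n : \sum_i \sum_m gi i m * weyl_coord g i j m n x = 0.
Proof.
pose G := g x; pose Ric := fun j n => ricci g j n x; pose sc := scalar_curvature g x.
have T1 : \sum_i \sum_m gi i m * (G i m * Ric j n) = 4 * Ric j n.
  have E i : \sum_m gi i m * (G i m * Ric j n) = Ric j n.
    under eq_bigr do rewrite invmx_sym (metric_symE i _ Ux) mulrA.
    by rewrite -mulr_suml metric_inv_mul eqxx mul1r.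
  by under eq_bigr do rewrite E; rewrite sumr_const card_ord mulr_natl.
have T1' : \sum_i \sum_m gi i m * (G i m * G j n) = 4 * G j n.
  have E i : \sum_m gi i m * (G i m * G j n) = G j n.
    under eq_bigr do rewrite invmx_sym (metric_symE i _ Ux) mulrA.
    by rewrite -mulr_suml metric_inv_mul eqxx mul1r.
  by under eq_bigr do rewrite E; rewrite sumr_const card_ord mulr_natl.
have T2 : \sum_i \sum_m gi i m * (G j n * Ric i m) = G j n * sc.
  rewrite /sc /scalar_curvature mulr_sumr; apply: eq_bigr => i _; rewrite mulr_sumr.
  by apply: eq_bigr => m _; rewrite mulrCA.
have T3 (f : 'I_4 -> R) : \sum_i \sum_m gi i m * (G i n * f m) = f n.
  rewrite exchange_big /=.
  have E m : \sum_i gi i m * (G i n * f m) = (m == n)%:R * f m.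
    by rewrite -metric_inv_mul mulr_suml; apply: eq_bigr => i _; rewrite mulrA.
  under eq_bigr do rewrite E.
  rewrite (bigD1 n)//= big1 => [|l ln]; first by rewrite eqxx mul1r addr0.
  by rewrite (negbTE ln) mul0r.
have T4 (f : 'I_4 -> R) : \sum_i \sum_m gi i m * (G j m * f i) = f j.
  apply: etrans (_ : \sum_i (j == i)%:R * f i = _).
    apply: eq_bigr => i _; under eq_bigr do rewrite invmx_sym (metric_symE j _ Ux) mulrA.
    by rewrite -mulr_suml metric_inv_mul eq_sym.
  rewrite (bigD1 j)//= big1 => [|l lj]; first by rewrite eqxx mul1r addr0.
  by rewrite eq_sym (negbTE lj) mul0r.
pose tr (f : 'I_4 -> 'I_4 -> R) := \sum_i \sum_m gi i m * f i m.
have lin c f h : tr (fun i m => f i m + c * h i m) = tr f + c * tr h.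
  rewrite /tr mulr_sumr -big_split; apply: eq_bigr => i _ /=.
  by rewrite mulr_sumr -big_split; apply: eq_bigr => m _ /=; rewrite mulrDr mulrCA.
have -> : \sum_i \sum_m gi i m * weyl_coord g i j m n x = tr (fun i m =>
    riemann g i j m n x + (- 2^-1) * (G i m * Ric j n) + (- 2^-1) * (G j n * Ric i m)
    + 2^-1 * (G i n * Ric j m) + 2^-1 * (G j m * Ric i n)
    + (sc / 6) * (G i m * G j n) + (- (sc / 6)) * (G i n * G j m)).
  apply: eq_bigr => i _; apply: eq_bigr => m _; congr (_ * _).
  rewrite /weyl_coord -/(Ric j n) -/(Ric i m) -/(Ric j m) -/(Ric i n) -/sc -/G.
  move: (riemann g i j m n x) (Ric j n) (Ric i m) (Ric j m) (Ric i n) => r c1 c2 c3 c4.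
  by move: (G i m) (G j n) (G i n) (G j m) => h1 h2 h3 h4; ring.
rewrite !lin /tr -ricci_trace -/(Ric j n) T1 T1' T2 !T3 !T4.
by move: (Ric j n) (G j n) => c h; field.
Qed.

End RiemannSymmetries.

(** * Type D from the vanishing of W(4,a,4,b) and W(4,a,4,3) *)

Section TypeD.
Context {R : realType}.
Local Notation pt := 'rV[R]_4.

(* Slots 0, 1 stand for e_3, e_4 and slots 2, 3 for the horizontal vectors. *)
Definition hslot (a : 'I_2) : 'I_4 := if a == 0 then 2 else 3.

(** The trace over (4,a) turns the vanishing of W(4,a,4,3) into that of W(4,a,c,b). The horizontal
    traces make the symmetric part of W(a,4,3,b) pure trace, the (4,3) trace gives its size, and the
    cyclic identity its antisymmetric part. *)
Lemma frame_weyl (w : 'I_4 -> 'I_4 -> 'I_4 -> 'I_4 -> R) : curvature_like w ->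
  (forall p q, - 2^-1 * (w 0 p 1 q + w 1 p 0 q) + (w 2 p 2 q + w 3 p 3 q) = 0) ->
  (forall a b, w 1 (hslot a) 1 (hslot b) = 0) -> (forall a, w 1 (hslot a) 1 0 = 0) ->
  [/\ forall a b c, w 1 (hslot a) (hslot c) (hslot b) = 0,
      forall a b, w (hslot a) (hslot b) 0 1 = vol a b * w 2 3 0 1
    & forall a b, w (hslot a) 1 0 (hslot b) =
        (a == b)%:R * (4^-1 * w 0 1 0 1) + vol a b * (2^-1 * w 2 3 0 1) ].
Proof.
move=> cw tr al be; have [a12 a34 cyc] := cw; have pr := curv_pair cw.
have a0 i m n : w i i m n = 0 by have := a12 i i m n; lra.
have a0' i j m : w i j m m = 0 by have := a34 i j m m; lra.
have b2 : w 1 2 1 0 = 0 by have := be 0.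
have b3 : w 1 3 1 0 = 0 by have := be 1.
split.
- have t2 := tr 1 2; have t3 := tr 1 3.
  have e1 : w 0 1 1 2 = 0 by have := a12 0 1 1 2; rewrite (pr 1 0 1 2); lra.
  have e2 : w 0 1 1 3 = 0 by have := a12 0 1 1 3; rewrite (pr 1 0 1 3); lra.
  have w1 : w 3 1 3 2 = 0 by move: t2; rewrite e1 !a0 !a0'; lra.
  have w2 : w 2 1 2 3 = 0 by move: t3; rewrite e2 !a0 !a0'; lra.
  have w3 : w 1 3 3 2 = 0 by have := a12 1 3 3 2; lra.
  have w4 : w 1 2 2 3 = 0 by have := a12 1 2 2 3; lra.
  have w5 : w 1 3 2 3 = 0 by have := a34 1 3 2 3; lra.
  have w6 : w 1 2 3 2 = 0 by have := a34 1 2 3 2; lra.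
  by move=> a b c; case: (I2P a) => ->; case: (I2P b) => ->; case: (I2P c) => ->.
- move=> a b; case: (I2P a) => ->; case: (I2P b) => ->; rewrite !volE /hslot /=.
  + by rewrite a0 mul0r.
  + by rewrite mul1r.
  + by rewrite a12 mulN1r.
  + by rewrite a0 mul0r.
- have t10 := tr 1 0; have t22 := tr 2 2; have t33 := tr 3 3; have t23 := tr 2 3.
  have p0 := pr 0 2 1 2; have p1 := pr 0 3 1 3; have p2 := pr 0 2 1 3.
  have q0 := a12 1 2 0 2; have q0' := a34 2 1 0 2.
  have q1 := a12 1 3 0 3; have q1' := a34 3 1 0 3.
  have q2 := a12 1 2 0 3; have q2' := a34 2 1 0 3.
  have q3 := a12 1 3 0 2; have q3' := a34 3 1 0 2.
  have z1 := a0 1 0 0; have z2 := a0' 1 1 0; have z3 := a0 2 2 3; have z4 := a0' 3 2 3.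
  have z5 := a0 2 2 2; have z6 := a0 3 3 3; have z7 := a0' 2 3 2.
  have s1 := a12 3 2 3 2; have s2 := a34 2 3 3 2.
  have c1 := cyc 1 2 3 0.
  have d1 := pr 1 0 2 3; have d2 := a34 2 3 1 0; have d3 := a34 1 2 3 0.
  have f1 := a34 0 1 1 0.
  have n1 := a0 1 0 0.
  move=> a b; case: (I2P a) => ->; case: (I2P b) => ->; rewrite !volE /hslot /=.
  all: by lra.
Qed.

Section Slots.
Variables (S : framed_spacetime R) (x : pt).
Local Notation g := (metric S).
Local Notation W := (fun i j m n => weyl_coord g i j m n x).
Hypothesis cW : curvature_like W.
Hypothesis trW : forall j n, \sum_i \sum_m invmx (g x) i m * W i j m n = 0.
Hypothesis giE : invmx (g x) = dual_metric S x.

Lemma tensor4_dual (V : 'I_4 -> 'I_4 -> 'I_4 -> 'I_4 -> R) (Y T : pt) :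
  \sum_i \sum_m dual_metric S x i m * (\sum_j \sum_n V i j m n * Y 0 j * T 0 n) =
  - 2^-1 * (tensor4 V (f3 S x) Y (f4 S x) T + tensor4 V (f4 S x) Y (f3 S x) T)
  + (tensor4 V (fh S 0 x) Y (fh S 0 x) T + tensor4 V (fh S 1 x) Y (fh S 1 x) T).
Proof.
rewrite -!tensor4_contract13 mulrDr !mulr_sumr -!big_split; apply: eq_bigr => i _ /=.
rewrite !mulr_sumr -!big_split; apply: eq_bigr => m _ /=.
by rewrite /dual_metric sum2 !mxE; ring.
Qed.

Lemma weyl_frame_trace (Y T : pt) :
  - 2^-1 * (weyl g x (f3 S x) Y (f4 S x) T + weyl g x (f4 S x) Y (f3 S x) T)
  + (weyl g x (fh S 0 x) Y (fh S 0 x) T + weyl g x (fh S 1 x) Y (fh S 1 x) T) = 0.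
Proof.
rewrite -[LHS](tensor4_dual W) -giE.
under eq_bigr do under eq_bigr do rewrite mulr_sumr.
under eq_bigr do rewrite exchange_big /=.
rewrite exchange_big big1// => j _ /=.
under eq_bigr do under eq_bigr do rewrite mulr_sumr.
under eq_bigr do rewrite exchange_big /=.
rewrite exchange_big big1// => n _ /=.
apply: etrans (_ : Y 0 j * T 0 n * \sum_i \sum_m invmx (g x) i m * W i j m n = 0);
  last by rewrite trW mulr0.
rewrite mulr_sumr; apply: eq_bigr => i _; rewrite mulr_sumr.
by apply: eq_bigr => m _; ring.
Qed.

Definition slot (p : 'I_4) : pt := [:: f3 S x; f4 S x; fh S 0 x; fh S 1 x]`_p.

Lemma slot_h a : slot (hslot a) = fh S a x.
Proof. by case: (I2P a) => ->. Qed.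

Lemma slot_weyl_curvature_like :
  curvature_like (fun p q r s => weyl g x (slot p) (slot q) (slot r) (slot s)).
Proof.
split=> *; [exact: tensor4_anti12|exact: tensor4_anti34|exact: tensor4_cyclic].
Qed.

Hypothesis al0 : forall a b, weyl g x (f4 S x) (fh S a x) (f4 S x) (fh S b x) = 0.
Hypothesis be0 : forall a, weyl g x (f4 S x) (fh S a x) (f4 S x) (f3 S x) = 0.

Lemma aligned_of :
  (forall a, betaF S x a = 0) -> (forall a, xi S x a = 0) ->
  (chi S x 0 0 = chi S x 1 1 /\ chi S x 0 1 = - chi S x 1 0) ->
  deriveC (f4 S x) (PF S) x = - conjc (trX S x) * PF S x ->
  deriveC (fh S 0 x) (PF S) x + (0 +i* 1)%C * deriveC (fh S 1 x) (PF S) x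
    = - 2 * Hc S x 0 * PF S x ->
  aligned S x.
Proof.
move=> HF Hxi Hchi HP4 HPh.
have A12 X Y Z T : weyl g x X Y Z T = - weyl g x Y X Z T by exact: tensor4_anti12.
have A34 X Y Z T : weyl g x X Y Z T = - weyl g x X Y T Z by exact: tensor4_anti34.
have P X Y Z T : weyl g x X Y Z T = weyl g x Z T X Y by exact: tensor4_pair.
have z X Z T : weyl g x X X Z T = 0 by have := A12 X X Z T; lra.
have z' X Z T : weyl g x Z T X X = 0 by rewrite P.
have al' a b : weyl g x (slot 1) (slot (hslot a)) (slot 1) (slot (hslot b)) = 0.
  by rewrite !slot_h; exact: al0.
have be' a : weyl g x (slot 1) (slot (hslot a)) (slot 1) (slot 0) = 0.
  by rewrite slot_h; exact: be0.
have [w1 w2 w3] := frame_weyl slot_weyl_curvature_like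
  (fun p q => weyl_frame_trace (slot p) (slot q)) al' be'.
have w1' a b c : weyl g x (f4 S x) (fh S a x) (fh S c x) (fh S b x) = 0.
  by have := w1 a b c; rewrite !slot_h.
split=> //.
- by move=> a b; rewrite A12 A34 opprK.
- by move=> a; rewrite /beta A12 A34 opprK be0 mulr0.
- by move=> b; rewrite P.
- by move=> a b c; rewrite P.
- by rewrite /rho A12 A34 opprK mulrA mulfV ?mul1r// pnatr_eq0.
- move=> a b; have := w2 a b; rewrite !slot_h => ->.
  rewrite /rhod -[weyl g x (slot 2) _ _ _]/(weyl g x (fh S 0 x) (fh S 1 x) (f3 S x) (f4 S x)).
  by move: (weyl g x (fh S 0 x) (fh S 1 x) (f3 S x) (f4 S x)) => u; field.
- move=> a b; have := w3 a b; rewrite !slot_h => ->.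
  by congr (_ * _ + _); rewrite /rho A12 A34 opprK.
Qed.

End Slots.
End TypeD.

Section RiemannVector.
Context {R : realType}.
Local Notation pt := 'rV[R]_4.
Implicit Types (X Y Z T : pt).

Lemma tensor4_perm (F : 'I_4 -> 'I_4 -> 'I_4 -> 'I_4 -> R) X Y Z T :
  [/\ tensor4 (fun i j m n => F m i n j) X Y Z T = tensor4 F Z X T Y,
      tensor4 (fun i j m n => F m j n i) X Y Z T = tensor4 F Z Y T X,
      tensor4 (fun i j m n => F n i m j) X Y Z T = tensor4 F T X Z Y
    & tensor4 (fun i j m n => F n j m i) X Y Z T = tensor4 F T Y Z X].
Proof.
have P1 X' Y' Z' T' : tensor4 (fun i j m n => F m i n j) X' Y' Z' T' = tensor4 F Z' X' T' Y'.
  rewrite (tensor4_swap23 (fun i j m n => F j i n m)).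
  by rewrite (tensor4_swap12 (fun i j m n => F i j n m)) tensor4_swap34.
split; first exact: P1.
- by rewrite (tensor4_swap12 (fun i j m n => F m i n j)) P1.
- by rewrite (tensor4_swap34 (fun i j m n => F m i n j)) P1.
- by rewrite (tensor4_swap12 (fun i j m n => F n i m j))
    (tensor4_swap34 (fun i j m n => F m i n j)) P1.
Qed.

Lemma tensor4_sum (F : 'I_4 -> 'I_4 -> 'I_4 -> 'I_4 -> 'I_4 -> R) X Y Z T :
  tensor4 (fun i j m n => \sum_k F k i j m n) X Y Z T = \sum_k tensor4 (F k) X Y Z T.
Proof.
elim: (index_enum _) => [|k s IH].
  rewrite big_nil; under tensor4_eq do rewrite big_nil.
  by rewrite /tensor4; do 4! (rewrite big1// => ? _); rewrite !mul0r.
by rewrite big_cons; under tensor4_eq do rewrite big_cons; rewrite tensor4D IH.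
Qed.

End RiemannVector.

(** * The Kerr-Newman background *)

Section RationalTrigonometric.
Context {R : realType}.
Local Notation pt := 'rV[R]_4.

(* Reified rational functions of [r], [cos theta] and [sin theta]: the first and
   second derivatives of the metric then reduce by computation. *)
Inductive rexpr :=
  | Cst of R | Rad | Cos | Sin
  | Add of rexpr & rexpr | Mul of rexpr & rexpr | Inv of rexpr.

Fixpoint ev (e : rexpr) (x : pt) : R :=
  match e with
  | Cst c => c | Rad => rad x | Cos => cos (theta x) | Sin => sin (theta x)
  | Add e f => ev e x + ev f x | Mul e f => ev e x * ev f x | Inv e => (ev e x)^-1
  end.

Fixpoint defined (e : rexpr) (x : pt) : Prop :=
  match e with
  | Add e f => defined e x /\ defined f x | Mul e f => defined e x /\ defined f x
  | Inv e => defined e x /\ ev e x != 0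
  | _ => True
  end.

Fixpoint fdiff (k : 'I_4) (e : rexpr) : rexpr :=
  match e with
  | Cst c => Cst 0 | Rad => Cst (k == 1)%:R
  | Cos => Mul (Cst (- (k == 2)%:R)) Sin | Sin => Mul (Cst (k == 2)%:R) Cos
  | Add e f => Add (fdiff k e) (fdiff k f)
  | Mul e f => Add (Mul (fdiff k e) f) (Mul e (fdiff k f))
  | Inv e => Mul (Cst (-1)) (Mul (Mul (Inv e) (Inv e)) (fdiff k e))
  end.

Lemma defined_fdiff k e x : defined e x -> defined (fdiff k e) x.
Proof. by elim: e => //= [e IHe f IHf [/IHe ? /IHf ?]|e IHe f IHf [? ?]|e IHe [? ?]]; auto. Qed.

(** Formal derivatives commute; this supplies the equality of mixed second derivatives of the
    metric. *)
Lemma fdiffC k m e x : ev (fdiff k (fdiff m e)) x = ev (fdiff m (fdiff k e)) x.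
Proof.
elim: e => //= [||e -> f ->|e -> f ->|e ->]; ring.
Qed.

Lemma coord_line (x v : pt) (h : R) i : (h *: v + x) 0 i = h * v 0 i + x 0 i.
Proof. by rewrite !mxE. Qed.

Lemma is_derive_line (p q : R) : is_derive (0 : R) (1 : R) (fun h : R => h * p + q) p.
Proof.
have H := is_deriveD (is_deriveM (is_derive_id (0 : R) (1 : R)) (is_derive_cst p (0 : R) (1 : R)))
  (is_derive_cst q (0 : R) (1 : R)).
by apply: is_derive_eq H _; rewrite scaler0 add0r addr0 -[_ *: _]/(_ * _) mulr1.
Qed.

Lemma grad_of_line (f : pt -> R) x (d : 'I_4 -> R) :
  (forall v, is_derive (0 : R) (1 : R) (fun h : R => f (h *: v + x)) (\sum_i v 0 i * d i)) ->
  has_gradient f x /\ forall k, pderive k f x = d k.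
Proof.
move=> H.
have D v : 'D_v f x = \sum_i v 0 i * d i by rewrite derive_along1; have [_] := H v.
have E k : pderive k f x = d k.
  rewrite /pderive D (bigD1 k)//= big1 => [|i ik]; first by rewrite mxE !eqxx mul1r addr0.
  by rewrite mxE eqxx /= (negbTE ik) mul0r.
split=> // v; split; first by apply/derivable1P; have [] := H v.
by rewrite D; apply: eq_bigr => i _; rewrite E.
Qed.

Lemma sum_pick (v : pt) (j : 'I_4) (c : R) : \sum_i v 0 i * (c * (i == j)%:R) = v 0 j * c.
Proof.
rewrite (bigD1 j)//= big1 => [|i ij]; first by rewrite eqxx mulr1 addr0.
by rewrite (negbTE ij) !mulr0.
Qed.

Lemma grad_ev e x : defined e x ->
  has_gradient (ev e) x /\ forall k, pderive k (ev e) x = ev (fdiff k e) x.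
Proof.
elim: e => /= [c||||e IHe f IHf|e IHe f IHf|e IHe] H.
- have [G D] := grad_cst c x; split=> // k; exact: D.
- apply: grad_of_line => v; under eq_bigr do rewrite -[_%:R]mul1r.
  rewrite sum_pick mulr1 /rad; under eq_fun do rewrite coord_line.
  exact: is_derive_line.
- apply: grad_of_line => v.
  have -> : \sum_i v 0 i * (- (i == 2)%:R * sin (theta x)) = - sin (theta x) * v 0 2.
    by rewrite mulrC -sum_pick; apply: eq_bigr => i _; ring.
  rewrite /theta; under eq_fun do rewrite coord_line.
  have := is_derive_line (v 0 2) (x 0 2).
  by apply: is_derive1_comp; rewrite mul0r add0r; exact: is_derive_cos.
- apply: grad_of_line => v.
  have -> : \sum_i v 0 i * ((i == 2)%:R * cos (theta x)) = cos (theta x) * v 0 2.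
    by rewrite mulrC -sum_pick; apply: eq_bigr => i _; ring.
  rewrite /theta; under eq_fun do rewrite coord_line.
  have := is_derive_line (v 0 2) (x 0 2).
  by apply: is_derive1_comp; rewrite mul0r add0r; exact: is_derive_sin.
- have [Ge De] := IHe H.1; have [Gf Df] := IHf H.2.
  have [G D] := gradD Ge Gf; split=> // k.
  by rewrite [LHS]D -De -Df.
- have [Ge De] := IHe H.1; have [Gf Df] := IHf H.2.
  have [G D] := gradM Ge Gf; split=> // k.
  by rewrite [LHS]D -De -Df.
- have [Ge De] := IHe H.1.
  have D v := deriveV H.2 (Ge v).1.
  split=> [v|k]; last by rewrite [LHS]D -De -[_ *: _]/(_ * _) mulNr mulN1r -exprVn expr2.
  split; first exact: derivableV H.2 (Ge v).1.
  rewrite D (Ge v).2 -[_ *: _]/(_ * _) mulr_sumr; apply: eq_bigr => i _.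
  by rewrite /pderive D -[_ *: _]/(_ * _) mulrCA.
Qed.

End RationalTrigonometric.

(** * The Kerr-Newman metric as a table of symbolic expressions *)

Section KerrNewmanMetric.
Context {R : realType}.
Local Notation pt := 'rV[R]_4.

(* The shape of the Kerr-Newman metric and of its derivatives. *)
Definition kn_mx (tt tp pp rr hh : R) : 'M[R]_4 := \matrix_(i, j)
  match val i, val j with
  | 0%N, 0%N => tt | 0%N, 3%N => tp | 3%N, 0%N => tp | 3%N, 3%N => pp
  | 1%N, 1%N => rr | 2%N, 2%N => hh | _, _ => 0
  end.

Lemma sum4 (V : nmodType) (F : 'I_4 -> V) : \sum_i F i = F 0 + F 1 + F 2 + F 3.
Proof.
rewrite !big_ord_recl big_ord0 addr0 !addrA.
by congr (_ + F _ + F _ + F _); exact: val_inj.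
Qed.

Lemma bil_kn tt tp pp rr hh (X Y : pt) : bil (kn_mx tt tp pp rr hh) X Y =
  tt * X 0 0 * Y 0 0 + tp * (X 0 0 * Y 0 3 + X 0 3 * Y 0 0) + pp * X 0 3 * Y 0 3
  + rr * X 0 1 * Y 0 1 + hh * X 0 2 * Y 0 2.
Proof. by rewrite bilE !sum4 !mxE /=; ring. Qed.

Lemma vec4E (a b c d : R) : (vec4 a b c d 0 0 = a) * (vec4 a b c d 0 1 = b)
  * (vec4 a b c d 0 2 = c) * (vec4 a b c d 0 3 = d).
Proof. by rewrite /vec4 !mxE. Qed.

Variables (M a Q : R).

Local Notation "e + f" := (Add e f).
Local Notation "e * f" := (Mul e f).
(** Sigma = |q|^2 written through the sine, so that in the metric the cosine arises only by
    differentiation. *)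
Definition eSig := Rad * Rad + (Cst (a ^+ 2)%R + Cst (- a ^+ 2)%R * (Sin * Sin)).
Definition eDel := Rad * Rad + (Cst (- (2 * M))%R * Rad + Cst (a ^+ 2 + Q ^+ 2)%R).
(** (r^2 + a^2 - Delta) / Sigma: expanding the squares in the metric, all mass and charge dependence
    of the (t, phi) block enters through it. *)
Definition eF := (Cst (2 * M)%R * Rad + Cst (- Q ^+ 2)%R) * Inv eSig.
Definition ett := Cst (-1) + eF.
Definition etp := Cst (- a) * (Sin * Sin * eF).
Definition epp := Sin * Sin * (Rad * Rad + Cst (a ^+ 2)%R + Cst (a ^+ 2)%R * (Sin * Sin * eF)).
Definition err := eSig * Inv eDel.

(** f is the identity for the metric itself and one or two formal derivatives for its
    derivatives. *)
Definition kn_ev (f : rexpr (R := R) -> rexpr) (x : pt) : 'M[R]_4 :=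
  kn_mx (ev (f ett) x) (ev (f etp) x) (ev (f epp) x) (ev (f err) x) (ev (f eSig) x).

Lemma ev_Sig x : ev eSig x = q2 a x.
Proof. by rewrite /q2 /= cos2sin2; ring. Qed.

Lemma ev_Del x : ev eDel x = Delta M a Q x.
Proof. by rewrite /Delta /=; ring. Qed.

Section Point.
Variable x : pt.
Hypothesis Cx : KN_chart M a Q x.

Lemma chart_Sig : ev eSig x != 0. Proof. by rewrite ev_Sig; case: Cx. Qed.
Lemma chart_Del : ev eDel x != 0. Proof. by rewrite ev_Del; case: Cx. Qed.
Lemma chart_sin : sin (theta x) != 0.
Proof. by case: Cx => t _ _; rewrite gt_eqF ?sin_gt0_pi. Qed.

Lemma defined_metric : [/\ defined ett x, defined etp x, defined epp x,
  defined err x & defined eSig x].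
Proof. by have := chart_Sig; have := chart_Del; split=> //=; tauto. Qed.

Lemma KN_metricE : KN_metric M a Q x = kn_ev id x.
Proof.
have S0 := chart_Sig; have D0 := chart_Del.
have DE : Delta M a Q x = ev eDel x by rewrite ev_Del.
rewrite /KN_metric -!ev_Sig DE.
move: S0 D0; rewrite /kn_ev /=; set r := rad x; set s := sin (theta x) => S0 D0.
apply/matrixP => i j; rewrite /sq /vec4 !mxE !big_ord1 !mxE.
case: i => [[|[|[|[|//]]]] ?]; case: j => [[|[|[|[|//]]]] ?] /=.
all: by field; rewrite ?S0 ?D0.
Qed.

End Point.
End KerrNewmanMetric.

(** * Metric derivatives and curvature in the principal frame *)

Section FrozenTables.
Context {R : realType}.
Local Notation pt := 'rV[R]_4.
Variables (M a Q : R) (x : pt).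
Hypothesis Cx : KN_chart M a Q x.

Local Notation r := (rad x).
Local Notation s := (sin (theta x)).
Local Notation c := (cos (theta x)).
Local Notation Sg := (ev (eSig a) x).
Local Notation Dl := (ev (eDel M a Q) x).

(* The principal null directions: [KN_e4] for [sg = 1], a multiple of [KN_e3]
   for [sg = -1]. *)
Definition null_vec (sg : R) y : pt := vec4 ((rad y * rad y + a ^+ 2) / ev (eDel M a Q) y)
  sg 0 (a / ev (eDel M a Q) y).
(** With [hor2], the vectors |q| e_1 and |q| e_2: dropping the square root keeps all components
    rational. *)
Definition hor1 : pt := vec4 0 0 1 0.
Definition hor2 y : pt := vec4 (a * sin (theta y)) 0 0 (sin (theta y))^-1.

Local Notation L sg := (null_vec sg x).
Local Notation N2 := (hor2 x).

Definition dmet k := bil (kn_ev M a Q (fdiff k) x).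
Definition ddmet k m := bil (kn_ev M a Q (fun e => fdiff k (fdiff m e)) x).
(** The r-derivative of Sigma / Delta. *)
Definition Kexpr : R := (2 * r * Dl - Sg * (2 * (r - M))) / Dl ^+ 2.

Ltac table := rewrite /dmet /ddmet /kn_ev ?bil_kn /null_vec /hor1 /hor2 ?vec4E /Kexpr;
  have := chart_Sig Cx; have := chart_Del Cx; have := chart_sin Cx;
  move: (cos2sin2 (theta x)); rewrite /=; move: r s c => r0 s0 c0 cs S0 D0 Z0.

Ltac table_by := table; field; repeat (apply/andP; split); repeat split; assumption.

Lemma dmet_sym k X Y : dmet k X Y = dmet k Y X.
Proof. by rewrite /dmet /kn_ev !bil_kn; ring. Qed.
Lemma ddmet_sym k m X Y : ddmet k m X Y = ddmet k m Y X.
Proof. by rewrite /ddmet /kn_ev !bil_kn; ring. Qed.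

Lemma met_LL sg tau : bil (kn_ev M a Q id x) (L sg) (L tau) = (sg * tau - 1) * Sg / Dl.
Proof. table_by. Qed.
Lemma met_L1 sg : bil (kn_ev M a Q id x) (L sg) hor1 = 0.
Proof. table_by. Qed.
Lemma met_L2 sg : bil (kn_ev M a Q id x) (L sg) N2 = 0.
Proof. table_by. Qed.
Lemma dr_LL sg tau : dmet 1 (L sg) (L tau) = (1 + sg * tau) * Kexpr.
Proof. table_by. Qed.
Lemma dr_L1 sg : dmet 1 (L sg) hor1 = 0.
Proof. table_by. Qed.
Lemma dr_L2 sg : dmet 1 (L sg) N2 = 2 * r * a * s / Dl.
Proof. table_by. Qed.
Lemma dr_11 : dmet 1 hor1 hor1 = 2 * r.
Proof. table_by. Qed.
Lemma dr_12 : dmet 1 hor1 N2 = 0.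
Proof. table_by. Qed.
Lemma dr_22 : dmet 1 N2 N2 = 2 * r.
Proof. table_by. Qed.

Lemma dt_LL sg tau : dmet 2 (L sg) (L tau) = 2 * (1 - sg * tau) * a ^+ 2 * s * c / Dl.
Proof. table_by. Qed.
Lemma dt_L1 sg : dmet 2 (L sg) hor1 = 0.
Proof. table_by. Qed.
Lemma dt_L2 sg : dmet 2 (L sg) N2 = 2 * a * c.
Proof. table_by. Qed.
Lemma dt_11 : dmet 2 hor1 hor1 = - 2 * a ^+ 2 * s * c.
Proof. table_by. Qed.
Lemma dt_12 : dmet 2 hor1 N2 = 0.
Proof. table_by. Qed.
Lemma dt_22 : dmet 2 N2 N2 = 2 * c * (r ^+ 2 + a ^+ 2) / s.
Proof. table_by. Qed.

Lemma drr_11 : ddmet 1 1 hor1 hor1 = 2.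
Proof. table_by. Qed.
Lemma drr_12 : ddmet 1 1 hor1 N2 = 0.
Proof. table_by. Qed.
Lemma drr_22 : ddmet 1 1 N2 N2 = 2.
Proof. table_by. Qed.
Lemma drr_L1 sg : ddmet 1 1 (L sg) hor1 = 0.
Proof. table_by. Qed.
Lemma drr_L2 sg : ddmet 1 1 (L sg) N2 = 2 * a * s / Dl.
Proof. table_by. Qed.
Lemma drt_L1 sg : ddmet 1 2 (L sg) hor1 = 0.
Proof. table_by. Qed.
Lemma drt_L2 sg : ddmet 1 2 (L sg) N2 = 2 * a * c * (2 * (r - M) / Dl - 2 * r / Sg)
  + 4 * r * a * c * (r ^+ 2 + a ^+ 2) / (Sg * Dl).
Proof. table_by. Qed.
Lemma drt_LL sg tau : ddmet 1 2 (L sg) (L tau) =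
  2 * (1 + sg * tau) * a ^+ 2 * s * c * (2 * (r - M)) / Dl ^+ 2.
Proof. table_by. Qed.

Lemma dtt_LL sg tau : ddmet 2 2 (L sg) (L tau) =
  2 * (1 - sg * tau) * a ^+ 2 * (c ^+ 2 - s ^+ 2) / Dl.
Proof. table_by. Qed.

(** [frozen_conn] for a stationary axisymmetric metric: only the r and theta derivatives survive. *)
Definition frozen (A B Z : pt) : R :=
  A 0 1 * dmet 1 B Z + A 0 2 * dmet 2 B Z + (B 0 1 * dmet 1 A Z + B 0 2 * dmet 2 A Z)
  - (Z 0 1 * dmet 1 A B + Z 0 2 * dmet 2 A B).

Definition frozen2 (A B C D : pt) : R :=
  A 0 1 * B 0 1 * ddmet 1 1 C D + (A 0 1 * B 0 2 + A 0 2 * B 0 1) * ddmet 1 2 C D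
  + A 0 2 * B 0 2 * ddmet 2 2 C D.

(* Contraction of two lower Christoffel symbols in the principal frame. *)
Definition gamma_sq (A B C D : pt) : R := 4^-1 * (
  - (Dl / (2 * Sg)) * (frozen A B (L 1) * frozen C D (L (-1))
                       + frozen A B (L (-1)) * frozen C D (L 1))
  + Sg^-1 * (frozen A B hor1 * frozen C D hor1 + frozen A B N2 * frozen C D N2)).

Definition riem4 (X Y Z T : pt) : R :=
  2^-1 * (frozen2 Z Y T X + frozen2 T X Z Y - frozen2 Z X T Y - frozen2 T Y Z X)
  - gamma_sq Z X T Y + gamma_sq T X Z Y.

Let comps : (forall sg, L sg 0 1 = sg) * (forall sg, L sg 0 2 = 0) * (hor1 0 1 = 0)
  * (hor1 0 2 = 1) * (N2 0 1 = 0) * (N2 0 2 = 0).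
Proof. by rewrite /null_vec /hor1 /hor2; do !split=> *; rewrite vec4E. Qed.

Let dmet_21 : (forall sg, dmet 1 hor1 (L sg) = 0)
  * (forall sg, dmet 1 N2 (L sg) = dmet 1 (L sg) N2)
  * (forall sg, dmet 2 hor1 (L sg) = 0) * (forall sg, dmet 2 N2 (L sg) = dmet 2 (L sg) N2)
  * (dmet 1 N2 hor1 = 0) * (dmet 2 N2 hor1 = 0).
Proof.
by do !split; try move=> sg; rewrite dmet_sym ?dr_L1 ?dt_L1 ?dr_12 ?dt_12.
Qed.

Let ddmet_21 : (forall sg, ddmet 1 1 hor1 (L sg) = 0)
  * (forall sg, ddmet 1 1 N2 (L sg) = ddmet 1 1 (L sg) N2)
  * (forall sg, ddmet 1 2 hor1 (L sg) = 0)
  * (forall sg, ddmet 1 2 N2 (L sg) = ddmet 1 2 (L sg) N2) * (ddmet 1 1 N2 hor1 = 0).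
Proof. by do !split; try move=> sg; rewrite ddmet_sym ?drr_L1 ?drt_L1 ?drr_12. Qed.

(** Substituting the tables leaves a rational identity in r, sin and cos, closed by [field] modulo
    cos^2 = 1 - sin^2. *)
Ltac curvature := rewrite /riem4 /frozen2 /gamma_sq /frozen !comps ?dmet_21 ?ddmet_21
  ?dr_LL ?dr_L1 ?dr_L2 ?dr_11 ?dr_12 ?dr_22 ?dt_LL ?dt_L1 ?dt_L2 ?dt_11 ?dt_12 ?dt_22
  ?drr_11 ?drr_12 ?drr_22 ?drr_L1 ?drr_L2 ?drt_L1 ?drt_L2 ?drt_LL ?dtt_LL
  ?(mul0r, mulr0, add0r, addr0, subr0, mul1r, mulr1);
  rewrite /Kexpr; have := chart_Sig Cx; have := chart_Del Cx; have := chart_sin Cx;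
  move: (cos2sin2 (theta x)); rewrite /=; move: r s c => r0 s0 c0 cs S0 D0 Z0.

Ltac curvature_by := curvature;
  match goal with H : _ = 1 - _ |- _ => first [field: H | field] end;
  repeat (apply/andP; split); repeat split; assumption.

(** By multilinearity these entries cover every rescaled and rotated frame, for both null
    directions. *)
Lemma riem4_alpha sg X Y : sg = 1 \/ sg = -1 -> X = hor1 \/ X = N2 -> Y = hor1 \/ Y = N2 ->
  riem4 (L sg) X (L sg) Y = 0.
Proof. by case=> -> [] -> [] ->; curvature_by. Qed.

Lemma riem4_beta sg X : sg = 1 \/ sg = -1 -> X = hor1 \/ X = N2 ->
  riem4 (L sg) X (L sg) (L (- sg)) = 0.
Proof. by case=> -> [] ->; rewrite ?opprK; curvature_by. Qed.

(** The r-derivative of [null_vec]; the sign sg is constant and disappears. *)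
Definition null_vec_r : pt := vec4 ((2 * r * Dl - (r * r + a ^+ 2) * (2 * (r - M))) / Dl ^+ 2)
  0 0 (- (a * (2 * (r - M))) / Dl ^+ 2).

Lemma met_dL1 : bil (kn_ev M a Q id x) null_vec_r hor1 = 0.
Proof. rewrite /null_vec_r; table_by. Qed.
Lemma met_dL2 : bil (kn_ev M a Q id x) null_vec_r N2 = - 2 * r * a * s / Dl.
Proof. rewrite /null_vec_r; table_by. Qed.

Ltac conn := rewrite /frozen !comps ?dmet_21 ?dr_LL ?dr_L1 ?dr_L2 ?dr_11 ?dr_12 ?dr_22
  ?dt_LL ?dt_L1 ?dt_L2 ?dt_11 ?dt_12 ?dt_22.

Lemma frozen_1L1 sg : frozen hor1 (L sg) hor1 = 2 * sg * r.
Proof. by conn; ring. Qed.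
Lemma frozen_1L2 sg : frozen hor1 (L sg) N2 = 2 * a * c.
Proof. by conn; ring. Qed.
Lemma frozen_2L1 sg : frozen N2 (L sg) hor1 = - 2 * a * c.
Proof. by conn; ring. Qed.
Lemma frozen_2L2 sg : frozen N2 (L sg) N2 = 2 * sg * r.
Proof. by conn; ring. Qed.
Lemma frozen_LL1 sg tau : frozen (L sg) (L tau) hor1 =
  - 2 * (1 - sg * tau) * a ^+ 2 * s * c / Dl.
Proof. by conn; ring. Qed.
Lemma frozen_LL2 sg tau : frozen (L sg) (L tau) N2 = 2 * (sg + tau) * r * a * s / Dl.
Proof. by conn; ring. Qed.

End FrozenTables.

(** * Weyl and Ricci tensors contracted with frame vectors *)

Section Contractions.
Context {R : realType}.
Local Notation pt := 'rV[R]_4.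

Definition pair_row (p : 'I_4 -> R) (v : pt) : R := \sum_k p k * v 0 k.

Lemma dual_metric_contract (e : frame R) x (p q : 'I_4 -> R) :
  \sum_k \sum_l dual_metric e x k l * p k * q l =
  - 2^-1 * (pair_row p (f3 e x) * pair_row q (f4 e x)
            + pair_row p (f4 e x) * pair_row q (f3 e x))
  + (pair_row p (fh e 0 x) * pair_row q (fh e 0 x)
     + pair_row p (fh e 1 x) * pair_row q (fh e 1 x)).
Proof.
rewrite /pair_row !mulr_suml -!big_split mulr_sumr -!big_split; apply: eq_bigr => k _ /=.
rewrite !mulr_sumr -!big_split mulr_sumr -!big_split; apply: eq_bigr => l _ /=.
by rewrite /dual_metric !mxE sum2 !mxE !big_ord1 !mxE; ring.
Qed.

Lemma weyl_vec (g : pt -> 'M[R]_4) x X Y Z T :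
  let Rc := \matrix_(i, j) ricci g i j x in
  weyl g x X Y Z T = tensor4 (fun i j m n => riemann g i j m n x) X Y Z T
  - 2^-1 * (bil (g x) X Z * bil Rc Y T + bil Rc X Z * bil (g x) Y T
            - bil (g x) X T * bil Rc Y Z - bil Rc X T * bil (g x) Y Z)
  + scalar_curvature g x / 6 * (bil (g x) X Z * bil (g x) Y T
                               - bil (g x) X T * bil (g x) Y Z).
Proof.
move=> Rc; set sc := scalar_curvature g x.
apply: etrans (_ : tensor4 (fun i j m n => riemann g i j m n x
   + (- 2^-1 * (g x i m * Rc j n) + (- 2^-1 * (Rc i m * g x j n)
   + (2^-1 * (g x i n * Rc j m) + (2^-1 * (Rc i n * g x j m)
   + (sc / 6 * (g x i m * g x j n) + (- (sc / 6) * (g x i n * g x j m)))))))) X Y Z T = _).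
  apply: tensor4_eq => i j m n; rewrite /weyl_coord !mxE -/sc.
  by move: (riemann g i j m n x) (ricci g) (g x) sc => *; ring.
by rewrite !tensor4D !tensor4Z !tensor4_prod13 !tensor4_prod14; ring.
Qed.

(** The completeness relation expands the contraction in F F over the frame, so that Ricci
    components are read off the electromagnetic ones. *)
Lemma einstein_ricci (g F : pt -> 'M[R]_4) (e : frame R) x X Y :
  (forall m n, einstein_residual g F m n x = 0) -> invmx (g x) = dual_metric e x ->
  bil (\matrix_(i, j) ricci g i j x) X Y =
  2 * (- 2^-1 * (bil (F x) X (f3 e x) * bil (F x) Y (f4 e x)
                 + bil (F x) X (f4 e x) * bil (F x) Y (f3 e x))
       + (bil (F x) X (fh e 0 x) * bil (F x) Y (fh e 0 x)
          + bil (F x) X (fh e 1 x) * bil (F x) Y (fh e 1 x)))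
  - 2^-1 * normF2 g F x * bil (g x) X Y.
Proof.
move=> E giE.
pose f m n := \sum_l F x m l * raise g F n l x.
have rE i j : ricci g i j x = 2 * f i j
    - 2^-1 * g x i j * normF2 g F x.
  by apply/eqP; rewrite -subr_eq0; exact/eqP/E.
have bE Z W : bil (F x) Z W = pair_row (fun l => \sum_m Z 0 m * F x m l) W.
  by rewrite bilE.
have -> : - 2^-1 * (bil (F x) X (f3 e x) * bil (F x) Y (f4 e x)
                 + bil (F x) X (f4 e x) * bil (F x) Y (f3 e x))
       + (bil (F x) X (fh e 0 x) * bil (F x) Y (fh e 0 x)
          + bil (F x) X (fh e 1 x) * bil (F x) Y (fh e 1 x)) =
   \sum_k \sum_l dual_metric e x k l * (\sum_n Y 0 n * F x n k) * (\sum_m X 0 m * F x m l).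
  by rewrite dual_metric_contract !bE; ring.
rewrite -giE.
have T : \sum_n (\sum_m X 0 m * f m n) * Y 0 n =
    \sum_k \sum_l invmx (g x) k l * (\sum_n Y 0 n * F x n k) * (\sum_m X 0 m * F x m l).
  have D (c : R) (A B : 'I_4 -> R) :
      c * (\sum_n A n) * (\sum_m B m) = \sum_n \sum_m c * A n * B m.
    rewrite -mulrA big_distrlr mulr_sumr; apply: eq_bigr => n _ /=.
    by rewrite mulr_sumr; apply: eq_bigr => m _; rewrite mulrA.
  under [RHS]eq_bigr do under eq_bigr do rewrite D.
  under [RHS]eq_bigr do rewrite exchange_big /=.
  rewrite [RHS]exchange_big /=; apply: eq_bigr => n _.
  under [RHS]eq_bigr do rewrite exchange_big /=.
  rewrite [RHS]exchange_big /= mulr_suml; apply: eq_bigr => m _.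
  rewrite /f mulr_sumr mulr_suml [RHS]exchange_big /=; apply: eq_bigr => l _.
  by rewrite /raise !mulr_sumr mulr_suml; apply: eq_bigr => k _; ring.
rewrite -T !bilE; move: (normF2 g F x) rE => N2 rE.
rewrite !mulr_sumr -sumrB; apply: eq_bigr => n _.
rewrite !mulr_suml !mulr_sumr -sumrB; apply: eq_bigr => m _.
by rewrite mxE rE; move: (f m n) => fmn; ring.
Qed.

End Contractions.

Section RiemannSymbol.
Context {R : realType}.

Lemma riemann_symbol (H G : 'I_4 -> 'I_4 -> 'I_4 -> 'I_4 -> R) X Y Z T :
  tensor4 (fun i j m n => 2^-1 * H m j n i + (2^-1 * H n i m j + (- 2^-1 * H m i n j
    + (- 2^-1 * H n j m i + (- 1 * G m i n j + G n i m j))))) X Y Z T =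
  2^-1 * (tensor4 H Z Y T X + tensor4 H T X Z Y - tensor4 H Z X T Y - tensor4 H T Y Z X)
  - tensor4 G Z X T Y + tensor4 G T X Z Y.
Proof.
rewrite (tensor4D (fun i j m n => 2^-1 * H m j n i)).
rewrite (tensor4D (fun i j m n => 2^-1 * H n i m j)).
rewrite (tensor4D (fun i j m n => - 2^-1 * H m i n j)).
rewrite (tensor4D (fun i j m n => - 2^-1 * H n j m i)).
rewrite (tensor4D (fun i j m n => - 1 * G m i n j)) !tensor4Z.
have [-> -> -> ->] := tensor4_perm H X Y Z T.
by have [-> _ -> _] := tensor4_perm G X Y Z T; ring.
Qed.

End RiemannSymbol.

(** * Kerr-Newman is aligned with each of its principal null directions *)

Section PrincipalFrame.
Context {R : realType}.
Local Notation pt := 'rV[R]_4.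
Variables (M a Q : R) (U : set pt) (openU : open U).
Hypothesis chartU : U `<=` KN_chart M a Q.
Variables (S0 : framed_spacetime R) (sg : R) (k k' : pt -> R).
(* [sg = 1] for the background frame, [sg = -1] once [f3] and [f4] are exchanged. *)
Hypothesis sgE : sg = 1 \/ sg = -1.
Local Notation g := (metric S0).
Hypothesis metE : forall y, U y -> g y = KN_metric M a Q y.
Hypothesis gT : forall y, U y -> (g y)^T = g y.
Hypothesis nf : forall y, U y -> null_frame (g y) S0 y.
Hypothesis chG : forall y l i j, U y -> has_gradient (christoffel g l i j) y.
Hypothesis f4E : forall y, U y -> f4 S0 y = k y *: null_vec M a Q sg y.
Hypothesis f3E : forall y, U y -> f3 S0 y = k' y *: null_vec M a Q (- sg) y.
Hypothesis hE : forall y, U y -> exists p w, p ^+ 2 + w ^+ 2 = (ev (eSig a) y)^-1 /\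
  fh S0 0 y = p *: hor1 + w *: hor2 a y /\ fh S0 1 y = - w *: hor1 + p *: hor2 a y.

Definition kn_entry (i j : 'I_4) : rexpr (R := R) :=
  match val i, val j with
  | 0%N, 0%N => ett M a Q | 0%N, 3%N => etp M a Q | 3%N, 0%N => etp M a Q
  | 3%N, 3%N => epp M a Q | 1%N, 1%N => err M a Q | 2%N, 2%N => eSig a | _, _ => Cst 0
  end.

Lemma kn_entryE (f : rexpr (R := R) -> rexpr) y i j : ev (f (Cst 0)) y = 0 ->
  kn_ev M a Q f y i j = ev (f (kn_entry i j)) y.
Proof.
move=> f0; rewrite /kn_ev mxE /kn_entry.
by case: i => [[|[|[|[|//]]]] ?]; case: j => [[|[|[|[|//]]]] ?] /=.
Qed.

Lemma defined_entry y i j : U y -> defined (kn_entry i j) y.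
Proof.
move=> /chartU/defined_metric[dtt dtp dpp drr dS]; rewrite /kn_entry.
by case: i => [[|[|[|[|//]]]] ?]; case: j => [[|[|[|[|//]]]] ?].
Qed.

Lemma metric_kn y : U y -> g y = kn_ev M a Q id y.
Proof. by move=> Uy; rewrite metE// KN_metricE//; exact: chartU. Qed.

Lemma metric_grad i j y : U y -> has_gradient (fun z => g z i j) y /\
  forall m, pderive m (fun z => g z i j) y = kn_ev M a Q (fdiff m) y i j.
Proof.
move=> Uy; have [G D] := grad_ev (defined_entry i j Uy).
have E z : U z -> ev (kn_entry i j) z = g z i j.
  by move=> Uz; rewrite metric_kn// kn_entryE.
have [G' D'] := grad_eq openU E Uy G; split=> // m.
by rewrite /pderive -D' [LHS]D kn_entryE.
Qed.

Lemma metric_grad2 n i j y : U y ->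
  has_gradient (fun z => pderive n (fun z => g z i j) z) y /\
  forall m, pderive m (fun z => pderive n (fun z => g z i j) z) y =
    kn_ev M a Q (fun e => fdiff m (fdiff n e)) y i j.
Proof.
move=> Uy; have [G D] := grad_ev (defined_fdiff n (defined_entry i j Uy)).
have E z : U z -> ev (fdiff n (kn_entry i j)) z = pderive n (fun z => g z i j) z.
  by move=> Uz; rewrite (metric_grad i j Uz).2 kn_entryE.
have [G' D'] := grad_eq openU E Uy G; split=> // m.
by rewrite /pderive -D' [LHS]D kn_entryE.
Qed.

(** Stationarity and axial symmetry: expressions in r and theta do not vary along t and phi. *)
Lemma ev_fdiff0 (m : 'I_4) (e : rexpr (R := R)) y :
  (m == 1) = false -> (m == 2) = false -> ev (fdiff m e) y = 0.
Proof.
move=> m1 m2; elim: e => //= [|||e -> f ->|e -> f ->|e ->]; rewrite ?m1 ?m2 ?mulr0n //; ring.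
Qed.

Lemma kn_ev0 f y : (forall e, ev (f e) y = 0) -> kn_ev M a Q f y = 0.
Proof.
move=> f0; apply/matrixP => i j; rewrite /kn_ev mxE !f0 mxE.
by case: i => [[|[|[|[|//]]]] ?]; case: j => [[|[|[|[|//]]]] ?].
Qed.

Lemma bil_linm (G H : 'M[R]_4) (c d : R) X Y :
  bil (c *: G + d *: H) X Y = c * bil G X Y + d * bil H X Y.
Proof. by rewrite /bil mulmxDr mulmxDl -!scalemxAr -!scalemxAl !mxE. Qed.

Let gu y : U y -> g y \in unitmx.
Proof. by move=> Uy; have [] := null_frame_inv (gT Uy) (nf Uy). Qed.
Let gG y i j : U y -> has_gradient (fun z => g z i j) y.
Proof. by move=> Uy; have [] := metric_grad i j Uy. Qed.
Let dgG y n i j : U y -> has_gradient (fun z => pderive n (fun z => g z i j) z) y.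
Proof. by move=> Uy; have [] := metric_grad2 n i j Uy. Qed.

Variables (x : pt) (Ux : U x).
Let Cx := chartU Ux.

Lemma schwarz m n i j : pderive m (fun z => pderive n (fun z => g z i j) z) x =
  pderive n (fun z => pderive m (fun z => g z i j) z) x.
Proof.
by rewrite (metric_grad2 n i j Ux).2 (metric_grad2 m i j Ux).2 !kn_entryE// fdiffC.
Qed.

Lemma dmetric_kn V : dmetric g x V =
  V 0 1 *: kn_ev M a Q (fdiff 1) x + V 0 2 *: kn_ev M a Q (fdiff 2) x.
Proof.
apply/matrixP => i j; rewrite dmetricE; last by move=> *; exact: gG.
rewrite sum4 !(metric_grad i j Ux).2.
rewrite (kn_ev0 (f := fdiff 0)); last by move=> e; exact: ev_fdiff0.
rewrite (kn_ev0 (f := fdiff 3)); last by move=> e; exact: ev_fdiff0.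
by rewrite !mxE !mulr0 addr0 add0r.
Qed.

Lemma frozen_connE A B Z : frozen_conn g x A B Z = frozen M a Q x A B Z.
Proof. by rewrite /frozen_conn !dmetric_kn !bil_linm. Qed.

Lemma frozen2E A B C D :
  tensor4 (fun m n i j => pderive m (fun z => pderive n (fun z => g z i j) z) x) A B C D
  = frozen2 M a Q x A B C D.
Proof.
pose P m n := kn_ev M a Q (fun e => fdiff m (fdiff n e)) x.
have E : tensor4 (fun m n i j => pderive m (fun z => pderive n (fun z => g z i j) z) x) A B C D
    = \sum_m \sum_n A 0 m * B 0 n * bil (P m n) C D.
  rewrite /tensor4; apply: eq_bigr => m _; apply: eq_bigr => n _.
  rewrite bilE exchange_big mulr_sumr; apply: eq_bigr => j _ /=.
  rewrite mulr_suml mulr_sumr; apply: eq_bigr => i _.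
  by rewrite (metric_grad2 n i j Ux).2 -/(P m n); ring.
have P0 (m n : 'I_4) : (m == 1) = false -> (m == 2) = false -> P m n = 0.
  by move=> m1 m2; apply: kn_ev0 => e; exact: ev_fdiff0.
have PC m n : P m n = P n m.
  by apply/matrixP => i j; rewrite /P !kn_entryE// fdiffC.
have b0 X Y : bil (0 : 'M[R]_4) X Y = 0 by rewrite /bil mulmx0 mul0mx mxE.
rewrite E !sum4 (P0 0 0)// (P0 0 1)// (P0 0 2)// (P0 0 3)// (P0 3 0)// (P0 3 1)//.
rewrite (P0 3 2)// (P0 3 3)// (PC 1 0) (PC 2 0) (PC 1 3) (PC 2 3) (P0 0 1)// (P0 0 2)//.
rewrite (P0 3 1)// (P0 3 2)// !b0 (PC 2 1) /frozen2 /ddmet -/(P 1 1) -/(P 1 2) -/(P 2 2).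
by ring.
Qed.

Local Notation Sg := (ev (eSig a) x).
Local Notation Dl := (ev (eDel M a Q) x).
Local Notation L s := (null_vec M a Q s x).
Local Notation N2 := (hor2 a x).

Let giE : invmx (g x) = dual_metric S0 x.
Proof. by have [] := null_frame_inv (gT Ux) (nf Ux). Qed.

(** The normalization g(e_3, e_4) = - 2 against [met_LL], which gives - 2 Sigma / Delta for opposite
    signs. *)
Lemma null_scale : k x * k' x = Dl / Sg.
Proof.
have [_ E _ _] := nf Ux; move: E.
rewrite f3E// f4E// bilZl bilZr metric_kn// met_LL//.
have S_ := chart_Sig Cx; have D_ := chart_Del Cx.
have -> : - sg * sg - 1 = -2 by case: sgE => ->; rewrite ?mulN1r ?mulr1; ring.
move=> E; apply: (mulIf (_ : -2 * Sg / Dl != 0)).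
  by rewrite !mulf_neq0 ?invr_eq0 ?oppr_eq0 ?pnatr_eq0.
apply: etrans (_ : _ = -2) _; first by rewrite -[RHS]E; ring.
by field; rewrite S_ D_.
Qed.

Lemma frozen_lin A B (c : R) Z Z' : frozen M a Q x A B (c *: Z + Z') =
  c * frozen M a Q x A B Z + frozen M a Q x A B Z'.
Proof. by rewrite /frozen /dmet !bilDr !bilZr !mxE; ring. Qed.

Lemma frozen_scale A B (c : R) Z : frozen M a Q x A B (c *: Z) = c * frozen M a Q x A B Z.
Proof. by rewrite /frozen /dmet !bilZr !mxE; ring. Qed.

(** The inverse metric does not see the choice of frame: the scales enter through k k' and the
    rotation through p^2 + w^2 = 1 / Sigma. *)
Lemma gamma_sqE A B C D : tensor4 (gamma2 g x) A B C D = gamma_sq M a Q x A B C D.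
Proof.
pose Lw l : 'M[R]_4 := \matrix_(i, j) lower_gamma g x l i j.
have PE X Y Z : pair_row (fun l => bil (Lw l) X Y) Z = 2^-1 * frozen M a Q x X Y Z.
  rewrite -frozen_connE -sum_lower_gamma; last by move=> *; exact: gG.
  apply: eq_bigr => l _; rewrite bilE exchange_big mulr_suml; apply: eq_bigr => j _ /=.
  by rewrite !mulr_suml; apply: eq_bigr => i _; rewrite mxE; ring.
have -> : tensor4 (gamma2 g x) A B C D =
    \sum_l \sum_m dual_metric S0 x l m * bil (Lw l) A B * bil (Lw m) C D.
  rewrite -giE; under tensor4_eq do rewrite gamma2E.
  rewrite tensor4_sum; apply: eq_bigr => l _; rewrite tensor4_sum; apply: eq_bigr => m _.
  rewrite -mulrA -tensor4_prod12 -tensor4Z; apply: tensor4_eq => i j p q.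
  by rewrite !mxE mulrA.
rewrite dual_metric_contract !PE f3E// f4E//.
have [p [w [pw [-> ->]]]] := hE Ux.
rewrite !frozen_scale !frozen_lin !frozen_scale /gamma_sq -pw.
have -> : Dl / (2 * Sg) = 2^-1 * (k x * k' x).
  by rewrite null_scale; field; rewrite (chart_Sig Cx).
by case: sgE => ->; rewrite ?opprK; field.
Qed.

Lemma riemE X Y Z T : tensor4 (fun i j m n => riemann g i j m n x) X Y Z T =
  riem4 M a Q x X Y Z T.
Proof.
pose H m n i j := pderive m (fun z => pderive n (fun z => g z i j) z) x.
have RL i j m n : riemann g i j m n x =
    2^-1 * H m j n i + (2^-1 * H n i m j + (- 2^-1 * H m i n j + (- 2^-1 * H n j m i
    + (- 1 * gamma2 g x m i n j + gamma2 g x n i m j)))).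
  rewrite (riemann_lower openU gT gu gG dgG chG Ux schwarz) -!/(H _ _ _ _).
  move: (H m j n i) (H n i m j) (H m i n j) (H n j m i) (gamma2 g x m i n j)
    (gamma2 g x n i m j) => *; ring.
rewrite (tensor4_eq _ _ _ _ RL) riemann_symbol.
rewrite !frozen2E !gamma_sqE /riem4.
by do 6! (match goal with |- context [frozen2 M a Q x ?A ?B ?C ?D] =>
  move: (frozen2 M a Q x A B C D) => ? | |- context [gamma_sq M a Q x ?A ?B ?C ?D] =>
  move: (gamma_sq M a Q x A B C D) => ? end); ring.
Qed.

Hypothesis FT : (faraday S0 x)^T = - faraday S0 x.
Hypothesis einstein : forall m n, einstein_residual g (faraday S0) m n x = 0.
Hypothesis bF : forall b, betaF S0 x b = 0.

Let Fh4 b : bil (faraday S0 x) (fh S0 b x) (f4 S0 x) = 0.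
Proof. exact: bF. Qed.
Let F4h b : bil (faraday S0 x) (f4 S0 x) (fh S0 b x) = 0.
Proof. by rewrite bil_anti// Fh4 oppr0. Qed.
Let F44 : bil (faraday S0 x) (f4 S0 x) (f4 S0 x) = 0.
Proof.
have := bil_anti (f4 S0 x) (f4 S0 x) FT; move: (bil _ _ _) => u; lra.
Qed.

Lemma ricci_44 : bil (\matrix_(i, j) ricci g i j x) (f4 S0 x) (f4 S0 x) = 0.
Proof.
have [[_ g44] _ _ _] := nf Ux.
by rewrite (einstein_ricci _ _ einstein giE) F44 !F4h g44; ring.
Qed.

Lemma ricci_h4 b : bil (\matrix_(i, j) ricci g i j x) (fh S0 b x) (f4 S0 x) = 0.
Proof.
have [_ _ gh _] := nf Ux; have [_ gh4] := gh b.
by rewrite (einstein_ricci _ _ einstein giE) F44 !F4h Fh4 gh4; ring.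
Qed.

Let hor_lin b : exists p w, fh S0 b x = p *: hor1 + w *: N2.
Proof.
have [p [w [_ [h0 h1]]]] := hE Ux.
by case: (I2P b) => ->; [exists p, w | exists (- w), p].
Qed.

(** Each Ricci term carries Ric(4,4) or one of g(4,4), g(4,a), all zero; Weyl then equals Riemann
    here. *)
Lemma weyl_4h4h b c : weyl g x (f4 S0 x) (fh S0 b x) (f4 S0 x) (fh S0 c x) = 0.
Proof.
have [[_ g44] _ gh _] := nf Ux; have [_ gb4] := gh b; have [_ gc4] := gh c.
rewrite weyl_vec ricci_44 g44 [bil (g x) (f4 S0 x) _]bil_sym ?gT// gb4 gc4.
rewrite !(mul0r, mulr0, subr0, addr0).
have [p [w ->]] := hor_lin b; have [p' [w' ->]] := hor_lin c.
(* Padding with 0 gives scaled vectors the shape c X + X' expected by [tensor4_lin]. *)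
rewrite f4E// -[k x *: _]addr0 -[w *: _]addr0 -[w' *: _]addr0.
rewrite !(tensor4_lin, tensor4_zero) !riemE.
by rewrite !riem4_alpha//; [ring|..]; auto.
Qed.

Lemma weyl_4h43 b : weyl g x (f4 S0 x) (fh S0 b x) (f4 S0 x) (f3 S0 x) = 0.
Proof.
have [[_ g44] _ gh _] := nf Ux; have [gh3 gh4] := gh b.
rewrite weyl_vec ricci_44 g44 ricci_h4 gh4 gh3.
rewrite !(mul0r, mulr0, subr0, addr0).
have [p [w ->]] := hor_lin b.
rewrite f4E// f3E// -[k x *: _]addr0 -[w *: _]addr0 -[k' x *: _]addr0.
rewrite !(tensor4_lin, tensor4_zero) !riemE.
by rewrite !riem4_beta//; [ring|..]; auto.
Qed.

Definition null_entry (i : 'I_4) : rexpr (R := R) :=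
  match val i with
  | 0%N => Mul (Add (Mul Rad Rad) (Cst (a ^+ 2))) (Inv (eDel M a Q)) | 1%N => Cst sg
  | 3%N => Mul (Cst a) (Inv (eDel M a Q)) | _ => Cst 0
  end.

Lemma null_entryE y i : ev (null_entry i) y = null_vec M a Q sg y 0 i.
Proof.
by rewrite /null_vec /vec4 mxE /null_entry; case: i => [[|[|[|[|//]]]] ?].
Qed.

Lemma null_grad i : has_gradient (fun y => null_vec M a Q sg y 0 i) x /\
  forall v, 'D_v (fun y => null_vec M a Q sg y 0 i) x = v 0 1 * null_vec_r M a Q x 0 i.
Proof.
have D_ := chart_Del Cx.
have df : defined (null_entry i) x.
  by rewrite /null_entry; case: i => [[|[|[|[|//]]]] ?] //=; repeat split.
have [G D] := grad_ev df.
have [G' D'] := grad_eq openU (fun y _ => null_entryE y i) Ux G; split=> // v.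
rewrite -D' (G v).2 sum4 !D /null_vec_r /vec4 mxE /null_entry {D D' G G' df}; move: D_.
by case: i => [[|[|[|[|//]]]] ?] /= D_; field.
Qed.

Lemma cov_eq Y Y' X : (forall y, U y -> Y y = Y' y) -> smooth_field x Y ->
  smooth_field x Y' /\ cov g X Y x = cov g X Y' x.
Proof.
move=> E GY.
have H i := grad_eq openU (fun y Uy => congr1 (fun Z : pt => Z 0 i) (E y Uy)) Ux (GY i).
split=> [i|]; first exact: (H i).1.
by apply/rowP => i; rewrite !mxE (H i).2 E.
Qed.

Hypothesis kG : has_gradient k x.

(** Orthogonality of Z to the null vector removes the derivative of the scale k. *)
Lemma cov_f4 V Z : bil (g x) (L sg) Z = 0 -> bil (g x) (cov g V (f4 S0) x) Z =
  k x * (V x 0 1 * bil (g x) (null_vec_r M a Q x) Z + 2^-1 * frozen M a Q x (V x) (L sg) Z).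
Proof.
move=> LZ; have Gl i := (null_grad i).1.
have G4 := smooth_fieldZ kG Gl.
have [_ <-] := cov_eq V (fun y Uy => esym (f4E Uy)) G4.
rewrite (cov_scaler g V kG Gl) bilDl !bilZl LZ mulr0 add0r bil_cov ?gT ?gu//; last first.
  by move=> *; exact: gG.
rewrite frozen_connE; congr (_ * (_ + _)).
have -> : \row_i 'D_(V x) (fun y => null_vec M a Q sg y 0 i) x =
    V x 0 1 *: null_vec_r M a Q x by apply/rowP => i; rewrite mxE (null_grad i).2 [RHS]mxE.
by rewrite bilZl.
Qed.

Local Notation r := (rad x).
Local Notation s := (sin (theta x)).
Local Notation c := (cos (theta x)).

Let gL1 : bil (g x) (L sg) hor1 = 0.
Proof. by rewrite metric_kn// met_L1. Qed.
Let gL2 : bil (g x) (L sg) N2 = 0.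
Proof. by rewrite metric_kn// met_L2. Qed.
Let gLh p w : bil (g x) (L sg) (p *: hor1 + w *: N2) = 0.
Proof. by rewrite bilDr !bilZr gL1 gL2 !mulr0 addr0. Qed.

Lemma frozen_linA p A A' B Z : frozen M a Q x (p *: A + A') B Z =
  p * frozen M a Q x A B Z + frozen M a Q x A' B Z.
Proof. by rewrite /frozen /dmet !(bilDl, bilZl) !mxE; ring. Qed.

Lemma frozen_scaleA p A B Z : frozen M a Q x (p *: A) B Z = p * frozen M a Q x A B Z.
Proof. by rewrite /frozen /dmet !bilZl !mxE; ring. Qed.

(** Computes chi: the first term is a multiple of the horizontal metric and the second is
    antisymmetric, hence no shear. *)
Lemma cov_horizontal V p w p' w' : V x = p *: hor1 + w *: N2 ->
  bil (g x) (cov g V (f4 S0) x) (p' *: hor1 + w' *: N2) =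
  k x * (sg * r * (p * p' + w * w') + a * c * (p * w' - w * p')).
Proof.
move=> VE; rewrite cov_f4 ?gLh// VE frozen_linA frozen_scaleA !frozen_lin !frozen_scale.
rewrite frozen_1L1// frozen_1L2// frozen_2L1// frozen_2L2//.
have -> : (p *: hor1 + w *: N2) 0 1 = 0.
  by rewrite /hor1 /hor2 mxE mxE [X in _ + X]mxE !vec4E !mulr0 addr0.
by rewrite mul0r add0r; congr (_ * _); field.
Qed.

(** Serves xi with tau = sg, where both terms vanish, and eta with tau = - sg. *)
Lemma cov_null V l tau p w : V x = l *: L tau ->
  bil (g x) (cov g V (f4 S0) x) (p *: hor1 + w *: N2) =
  k x * l * ((sg * tau - 1) * p * a ^+ 2 * s * c / Dl + (sg - tau) * w * r * a * s / Dl).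
Proof.
move=> VE; rewrite cov_f4 ?gLh// VE frozen_scaleA frozen_lin frozen_scale.
rewrite frozen_LL1// frozen_LL2// metric_kn// bilDr !bilZr met_dL1// met_dL2//.
have -> : (l *: L tau) 0 1 = l * tau by rewrite mxE /null_vec vec4E.
have D_ := chart_Del Cx; move: (ev (eDel M a Q) x) D_ => D0 D_.
by field.
Qed.

Lemma derive_rexpr e f v : defined e x -> (forall y, U y -> f y = ev e y) ->
  'D_v f x = v 0 1 * ev (fdiff 1 e) x + v 0 2 * ev (fdiff 2 e) x.
Proof.
move=> de fE; have [G D] := grad_ev de.
have [_ <-] := grad_eq openU (fun y Uy => esym (fE y Uy)) Ux G.
rewrite (G v).2 sum4 !D (@ev_fdiff0 0)// (@ev_fdiff0 3)//; ring.
Qed.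

(** With [erhod], the real and imaginary parts of Q / conj(q)^2 = Q q^2 / Sigma^2; the real part
    changes sign when the null directions are exchanged. *)
Definition erho : rexpr (R := R) := Mul (Cst (sg * Q)) (Mul (Add (Mul Rad Rad)
  (Mul (Cst (- a ^+ 2)) (Mul Cos Cos))) (Inv (Mul (eSig a) (eSig a)))).
Definition erhod : rexpr (R := R) := Mul (Cst (2 * Q * a)) (Mul (Mul Rad Cos)
  (Inv (Mul (eSig a) (eSig a)))).

Hypothesis rhoE : forall y, U y -> rhoF S0 y = ev erho y.
Hypothesis rhodE : forall y, U y -> rhodF S0 y = ev erhod y.

Lemma aligned_principal : aligned S0 x.
Proof.
have S_ := chart_Sig Cx; have D_ := chart_Del Cx; have kk := null_scale.
have [p [w [pw [h0 h1]]]] := hE Ux.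
have def1 : defined erho x by repeat split; rewrite mulf_neq0.
have def2 : defined erhod x by repeat split; rewrite mulf_neq0.
have Drho v := derive_rexpr v def1 rhoE; have Drhod v := derive_rexpr v def2 rhodE.
have cW := weyl_curvature_like openU gT gu gG dgG chG Ux schwarz.
apply: (aligned_of cW (weyl_trace gT gu Ux) giE weyl_4h4h weyl_4h43 bF).
- have sg2 : sg * sg = 1 by case: sgE => ->; ring.
  by move=> b; rewrite /xi; have [p' [w' ->]] := hor_lin b;
    rewrite (cov_null _ _ (f4E Ux)) sg2 !subrr !mul0r addr0 !mulr0.
- split.
    by rewrite /chi h0 h1 (cov_horizontal p w h0) (cov_horizontal (- w) p h1); ring.
  by rewrite /chi h0 h1 (cov_horizontal (- w) p h0) (cov_horizontal p w h1); ring.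
(* For sg = 1 this is 2 k / q, and conj(tr X) = 2 k / conj(q) is minus the logarithmic derivative
   along k d_r of Q / conj(q)^2. *)
- have T : trX S0 x = ((2 * k x * sg * r / Sg) +i* (- (2 * k x * a * c / Sg)))%C.
    rewrite /trX /trR /atrR !sum2 !volE /chi h0 h1 !(cov_horizontal _ _ h0)
      !(cov_horizontal _ _ h1).
    by rewrite -pw; congr (_ +i* _)%C; ring.
  have v1 : f4 S0 x 0 1 = k x * sg by rewrite f4E// mxE /null_vec vec4E.
  have v2 : f4 S0 x 0 2 = 0 by rewrite f4E// mxE /null_vec vec4E mulr0.
  rewrite T /deriveC /PF /= rhoE// rhodE//.
  have := S_; have := cos2sin2 (theta x); move: (Drho (f4 S0 x)) (Drhod (f4 S0 x)).
  rewrite v1 v2 /=.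
  move=> DR DI cs S0'; apply: complexP; rewrite ?ReImE /= ?DR ?DI {DR DI};
    move: (k x) r s c cs S0' => k0 r0 s0 c0 cs S1; case: sgE => ->; by field: cs.
- have etaE p' w' : 2^-1 * bil (g x) (cov g (f3 S0) (f4 S0) x) (p' *: hor1 + w' *: N2) =
      (- (p' * a ^+ 2 * s * c) + sg * w' * r * a * s) / Sg.
    rewrite (cov_null _ _ (f3E Ux)) kk; move: (ev (eSig a) x) (ev (eDel M a Q) x) S_ D_.
    move: r s c => r0 s0 c0 S1 D1 S_ D_.
    by case: sgE => ->; field; rewrite S_ D_.
  have H : Hc S0 x 0 = (((- (p * a ^+ 2 * s * c) + sg * w * r * a * s) / Sg) +i*
      ((w * a ^+ 2 * s * c + sg * p * r * a * s) / Sg))%C.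
    rewrite /Hc /cplx1 /dual1 sum2 !volE /eta h0 h1 !etaE.
    by congr (_ +i* _)%C; ring.
  have v1 : fh S0 0 x 0 1 = 0.
    by rewrite h0 mxE mxE [X in _ + X]mxE /hor1 /hor2 !vec4E !mulr0 addr0.
  have v2 : fh S0 0 x 0 2 = p.
    by rewrite h0 mxE mxE [X in _ + X]mxE /hor1 /hor2 !vec4E mulr0 mulr1 addr0.
  have w1 : fh S0 1 x 0 1 = 0.
    by rewrite h1 mxE mxE [X in _ + X]mxE /hor1 /hor2 !vec4E !mulr0 addr0.
  have w2 : fh S0 1 x 0 2 = - w.
    by rewrite h1 mxE mxE [X in _ + X]mxE /hor1 /hor2 !vec4E mulr0 mulr1 addr0.
  rewrite H /deriveC /PF /= rhoE// rhodE//.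
  have := S_; have := cos2sin2 (theta x); move: (Drho (fh S0 0 x)) (Drhod (fh S0 0 x)).
  move: (Drho (fh S0 1 x)) (Drhod (fh S0 1 x)); rewrite v1 v2 w1 w2 /=.
  move=> DR DI DR' DI' cs S0'; apply: complexP; rewrite ?ReImE ?Re_nat ?Im_nat /=
    ?DR ?DI ?DR' ?DI' {DR DI DR' DI'};
    move: r s c cs S0' => r0 s0 c0 cs S1;
    case: sgE => ->; by field: cs.
Qed.

End PrincipalFrame.

(** * Reading the principal frame off the background data *)

Section Background.
Context {R : realType}.
Local Notation pt := 'rV[R]_4.
Variables (M a Q : R) (S0 : framed_spacetime R) (x : pt).
Hypotheses (Cx : KN_chart M a Q x) (bg : KN_background M a Q S0 x).

(** The background gives the factor lam only by existence at each point. Since [null_vec] has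
    r-component 1, lam is the r-component of [f4], which is differentiable in the point. *)
Lemma background_f4 : f4 S0 x = f4 S0 x 0 1 *: null_vec M a Q 1 x.
Proof.
have [_ [l _ [-> _]] _ _] := bg.
rewrite [in RHS]mxE [KN_e4 M a Q x 0 1]mxE mulr1.
by rewrite /null_vec /KN_e4 ev_Del expr2.
Qed.

Lemma background_f3 : f3 S0 x = - f3 S0 x 0 1 *: null_vec M a Q (-1) x.
Proof.
have [_ [l l0 [_ ->]] _ _] := bg; have l_ := lt0r_neq0 l0;
have D_ := chart_Del Cx; have S_ := chart_Sig Cx.
rewrite [in RHS]mxE [KN_e3 M a Q x 0 1]mxE.
apply/rowP => i; rewrite mxE [RHS]mxE /null_vec /KN_e3 /vec4 !mxE.
move: S_ D_; rewrite ev_Sig ev_Del => S_ D_.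
by case: i => [[|[|[|[|//]]]] ?] /=; field; rewrite ?S_ ?D_ ?l_.
Qed.

Lemma background_hor : exists p w, p ^+ 2 + w ^+ 2 = (ev (eSig a) x)^-1 /\
  fh S0 0 x = p *: hor1 + w *: hor2 a x /\ fh S0 1 x = - w *: hor1 + p *: hor2 a x.
Proof.
have [_ _ [psi [-> ->]] _] := bg; have S_ := chart_Sig Cx; have s_ := chart_sin Cx.
have A2 : absq a x ^+ 2 = ev (eSig a) x.
  by rewrite ev_Sig sqr_sqrtr// addr_ge0// ?sqr_ge0// mulr_ge0// sqr_ge0.
have A_ : absq a x != 0 by rewrite -sqrf_eq0 A2.
(* Rotation angle and normalization 1 / |q| are merged into p and w; these are used pointwise, so
   psi may be arbitrary from point to point. *)
exists (cos psi / absq a x), (sin psi / absq a x).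
have e1 : KN_e1 a x = (absq a x)^-1 *: hor1.
  apply/rowP => i; rewrite mxE /KN_e1 /hor1 /vec4 !mxE.
  by case: i => [[|[|[|[|//]]]] ?] /=; rewrite ?(mulr0, mulr1).
have e2 : KN_e2 a x = (absq a x)^-1 *: hor2 a x.
  apply/rowP => i; rewrite mxE /KN_e2 /hor2 /vec4 !mxE.
  by case: i => [[|[|[|[|//]]]] ?] /=; field; rewrite ?A_ ?s_.
split; first by rewrite !expr_div_n -mulrDl cos2Dsin2 A2 div1r.
by rewrite e1 e2 !scalerA mulNr.
Qed.

Lemma background_betaF b : betaF S0 x b = 0.
Proof. by have [_ _ _ [B _ _]] := bg; have [] := B b. Qed.

Lemma background_betabF b : betabF S0 x b = 0.
Proof. by have [_ _ _ [_ B _]] := bg; have [] := B b. Qed.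

Lemma background_PF : rhoF S0 x = ev (erho a Q 1) x /\ rhodF S0 x = ev (erhod a Q) x.
Proof.
have [_ _ _ [_ _ P]] := bg; have S_ := chart_Sig Cx.
(* |q|^2 is nonzero on the chart, so r and a cos(theta) do not vanish together. *)
have q_ : conjc (q a x) ^+ 2 != 0.
  rewrite expf_neq0//; apply/eqP => q0; move: S_; rewrite ev_Sig.
  have r0 : rad x = 0 by have := congr1 (@complex.Re R) q0.
  have c0 : a * cos (theta x) = 0.
    by have := congr1 (@complex.Im R) q0 => /= /eqP; rewrite oppr_eq0 => /eqP.
  by rewrite /q2 -exprMn r0 c0 expr0n addr0 eqxx.
suff E : PF S0 x = (ev (erho a Q 1) x +i* ev (erhod a Q) x)%C.
  by split; [have := congr1 (@complex.Re R) E | have := congr1 (@complex.Im R) E].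
rewrite P; apply: (mulIf q_); rewrite divfK//.
move: S_; have := cos2sin2 (theta x); rewrite /q expr2 /=.
move: (rad x) (sin _) (cos _) => r0 s0 c0 cs S_.
by apply: complexP; rewrite ?ReImE /=; field: cs.
Qed.

End Background.

Theorem lemma5p4 (R : realType) (M a Q : R)
    (subextremal : Num.sqrt (a ^+ 2 + Q ^+ 2) < M)
    (U : set 'rV[R]_4) (openU : open U) (chartU : U `<=` KN_chart M a Q)
    (eps0 : R) (eps0_gt0 : 0 < eps0)
    (S : R -> framed_spacetime R)
    (pertS : linear_perturbation M a Q eps0 U S) :
  [/\ gauge_invariant2 eps0 U S Ac /\ gauge_invariant2 eps0 U S Abc,
      gauge_invariant2 eps0 U S frakF /\ gauge_invariant2 eps0 U S frakFb,
      gauge_invariant1 eps0 U S frakB /\ gauge_invariant1 eps0 U S frakBb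
    & gauge_invariant1 eps0 U S frakX /\ gauge_invariant1 eps0 U S frakXb].
Proof.
have [smS nfS bg eqs] := pertS.
have e0 : `|0 : R| < eps0 by rewrite normr0.
have Cx y : U y -> KN_chart M a Q y by move/chartU.
have metE y : U y -> metric (S 0) y = KN_metric M a Q y by move=> /bg[].
have gT y : U y -> (metric (S 0) y)^T = metric (S 0) y by move=> Uy; have [] := nfS _ _ e0 Uy.
have FT y : U y -> (faraday (S 0) y)^T = - faraday (S 0) y.
  by move=> Uy; have [] := nfS _ _ e0 Uy.
have nf y : U y -> null_frame (metric (S 0) y) (S 0) y by move=> Uy; have [] := nfS _ _ e0 Uy.
have chG y l i j : U y -> has_gradient (christoffel (metric (S 0)) l i j) y.
  by move=> Uy; exact: (sf_grad openU (sf_christoffel openU smS nfS l i j) e0 Uy).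
(* The residual is O(eps^2), hence zero at eps = 0. *)
have ein y m n : U y -> einstein_residual (metric (S 0)) (faraday (S 0)) m n y = 0.
  by move=> /eqs[E _ _]; exact: (negligible_at0 (E m n)).
have fG4 y : U y -> has_gradient (fun z => f4 (S 0) z 0 1) y.
  by move=> Uy; exact: (sf_grad openU (sf_f4 smS 1) e0 Uy).
have fG3 y : U y -> has_gradient (fun z => - f3 (S 0) z 0 1) y.
  move=> Uy; rewrite (_ : (fun z => _) = fun z => -1 * f3 (S 0) z 0 1); last first.
    by apply/funext => z; rewrite mulN1r.
  exact: (gradM (grad_cst (-1) y).1 (sf_grad openU (sf_f3 smS 1) e0 Uy)).1.
have F4 y : U y -> f4 (S 0) y = f4 (S 0) y 0 1 *: null_vec M a Q 1 y.
  by move=> Uy; exact: background_f4 (bg y Uy).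
have F3 y : U y -> f3 (S 0) y = - f3 (S 0) y 0 1 *: null_vec M a Q (-1) y.
  by move=> Uy; exact: background_f3 (Cx y Uy) (bg y Uy).
have hE y Uy := background_hor (Cx y Uy) (bg y Uy).
have PE y Uy := background_PF (Cx y Uy) (bg y Uy).
apply: (main_of_aligned eps0_gt0 openU smS nfS) => x Ux.
- apply: (aligned_principal openU chartU (or_introl erefl) metE gT nf chG F4 F3 hE) => //.
  + exact: FT.
  + by move=> m n; exact: ein.
  + by move=> b; exact: background_betaF (bg x Ux) b.
  + exact: fG4.
  + by move=> y /PE[].
  + by move=> y /PE[].
(* The other null direction: the same lemma for the swapped frame, with sign - 1 and the two scale
   functions exchanged. *)
- have nf' y : U y -> null_frame (metric (S 0) y) (swap (S 0)) y.
    by move=> Uy; have [] := null_swap nfS e0 Uy.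
  have F4' y : U y -> f4 (S 0) y = f4 (S 0) y 0 1 *: null_vec M a Q (- -1) y.
    by move=> Uy; rewrite opprK; exact: F4.
  apply: (@aligned_principal _ M a Q U openU chartU (swap (S 0)) (-1) _ _
    (or_intror erefl) metE gT nf' chG F3 F4' hE) => //.
  + exact: FT.
  + by move=> m n; exact: ein.
  + by move=> b; exact: background_betabF (bg x Ux) b.
  + exact: fG3.
  + move=> y Uy; have [E _] := PE y Uy.
    have -> : rhoF (swap (S 0)) y = - rhoF (S 0) y.
      by rewrite /rhoF /= bil_anti ?FT// mulrN.
    by rewrite E /= !mulNr.
  + by move=> y /PE[].
Qed.
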